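(* Let $Q\subset\mathbb{P}$ generate the integers $K$, let $J$ be the integers generated by the primes not in $Q$, and assume that $\sum_{p\in\mathbb{P}\setminus Q}p^{-1}<\infty$. Then $$\psi_K(s):=\frac1s\zeta_K(s)-\frac{\zeta_J^{-1}(1)}{s-1}$$ extends, in the sense of distributions, to a function in $L^1_{\mathrm{loc}}$ on the abscissa $\sigma=1$ if and only if $$\sum_{p\in\mathbb{P}\setminus Q}\frac{\log\log p}{p}<\infty.$$ For $q>1$, the extension is in $L^q_{\mathrm{loc}}$ on the abscissa $\sigma=1$ if $$\sum_{p\in\mathbb{P}\setminus Q}\frac{\log^{1/q'}p}{p}<\infty,$$ where $q'>1$ is the real number satisfying $q^{-1}+q'^{-1}=1$. Conversely, if $$\sum_{p\in\mathbb{P}\setminus Q}\frac{\log^{1/q'}p}{p}=\infty,$$ then the extension of $\psi_K$ to $\sigma=1$ is not in $L^r_{\mathrm{loc}}$ for $r>q$.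
   Context: $\mathbb{N}=\{1,2,3,\dots\}$ and $\mathbb{P}$ is the set of prime numbers. The integers generated by a set of primes $Q$ are the positive integers all of whose prime factors lie in $Q$ (including $1$). For $K\subset\mathbb{N}$, $\zeta_K(s)=\sum_{n\in K}n^{-s}$, absolutely convergent for $\operatorname{Re}s>1$. Write $s=\sigma+\mathrm{i}t$. Under the assumption on the primes, $\zeta_J(1)=\sum_{n\in J}n^{-1}<\infty$, and $\zeta_J^{-1}(1)=1/\zeta_J(1)$. The extension of $\psi_K$ to $\sigma=1$ in the sense of distributions is the limit of $t\mapsto\psi_K(1+\delta+\mathrm{i}t)$ as $\delta\to0^+$ in the sense of distributions on $\mathbb{R}$. $f\in L^p_{\mathrm{loc}}$ means $f\in L^p(E)$ for every compact $E\subset\mathbb{R}$. $\log^{a}p=(\log p)^a$. *)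

(* Defs.v *)
From mathcomp Require Import all_boot all_order all_algebra.
From mathcomp Require Import all_classical all_reals all_analysis.
From mathcomp Require Import complex.
Import Order.TTheory GRing.Theory Num.Theory.
Import numFieldNormedType.Exports.

Set Implicit Arguments.
Unset Strict Implicit.
Unset Printing Implicit Defensive.

Local Open Scope classical_set_scope.
Local Open Scope ring_scope.
Local Open Scope complex_scope.

Definition primeset : set nat := [set p : nat | prime p].

Definition generated (Q : set nat) : set nat :=
  [set n : nat | (0 < n)%N /\ forall p : nat, prime p -> (p %| n)%N -> Q p].

Section Zeta.
Variable R : realType.
Implicit Types (K Q : set nat) (n : nat) (s : R[i]).

(* n ^ (- (sigma + i t)) = n ^ (- sigma) (cos (t ln n) - i sin (t ln n)),
   used for n >= 1 only. *)
Definition dirichlet_term n s : R[i] :=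
  (n%:R `^ (- complex.Re s))%:C *
  (cos (complex.Im s * ln n%:R) -i* sin (complex.Im s * ln n%:R)).

Definition zeta K s : R[i] :=
  limn (fun N : nat =>
    \sum_(0 <= n < N | n \in K) dirichlet_term n s : (R[i] : numFieldType)).

Definition psi Q s : R[i] :=
  s^-1 * zeta (generated Q) s
  - (zeta (generated (primeset `\` Q)) 1)^-1 / (s - 1).

End Zeta.

Section Distributions.
Variable R : realType.
Notation mu := (@lebesgue_measure R).

Definition integralC (f : R -> R[i]) : R[i] :=
  (\int[mu]_t complex.Re (f t))%R +i* (\int[mu]_t complex.Im (f t))%R.

Definition smooth (g : R -> R) : Prop :=
  forall (k : nat) (x : R), derivable (derive1n k g) x 1.

Definition test_function (phi : R -> R[i]) : Prop :=
  [/\ smooth (fun t => complex.Re (phi t)),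
      smooth (fun t => complex.Im (phi t)) &
      compact (closure [set t | phi t != 0])].

Definition Lloc (p : R) (f : R -> R[i]) : Prop :=
  forall E : set R, compact E ->
  [/\ measurable_fun E (fun t => complex.Re (f t)),
      measurable_fun E (fun t => complex.Im (f t)) &
      (\int[mu]_(t in E) (complex.Re `|f t| `^ p)%:E < +oo)%E].

Definition boundary_distribution (F : R[i] -> R[i]) (f : R -> R[i]) : Prop :=
  forall phi : R -> R[i], test_function phi ->
  integralC (fun t => F ((1 + delta) +i* t) * phi t) @[delta --> 0^'+]
  --> (integralC (fun t => f t * phi t) : (R[i] : numFieldType)).

(* The distributional limit of [t |-> F (1 + delta + i t)] as [delta -> 0+]
   is (represented by) an [L^p_loc] function, which for [p >= 1] is then
   unique almost everywhere. *)
Definition extension_in_Lloc (F : R[i] -> R[i]) (p : R) : Prop :=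
  exists2 f : R -> R[i], Lloc p f & boundary_distribution F f.

End Distributions.

(* Main.v *)
Require Import Defs.
From mathcomp Require Import all_boot all_order all_algebra.
From mathcomp Require Import all_classical all_reals all_analysis.
From mathcomp Require Import complex measurable_realfun.
From mathcomp Require Import ring lra zify.
Import Order.TTheory GRing.Theory Num.Theory.
Import numFieldNormedType.Exports.

Set Implicit Arguments.
Unset Strict Implicit.
Unset Printing Implicit Defensive.

Local Open Scope classical_set_scope.
Local Open Scope ring_scope.
Local Open Scope complex_scope.

(** Write [P] for the primes outside [Q], [J] for the integers they generate
    and [z = s - 1].

    Sieving the primes of [P] out of all the integers gives
    zeta_K(s) = zeta(s) G(s), where G(s) is the product of 1 - p^(-s) over [P];
    since the sum of 1/p over [P] is finite, G converges uniformly on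
    Re s >= 1.  Sieving [J] by the same primes leaves only 1, so
    G(1) = 1 / zeta_J(1).  Comparing n^(-1-z) with the telescoping difference
    n^(-z) - (n+1)^(-z) gives zeta(1 + z) = (1 + h(z)) / z, where
    h(z) = O(|z| (1 + |z|)) on Re z >= 0.  Together ([psiE])

      psi_K(1 + z) = (h(z)/z - 1)/(1 + z) G(1 + z) + (G(1 + z) - G(1))/z.

    The right-hand side also makes sense for Re z = 0, z <> 0, and is there the
    pointwise limit of psi_K.  Its first term is locally bounded, so the
    question is how singular (G(1 + it) - G(1))/t is at t = 0.

    Upper bound.  Since |p^(-z) - 1| is at most 6 |z| ln p / (1 + |t| ln p),
    where t = Im z, the quotient is dominated, uniformly in Re z, by a multiple
    of the sum H(t) over [P] of p^(-1) ln p / (1 + |t| ln p)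
    ([cabs_psi_ext_le]).  The integral of a single term of H over [-M, M] is
    2 p^(-1) ln (1 + M ln p), that is ln ln p / p up to constant factors and a
    multiple of 1/p ([integral_Hs1]); hence H is locally integrable when the sum
    of ln ln p / p converges, and dominated convergence turns the pointwise
    limit into the distributional one.  The q-th power of
    H is handled by Jensen's inequality with weights (ln p)^(1/q') / p, because
    the integral of (L / (1 + |t| L))^q is of order L^(q - 1) and
    q / q' = q - 1 ([integral_Hsq]).

    Lower bound.  Taking real parts of the factors,
    |G(1 + it)| - G(1) is at least a constant times the sum of
    (1 - cos (t ln p)) / p ([cabs_psi_ext_ge]).  Any locally integrable
    function representing the boundary distribution agrees almost everywhere
    on ]0, 1[ with the pointwise limit ([boundary_ae_eq]), so up to constants
    its modulus dominates that sum divided by t.  Integrating against the weight 1 gives each prime the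
    mass (ln ln p - 2) / p.  Integrating against t^(-1/q') gives the mass
    (ln p)^(1/q') / (64 p), up to finitely many primes, and for a function g in
    L^r with r > q Young's inequality bounds the other side:
    |g| t^(-1/q') <= |g|^r + t^(-r'/q'), where r' is the conjugate exponent of
    r and r'/q' < 1 ([weighted_sum_bounded]). *)

(** * Modulus and convergence of complex numbers *)

Section Cabs.
Variable R : realType.
Implicit Types (z w : R[i]).

(** The norm of [R[i]] takes its values in [R[i]]; estimates are carried out with
    this real-valued modulus. *)
Definition cabs z : R := complex.Re `|z|.

Lemma cabsE z : `|z| = (cabs z)%:C.
Proof. by rewrite /cabs normc_def. Qed.

Lemma cabs_def z : cabs z = Num.sqrt (complex.Re z ^+ 2 + complex.Im z ^+ 2).
Proof. by rewrite /cabs normc_def. Qed.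

Lemma cabs_ge0 z : 0 <= cabs z.
Proof. by rewrite cabs_def sqrtr_ge0. Qed.

Lemma cabsD z w : cabs (z + w) <= cabs z + cabs w.
Proof. by rewrite -lecR rmorphD /= -!cabsE ler_normD. Qed.

Lemma cabsM z w : cabs (z * w) = cabs z * cabs w.
Proof. by apply: complexI; rewrite rmorphM /= -!cabsE normrM. Qed.

Lemma cabsV z : cabs z^-1 = (cabs z)^-1.
Proof. by apply: complexI; rewrite fmorphV /= -!cabsE normfV. Qed.

Lemma cabsN z : cabs (- z) = cabs z.
Proof. by apply: complexI; rewrite -!cabsE normrN. Qed.

Lemma cabs0 : cabs 0 = 0.
Proof. by apply: complexI; rewrite -!cabsE normr0. Qed.

Lemma cabs1 : cabs 1 = 1.
Proof. by apply: complexI; rewrite -!cabsE normr1. Qed.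

Lemma cabsR (a : R) : cabs a%:C = `|a|.
Proof. by rewrite cabs_def /= expr0n /= addr0 sqrtr_sqr. Qed.

Lemma cabs_eq0 z : (cabs z == 0) = (z == 0).
Proof. by rewrite -(inj_eq (@complexI R)) -cabsE normr_eq0. Qed.

Lemma cabs_gt0 z : (0 < cabs z) = (z != 0).
Proof. by rewrite lt_def cabs_ge0 cabs_eq0 andbT. Qed.

Lemma cabsB z w : cabs (z - w) <= cabs z + cabs w.
Proof. by rewrite -(cabsN w) cabsD. Qed.

Lemma cabs_distrC z w : cabs (z - w) = cabs (w - z).
Proof. by rewrite -cabsN opprB. Qed.

Lemma cabs_sub_le z w : cabs z - cabs w <= cabs (z - w).
Proof. by rewrite lerBlDr -{1}(subrK w z) cabsD. Qed.

Lemma cabs_sum (I : Type) (r : seq I) (P : pred I) (F : I -> R[i]) :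
  cabs (\sum_(i <- r | P i) F i) <= \sum_(i <- r | P i) cabs (F i).
Proof.
elim/big_ind2: _ => // [|a b c d h1 h2]; first by rewrite cabs0.
by rewrite (le_trans (cabsD _ _))// lerD.
Qed.

Lemma cabs_prod (I : Type) (r : seq I) (P : pred I) (F : I -> R[i]) :
  cabs (\prod_(i <- r | P i) F i) = \prod_(i <- r | P i) cabs (F i).
Proof. by apply: (big_morph cabs); [exact: cabsM|exact: cabs1]. Qed.

Lemma Re_le_cabs z : `|complex.Re z| <= cabs z.
Proof. by rewrite cabs_def -sqrtr_sqr ler_wsqrtr// lerDl sqr_ge0. Qed.

Lemma Im_le_cabs z : `|complex.Im z| <= cabs z.
Proof. by rewrite cabs_def -sqrtr_sqr ler_wsqrtr// lerDr sqr_ge0. Qed.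

Lemma cabs_le_ReIm z : cabs z <= `|complex.Re z| + `|complex.Im z|.
Proof.
have -> : z = (complex.Re z)%:C + (complex.Im z)%:C * 'i.
  by case: z => a b /=; simpc.
rewrite (le_trans (cabsD _ _))// cabsM !cabsR.
have -> : cabs 'i = 1 by rewrite cabs_def /= expr0n /= add0r expr1n sqrtr1.
by rewrite mulr1; simpc.
Qed.

Lemma cReD z w : complex.Re (z + w) = complex.Re z + complex.Re w.
Proof. by case: z; case: w. Qed.
Lemma cImD z w : complex.Im (z + w) = complex.Im z + complex.Im w.
Proof. by case: z; case: w. Qed.
Lemma cReN z : complex.Re (- z) = - complex.Re z.
Proof. by case: z. Qed.
Lemma cImN z : complex.Im (- z) = - complex.Im z.
Proof. by case: z. Qed.
Lemma cReM z w :
  complex.Re (z * w) = complex.Re z * complex.Re w - complex.Im z * complex.Im w.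
Proof. by case: z; case: w. Qed.
Lemma cImM z w :
  complex.Im (z * w) = complex.Re z * complex.Im w + complex.Im z * complex.Re w.
Proof. by case: z => a b; case: w => c d /=; rewrite /GRing.mul /=. Qed.

Lemma eq_ReIm z w : complex.Re z = complex.Re w -> complex.Im z = complex.Im w -> z = w.
Proof. by case: z => a b; case: w => c d /= -> ->. Qed.

(** Componentwise convergence lets the limit theorems for real functions be used
    directly; [cvgCE] identifies it with convergence in the norm of [R[i]]. *)
Definition cvgC (T : Type) (F : set_system T) (f : T -> R[i]) (l : R[i]) : Prop :=
  (complex.Re (f x) @[x --> F] --> complex.Re l) /\
  (complex.Im (f x) @[x --> F] --> complex.Im l).

Section Cvg.
Context {T : Type} {F : set_system T} {FF : Filter F}.
Implicit Types (f g : T -> R[i]) (l k : R[i]).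

Lemma cvgC_dist f l :
  cvgC F f l <-> (forall e : R, 0 < e -> \forall x \near F, cabs (l - f x) < e).
Proof.
split=> [[/cvgrPdist_lt hr /cvgrPdist_lt hi] e e0|h].
  have e20 : 0 < e / 2 by rewrite divr_gt0.
  apply: filterS2 (hr _ e20) (hi _ e20) => x h1 h2.
  by rewrite (le_lt_trans (cabs_le_ReIm _))// cReD cImD cReN cImN (splitr e) ltrD.
split; apply/cvgrPdist_lt => e e0; apply: filterS (h e e0) => x; apply: le_lt_trans.
  by rewrite -cReN -cReD; exact: Re_le_cabs.
by rewrite -cImN -cImD; exact: Im_le_cabs.
Qed.

Lemma cvgCE f l : cvgC F f l <-> f x @[x --> F] --> (l : (R[i] : numFieldType)).
Proof.
rewrite cvgC_dist; split=> [h|hl e e0].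
  apply: (proj2 (@cvgrPdist_lt R[i] (R[i] : numFieldType) _ F FF f l)) => -[e e'] /= ee.
  (* positive elements of R[i] are real *)
  have /eqP e'0 : e' == 0 by move: ee; rewrite ltcE /= => /andP[/eqP -> _].
  subst e'; move: ee; rewrite (ltcR 0 e) => e0.
  by apply: filterS (h e e0) => x; rewrite cabsE -ltcR.
have h := proj1 (@cvgrPdist_lt R[i] (R[i] : numFieldType) _ F FF f l) hl.
have := h e%:C; rewrite ltcR => /(_ e0).
by apply: filterS => x; rewrite cabsE ltcR.
Qed.

Lemma cvg_cabs f l : cvgC F f l -> cabs (f x) @[x --> F] --> cabs l.
Proof.
move=> /cvgC_dist h; apply/cvgrPdist_lt => e e0; apply: filterS (h e e0) => x.
apply: le_lt_trans; rewrite ler_norml cabs_sub_le andbT lerNl opprB.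
by rewrite cabs_distrC cabs_sub_le.
Qed.

Lemma cvgC_cst l : cvgC F (fun=> l) l.
Proof. by split; exact: cvg_cst. Qed.

Lemma cvgC_N f l : cvgC F f l -> cvgC F (fun x => - f x) (- l).
Proof.
move=> [h1 h2]; rewrite /cvgC cReN cImN; split.
  by under eq_fun do rewrite cReN; exact: cvgN.
by under eq_fun do rewrite cImN; exact: cvgN.
Qed.

Lemma cvgC_D f g l k : cvgC F f l -> cvgC F g k -> cvgC F (fun x => f x + g x) (l + k).
Proof.
move=> [h1 h2] [h3 h4]; rewrite /cvgC cReD cImD; split.
  by under eq_fun do rewrite cReD; exact: cvgD.
by under eq_fun do rewrite cImD; exact: cvgD.
Qed.

Lemma cvgC_B f g l k : cvgC F f l -> cvgC F g k -> cvgC F (fun x => f x - g x) (l - k).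
Proof. by move=> fl gk; apply: cvgC_D; [exact: fl|exact: cvgC_N]. Qed.

Lemma cvgC_M f g l k : cvgC F f l -> cvgC F g k -> cvgC F (fun x => f x * g x) (l * k).
Proof.
move=> [h1 h2] [h3 h4]; rewrite /cvgC cReM cImM; split.
  by under eq_fun do rewrite cReM; apply: cvgB; exact: cvgM.
by under eq_fun do rewrite cImM; apply: cvgD; exact: cvgM.
Qed.

Lemma cReV z : complex.Re z^-1 = complex.Re z / (complex.Re z ^+ 2 + complex.Im z ^+ 2).
Proof. by case: z. Qed.
Lemma cImV z : complex.Im z^-1 = - (complex.Im z / (complex.Re z ^+ 2 + complex.Im z ^+ 2)).
Proof. by case: z. Qed.

Lemma cvgC_V f l : l != 0 -> cvgC F f l -> cvgC F (fun x => (f x)^-1) l^-1.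
Proof.
move=> l0 [h1 h2]; rewrite /cvgC cReV cImV.
have D : complex.Re (f x) ^+ 2 + complex.Im (f x) ^+ 2 @[x --> F] -->
    complex.Re l ^+ 2 + complex.Im l ^+ 2.
  by under eq_fun do rewrite !expr2; rewrite !expr2; apply: cvgD; exact: cvgM.
have n0 : complex.Re l ^+ 2 + complex.Im l ^+ 2 != 0.
  move: l0; rewrite -cabs_eq0 cabs_def; apply: contra => /eqP ->.
  by rewrite sqrtr0.
split.
  by under eq_fun do rewrite cReV; apply: cvgM => //; exact: cvgV.
by under eq_fun do rewrite cImV; apply: cvgN; apply: cvgM => //; exact: cvgV.
Qed.

Lemma cvgC_sum (I : Type) (r : seq I) (P : pred I) (f : I -> T -> R[i]) (l : I -> R[i]) :
  (forall i, cvgC F (f i) (l i)) ->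
  cvgC F (fun x => \sum_(i <- r | P i) f i x) (\sum_(i <- r | P i) l i).
Proof.
move=> h; elim: r => [|i r IH].
  by under eq_fun do rewrite big_nil; rewrite big_nil; exact: cvgC_cst.
under eq_fun do rewrite big_cons; rewrite big_cons.
by case: (P i); [exact: cvgC_D|exact: IH].
Qed.

Lemma cvgC_prod (I : Type) (r : seq I) (P : pred I) (f : I -> T -> R[i]) (l : I -> R[i]) :
  (forall i, cvgC F (f i) (l i)) ->
  cvgC F (fun x => \prod_(i <- r | P i) f i x) (\prod_(i <- r | P i) l i).
Proof.
move=> h; elim: r => [|i r IH].
  by under eq_fun do rewrite big_nil; rewrite big_nil; exact: cvgC_cst.
under eq_fun do rewrite big_cons; rewrite big_cons.
by case: (P i); [exact: cvgC_M|exact: IH].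
Qed.
End Cvg.

Lemma cvgC_unique (T : Type) (F : set_system T) (FF : ProperFilter F) (f : T -> R[i]) (l l' : R[i]) :
  cvgC F f l -> cvgC F f l' -> l = l'.
Proof.
move=> [h1 h2] [h3 h4]; apply: eq_ReIm.
  by rewrite -(cvg_lim _ h1)// -(cvg_lim _ h3).
by rewrite -(cvg_lim _ h2)// -(cvg_lim _ h4).
Qed.

Lemma limnC_eq (f : nat -> R[i]) (l : R[i]) :
  cvgC \oo f l -> limn (f : nat -> (R[i] : numFieldType)) = l.
Proof. move=> /cvgCE h; apply: (@cvg_lim (R[i] : numFieldType) _ _ _ _ f l h).
exact: norm_hausdorff. Qed.

Lemma cabs_ge_Re z : complex.Re z <= cabs z.
Proof. exact: le_trans (ler_norm _) (Re_le_cabs z). Qed.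

End Cabs.
(** * Limits controlled by a summable majorant *)

Section Tail.
Variable R : realType.
Definition tail (m : nat -> R) (N : nat) : R := limn (series m) - series m N.

Lemma is_cvg_bounded_series (m : nat -> R) (B : R) : (forall n, 0 <= m n) ->
  (forall N, series m N <= B) -> cvgn (series m).
Proof.
move=> m0 mB; apply: nondecreasing_is_cvgn.
  by move=> i j ij; rewrite -subr_ge0 sub_series_geq// sumr_ge0.
by exists B => _ [N _ <-]; exact: mB.
Qed.

Lemma series_le_lim (m : nat -> R) N : (forall n, 0 <= m n) -> cvgn (series m) ->
  series m N <= limn (series m).
Proof.
move=> m0 mc; apply: nondecreasing_cvgn_le => //.
by move=> i j ij; rewrite -subr_ge0 sub_series_geq// sumr_ge0.
Qed.

Lemma cvg_tail (m : nat -> R) : cvgn (series m) -> tail m N @[N --> \oo] --> (0 : R).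
Proof.
move=> mc; rewrite -(subrr (limn (series m))).
by apply: cvgB => //; exact: cvg_cst.
Qed.

Lemma cabs_dist_tail (U : nat -> R[i]) (m : nat -> R) N M :
  (forall n, cabs (U n.+1 - U n) <= m n) -> (N <= M)%N ->
  cabs (U M - U N) <= series m M - series m N.
Proof.
move=> Um NM; rewrite sub_series_geq// -(telescope_sumr U NM).
by rewrite (le_trans (cabs_sum _ _ _))// ler_sum.
Qed.

(** Increments dominated by a summable series make both components absolutely
    convergent telescoping series. *)
Lemma cvgC_of_summable (U : nat -> R[i]) (m : nat -> R) :
  cvgn (series m) -> (forall n, cabs (U n.+1 - U n) <= m n) ->
  exists l : R[i], cvgC \oo U l.
Proof.
move=> mc Um.
have Hr : cvgn (fun n => complex.Re (U n)).
  have H : cvgn (series (fun n => complex.Re (U n.+1 - U n))).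
    apply: normed_cvg; apply: series_le_cvg mc => n //=.
      exact: le_trans (cabs_ge0 _) (Um n).
    exact: le_trans (Re_le_cabs _) (Um n).
  have -> : (fun n => complex.Re (U n)) =
    (fun n => complex.Re (U 0%N) + series (fun n => complex.Re (U n.+1 - U n)) n).
    apply/funext => n; rewrite /series /=.
    under eq_bigr do rewrite cReD cReN.
    by rewrite telescope_sumr// addrC subrK.
  by apply: is_cvgD => //; exact: is_cvg_cst.
have Hi : cvgn (fun n => complex.Im (U n)).
  have H : cvgn (series (fun n => complex.Im (U n.+1 - U n))).
    apply: normed_cvg; apply: series_le_cvg mc => n //=.
      exact: le_trans (cabs_ge0 _) (Um n).
    exact: le_trans (Im_le_cabs _) (Um n).
  have -> : (fun n => complex.Im (U n)) =
    (fun n => complex.Im (U 0%N) + series (fun n => complex.Im (U n.+1 - U n)) n).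
    apply/funext => n; rewrite /series /=.
    under eq_bigr do rewrite cImD cImN.
    by rewrite telescope_sumr// addrC subrK.
  by apply: is_cvgD => //; exact: is_cvg_cst.
exists (limn (fun n => complex.Re (U n)) +i* limn (fun n => complex.Im (U n))).
by split.
Qed.

Lemma cabs_lim_tail (U : nat -> R[i]) (m : nat -> R) l N :
  (forall n, 0 <= m n) -> cvgn (series m) -> (forall n, cabs (U n.+1 - U n) <= m n) ->
  cvgC \oo U l -> cabs (l - U N) <= tail m N.
Proof.
move=> m0 mc Um Ul.
have H : cabs (U M - U N) @[M --> \oo] --> cabs (l - U N).
  by apply: cvg_cabs; apply: cvgC_B; [exact: Ul|exact: cvgC_cst].
rewrite -(cvg_lim _ H)//; apply: limr_le; first by apply/cvg_ex; eexists; exact: H.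
near=> M; rewrite (le_trans (cabs_dist_tail Um _))//; first by near: M; exact: nbhs_infty_ge.
by rewrite /tail lerB// series_le_lim.
Unshelve. all: by end_near. Qed.

(** Interchange of limits: the approximants [U N] converge along [F], and both the
    approximation error along [F] and the error at the limit are at most [e N],
    which tends to 0. *)
Lemma cvgC_uniform (T : Type) (F : set_system T) (FF : Filter F)
  (U : nat -> T -> R[i]) (V : T -> R[i]) (U0 : nat -> R[i]) (V0 : R[i]) (e : nat -> R) :
  e N @[N --> \oo] --> (0 : R) ->
  (forall N, cvgC F (U N) (U0 N)) ->
  (forall N, \forall x \near F, cabs (V x - U N x) <= e N) ->
  (forall N, cabs (V0 - U0 N) <= e N) ->
  cvgC F V V0.
Proof.
move=> e0 UU0 VU V0U0; apply/cvgC_dist => eps eps0.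
have eps30 : 0 < eps / 3 by rewrite divr_gt0.
have [N _ /(_ N (leqnn N))] := proj1 (cvgrPdist_lt _ _) e0 _ eps30.
rewrite /= sub0r normrN => /(le_lt_trans (ler_norm _)) eN.
have /cvgC_dist /(_ _ eps30) := UU0 N.
apply: filterS2 (VU N) => x h1 h2.
have -> : V0 - V x = (V0 - U0 N) + (U0 N - U N x) - (V x - U N x).
  by ring.
rewrite (le_lt_trans (cabsB _ _))//.
have := cabsD (V0 - U0 N) (U0 N - U N x); have := V0U0 N.
move: h1 h2 eN; lra.
Qed.
End Tail.

(** * The exponential e^(-xs) *)

Section RealBounds.
Variable R : realType.
Implicit Types (a b x y : R).

Lemma norm_sin_le x : `|sin x| <= `|x|.
Proof.
wlog x0 : x / 0 <= x => [H|].
  case: (leP 0 x) => [/H//|x0]; rewrite -(normrN x) -(normrN (sin x)) -sinN; apply: H.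
  by rewrite oppr_ge0 ltW.
(* sin x = cos c * x for some c *)
have [c _] := @MVT_segment R sin cos 0 x x0 (fun y _ => is_derive_sin y)
  (continuous_subspaceT (@continuous_sin R)).
rewrite sin0 !subr0 => ->; rewrite normrM -[leRHS]mul1r ler_wpM2r//.
exact: cos_max.
Qed.

Lemma one_sub_cos_half x : 1 - cos x = 2 * sin (x / 2) ^+ 2.
Proof.
have {1}-> : x = (x / 2) *+ 2 by rewrite mulr2n -splitr.
rewrite cos_mulr2n; have := cos2Dsin2 (x / 2).
by rewrite mulr2n; move: (cos _) (sin _) => c d h; lra.
Qed.

Lemma one_sub_cos_ge0 x : 0 <= 1 - cos x.
Proof. by rewrite subr_ge0 cos_le1. Qed.

Lemma one_sub_cos_le_norm x : 1 - cos x <= `|x|.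
Proof.
rewrite one_sub_cos_half -real_normK ?num_real// expr2.
have := sin_max (x / 2); have := norm_sin_le (x / 2); rewrite normrM.
have -> : `|2^-1 : R| = 2^-1 by rewrite gtr0_norm// invr_gt0.
have := normr_ge0 (sin (x/2)).
nra.
Qed.

Lemma one_sub_cos_le_sqr x : 1 - cos x <= x ^+ 2.
Proof.
rewrite one_sub_cos_half -real_normK ?num_real// -(real_normK (num_real x)) !expr2.
have := norm_sin_le (x / 2); rewrite normrM.
have -> : `|2^-1 : R| = 2^-1 by rewrite gtr0_norm// invr_gt0.
have := normr_ge0 (sin (x/2)); have := normr_ge0 x.
nra.
Qed.

Lemma norm_id_sub_sin_le x : `|x - sin x| <= x ^+ 2.
Proof.
wlog x0 : x / 0 <= x => [H|].
  case: (leP 0 x) => [/H//|x0]; rewrite -(normrN (x - _)) opprD -sinN -sqrrN; apply: H.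
  by rewrite oppr_ge0 ltW.
have D : forall y : R, is_derive y 1 (fun y => y - sin y) (1 - cos y).
  by move=> y; apply: is_deriveB.
have [c] := @MVT_segment R (fun y => y - sin y) (fun y => 1 - cos y) 0 x x0 (fun y _ => D y)
  (continuous_subspaceT (fun y => cvgB cvg_id (@continuous_sin R y))).
rewrite in_itv/= => /andP[c0 cx]; rewrite sin0 !subr0 => ->.
rewrite normrM (ger0_norm x0) expr2 ler_wpM2r// ger0_norm ?one_sub_cos_ge0//.
by rewrite (le_trans (one_sub_cos_le_norm c))// ger0_norm.
Qed.

Lemma one_sub_expRN_le a : 1 - expR (- a) <= a.
Proof. by have := expR_ge1Dx (- a); lra. Qed.

Lemma expRN_sub1D_le a : 0 <= a -> expR (- a) - 1 + a <= a ^+ 2.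
Proof.
move=> a0; rewrite expRN.
have h : (expR a)^-1 <= (1 + a)^-1.
  by rewrite lef_pV2 ?posrE ?expR_gt0 ?expR_ge1Dx// ltr_wpDr.
rewrite (le_trans (lerD (lerB h (lexx 1)) (lexx a)))//.
have -> : (1 + a)^-1 - 1 + a = a ^+ 2 / (1 + a) by field; lra.
by rewrite ler_pdivrMr ?ltr_wpDr// ler_peMr ?sqr_ge0// lerDl.
Qed.
End RealBounds.

Section CExp.
Variable R : realType.
Implicit Types (x y a : R) (s z w : R[i]).

(** This is e^(-xs); for x = ln n it is the term n^(-s) of a Dirichlet series
    ([dirichlet_termE]). *)
Definition cexpN x s : R[i] :=
  (expR (- (x * complex.Re s)))%:C *
  (cos (x * complex.Im s) -i* sin (x * complex.Im s)).

Lemma Re_cexpN x s : complex.Re (cexpN x s) = expR (- (x * complex.Re s)) * cos (x * complex.Im s).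
Proof. by rewrite /cexpN cReM /= mul0r subr0. Qed.

Lemma Im_cexpN x s : complex.Im (cexpN x s) = - (expR (- (x * complex.Re s)) * sin (x * complex.Im s)).
Proof. by rewrite /cexpN cImM /= mul0r addr0 mulrN. Qed.

Lemma cexpN0l s : cexpN 0 s = 1.
Proof. by apply: eq_ReIm; rewrite ?Re_cexpN ?Im_cexpN !mul0r ?oppr0 ?expR0 ?cos0 ?sin0 ?mulr1 ?mulr0 ?oppr0. Qed.

Lemma cexpND x y s : cexpN (x + y) s = cexpN x s * cexpN y s.
Proof.
by apply: eq_ReIm; [rewrite [RHS]cReM|rewrite [RHS]cImM];
  rewrite !(Re_cexpN, Im_cexpN) !mulrDl opprD expRD ?cosD ?sinD; ring.
Qed.

Lemma cexpNDr x s z : cexpN x (s + z) = cexpN x s * cexpN x z.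
Proof.
by apply: eq_ReIm; [rewrite [RHS]cReM|rewrite [RHS]cImM];
  rewrite !(Re_cexpN, Im_cexpN) ?cReD ?cImD !mulrDr opprD expRD ?cosD ?sinD; ring.
Qed.

Lemma cexpN_real x a : cexpN x a%:C = (expR (- (x * a)))%:C.
Proof.
by apply: eq_ReIm; rewrite ?Re_cexpN ?Im_cexpN /= mulr0 ?cos0 ?sin0 ?mulr1// mulr0 oppr0.
Qed.

Lemma cabs_cexpN x s : cabs (cexpN x s) = expR (- (x * complex.Re s)).
Proof.
rewrite cabs_def Re_cexpN Im_cexpN sqrrN !exprMn -mulrDr cos2Dsin2 mulr1.
by rewrite sqrtr_sqr ger0_norm ?expR_ge0.
Qed.

Lemma cexpNZ x s : cexpN x s = cexpN 1 (x%:C * s).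
Proof.
by apply: eq_ReIm; rewrite !(Re_cexpN, Im_cexpN) ?cReM ?cImM /= !mul0r ?subr0 ?addr0 !mul1r.
Qed.

Lemma cabs_cexpN_sub1_le2 x s : 0 <= x -> 0 <= complex.Re s -> cabs (cexpN x s - 1) <= 2.
Proof.
move=> x0 s0; rewrite (le_trans (cabsB _ _))// cabs1 cabs_cexpN.
have : expR (- (x * complex.Re s)) <= 1 by rewrite expR_le1 oppr_le0 mulr_ge0.
lra.
Qed.

Lemma cabs_cexpN_sub1 x s : 0 <= x -> 0 <= complex.Re s ->
  cabs (cexpN x s - 1) <= 3 * (x * cabs s).
Proof.
move=> x0 s0; rewrite cexpNZ.
have -> : x * cabs s = cabs (x%:C * s) by rewrite cabsM cabsR ger0_norm.
have : 0 <= complex.Re (x%:C * s) by rewrite cReM /= mul0r subr0 mulr_ge0.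
move: (x%:C * s) => w w0; rewrite (le_trans (cabs_le_ReIm _))//.
rewrite cReD cImD cReN cImN Re_cexpN Im_cexpN !mul1r /= oppr0 addr0 normrN normrM.
have ha : 0 <= expR (- complex.Re w) <= 1 by rewrite expR_ge0 expR_le1 oppr_le0.
rewrite (@ger0_norm _ (expR _)) ?expR_ge0//.
have h1 := one_sub_expRN_le (complex.Re w).
have h2 := one_sub_cos_le_norm (complex.Im w); have h3 := one_sub_cos_ge0 (complex.Im w).
have h4 := norm_sin_le (complex.Im w); have h5 := normr_ge0 (sin (complex.Im w)).
have h6 := Im_le_cabs w; have h7 := cabs_ge_Re w.
move: ha h1 h2 h3 h4 h5 h6 h7; set e := expR _; set c := cos _; set b := `|sin _|.
set A := complex.Re w; set B := `|complex.Im w| => /andP[e0 e1] h1 h2 h3 h4 h5 h6 h7.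
have : `|e * c - 1| <= A + B.
  have -> : e * c - 1 = - ((1 - e) + e * (1 - c)) by ring.
  rewrite normrN ger0_norm; first by nra.
  by rewrite addr_ge0 ?subr_ge0// mulr_ge0.
by nra.
Qed.

(** The second-order expansion is what makes the terms of [zreg] of size 1/n^2;
    the first-order bound [cabs_cexpN_sub1] would only give 1/n. *)
Lemma cabs_cexpN_sub1D x s : 0 <= x -> 0 <= complex.Re s ->
  cabs (cexpN x s - 1 + x%:C * s) <= 4 * (x * cabs s) ^+ 2.
Proof.
move=> x0 s0; rewrite cexpNZ.
have -> : x * cabs s = cabs (x%:C * s) by rewrite cabsM cabsR ger0_norm.
have : 0 <= complex.Re (x%:C * s) by rewrite cReM /= mul0r subr0 mulr_ge0.
move: (x%:C * s) => w w0; rewrite (le_trans (cabs_le_ReIm _))//.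
rewrite !cReD !cImD cReN cImN Re_cexpN Im_cexpN !mul1r /= oppr0 addr0.
have -> : cabs w ^+ 2 = complex.Re w ^+ 2 + complex.Im w ^+ 2.
  by rewrite cabs_def sqr_sqrtr// addr_ge0 ?sqr_ge0.
have h1 := one_sub_expRN_le (complex.Re w).
have h1' := expR_ge1Dx (- complex.Re w).
have h1'' := expRN_sub1D_le w0.
have h2 := one_sub_cos_le_sqr (complex.Im w); have h3 := one_sub_cos_ge0 (complex.Im w).
have h4 := norm_sin_le (complex.Im w); have h5 := norm_id_sub_sin_le (complex.Im w).
have ha : 0 <= expR (- complex.Re w) <= 1 by rewrite expR_ge0 expR_le1 oppr_le0.
have h6 : complex.Im w ^+ 2 = `|complex.Im w| ^+ 2 by rewrite real_normK// num_real.
move: ha h1 h1' h1'' h2 h3 h4 h5 h6 w0; set e := expR _; set c := cos _; set b := sin _.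
set A := complex.Re w; set B := complex.Im w => /andP[e0 e1] h1 h1' h1'' h2 h3 h4 h5 h6 w0.
have H1 : `|e * c - 1 + A| <= A ^+ 2 + B ^+ 2.
  have -> : e * c - 1 + A = (e - 1 + A) - e * (1 - c) by ring.
  rewrite (le_trans (ler_normB _ _))// lerD//.
    by rewrite ger0_norm//; lra.
  rewrite ger0_norm ?mulr_ge0//; nra.
have H2 : `|- (e * b) + B| <= B ^+ 2 + A * `|B|.
  have -> : - (e * b) + B = (B - b) + (1 - e) * b by ring.
  rewrite (le_trans (ler_normD _ _))// lerD// normrM.
  rewrite ler_pM// ger0_norm//; lra.
have : A * `|B| <= A ^+ 2 + B ^+ 2 by rewrite h6; have := normr_ge0 B; nra.
rewrite !expr2 in h2 h5 h6 H1 H2 *.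
by nra.
Qed.

Lemma dirichlet_termE (n : nat) s : (0 < n)%N -> dirichlet_term n s = cexpN (ln n%:R) s.
Proof.
move=> n0; rewrite /dirichlet_term /cexpN /powR pnatr_eq0 gtn_eqF//.
by rewrite mulNr (mulrC (complex.Re s)) (mulrC (complex.Im s)).
Qed.

Lemma dirichlet_termM (m n : nat) s : (0 < m)%N -> (0 < n)%N ->
  dirichlet_term (m * n) s = dirichlet_term m s * dirichlet_term n s.
Proof.
move=> m0 n0; rewrite !dirichlet_termE ?muln_gt0 ?m0// natrM lnM ?posrE ?ltr0n//.
exact: cexpND.
Qed.

Lemma cabs_dirichlet_term (n : nat) s : (0 < n)%N ->
  cabs (dirichlet_term n s) = n%:R `^ (- complex.Re s).
Proof.
move=> n0; rewrite dirichlet_termE// cabs_cexpN /powR pnatr_eq0 gtn_eqF//.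
by rewrite mulNr mulrC.
Qed.

Lemma dirichlet_term1 (n : nat) : (0 < n)%N -> dirichlet_term n (1 : R[i]) = (n%:R^-1)%:C.
Proof.
move=> n0; rewrite dirichlet_termE// cexpN_real mulr1 expRN lnK// posrE ltr0n//.
Qed.

Lemma cvgC_cexpN (T : Type) (F : set_system T) (FF : Filter F) (f : T -> R[i]) s x :
  cvgC F f s -> cvgC F (fun t => cexpN x (f t)) (cexpN x s).
Proof.
move=> [h1 h2].
have E : expR (- (x * complex.Re (f t))) @[t --> F] --> expR (- (x * complex.Re s)).
  have I : - (x * complex.Re (f t)) @[t --> F] --> - (x * complex.Re s).
    by apply: cvgN; apply: cvgM => //; exact: cvg_cst.
  exact: (cvg_comp _ _ I (@continuous_expR R _)).
have I : x * complex.Im (f t) @[t --> F] --> x * complex.Im s.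
  apply: cvgM => //; exact: cvg_cst.
split.
  rewrite Re_cexpN; under eq_fun do rewrite Re_cexpN; apply: cvgM => //.
  exact: (cvg_comp _ _ I (@continuous_cos R _)).
rewrite Im_cexpN; under eq_fun do rewrite Im_cexpN; apply: cvgN; apply: cvgM => //.
exact: (cvg_comp _ _ I (@continuous_sin R _)).
Qed.
End CExp.

(** * Sieving by finitely many primes *)

Section Sieve.

Definition setsum (V : nmodType) (F : nat -> V) (A : set nat) (N : nat) : V :=
  \sum_(0 <= n < N | n \in A) F n.

(** The multiples of p below N are the p n with n below the upper integral part
    of N / p. *)
Lemma sum_multiples (V : nmodType) (F : nat -> V) (A : set nat) (p N : nat) : (0 < p)%N ->
  (forall n, A (p * n)%N <-> A n) ->
  \sum_(0 <= n < N | (n \in A) && (p %| n)%N) F n =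
  setsum (fun n => F (p * n)%N) A ((N + p.-1) %/ p).
Proof.
move=> p0 Ap; rewrite /setsum; elim: N => [|N IH].
  by rewrite add0n divn_small ?prednK// !big_geq.
rewrite big_mkcond big_nat_recr//= -big_mkcond IH {IH}.
have [/dvdnP[k ->]|pN] := boolP (p %| N)%N.
  have -> : ((k * p + p.-1) %/ p = k)%N.
    by rewrite divnMDl// divn_small ?addn0// prednK.
  have -> : (((k * p).+1 + p.-1) %/ p = k.+1)%N.
    by rewrite addSnnS prednK// divnMDl// divnn p0 addn1.
  rewrite [in RHS]big_mkcond big_nat_recr//= -big_mkcond andbT; congr (_ + _).
  rewrite mulnC; congr (if _ then _ else _); apply/idP/idP => /set_mem h; apply/mem_set.
    by apply/Ap.
  by apply/Ap.
rewrite andbF addr0; congr bigop.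
have -> // : ((N + p.-1) %/ p = (N.+1 + p.-1) %/ p)%N.
rewrite addSnnS prednK// {1 2}(divn_eq N p) -!addnA !divnMDl//.
have r0 : (0 < N %% p)%N by rewrite lt0n; rewrite /dvdn in pN.
have rp := ltn_pmod N p0.
have -> : (N %% p + p.-1 = 1 * p + (N %% p).-1)%N by lia.
have -> : (N %% p + p = 1 * p + N %% p)%N by lia.
have rp' : ((N %% p).-1 < p)%N by lia.
by rewrite !divnMDl// (divn_small rp) (divn_small rp').
Qed.

Definition sieved (P A : set nat) (N : nat) : set nat :=
  [set n | A n /\ forall p, P p -> (p < N)%N -> ~~ (p %| n)%N].

Variable P : set nat.
Hypothesis Pprime : P `<=` primeset.

Lemma sieved0 A : sieved P A 0 = A.
Proof. by apply/seteqP; split=> n; [case|move=> An; split]. Qed.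

Lemma sieved_notin A N : ~ P N -> sieved P A N.+1 = sieved P A N.
Proof.
move=> PN; apply/seteqP; split=> n [An h]; split=> // p Pp.
  by move=> /ltnW pN; apply: h.
by rewrite ltnS leq_eqVlt => /predU1P[pN|]; [subst p|exact: h].
Qed.

Lemma sieved_in A N : P N -> sieved P A N.+1 = [set n | sieved P A N n /\ ~~ (N %| n)%N].
Proof.
move=> PN; apply/seteqP; split=> n.
  by move=> [An h]; split; [split=> // p Pp pN; apply: h => //; exact: ltnW|exact: h].
move=> [[An h] Nn]; split=> // p Pp.
by rewrite ltnS leq_eqVlt => /predU1P[->|] //; exact: h.
Qed.

(** Satisfied both by the positive integers and by the integers generated by
    [P], the two sets that are sieved. *)
Definition mult_closed (A : set nat) := forall p n, P p -> (A (p * n)%N <-> A n).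

Lemma sieved_closed A N n : mult_closed A -> P N -> (sieved P A N (N * n)%N <-> sieved P A N n).
Proof.
move=> Ac PN; split=> [[An h]|[An h]]; split.
- exact/(Ac N).
- by move=> p Pp pN; apply: contra (h p Pp pN) => /dvdn_mull ->.
- exact/(Ac N).
- move=> p Pp pN; rewrite Euclid_dvdM ?(Pprime Pp)// negb_or h// andbT.
  rewrite dvdn_prime2 ?(Pprime Pp)// ?(Pprime PN)//.
  by rewrite neq_ltn pN.
Qed.

(** One step of the sieve of Eratosthenes: by complete multiplicativity, the
    multiples of N contribute F N times a shorter sum over the same set. *)
Lemma setsum_sieve (V : nzRingType) (F : nat -> V) A N M :
  (forall m n, (0 < m)%N -> (0 < n)%N -> F (m * n)%N = F m * F n) ->
  ~ A 0%N -> mult_closed A -> P N ->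
  setsum F (sieved P A N.+1) M =
  setsum F (sieved P A N) M - F N * setsum F (sieved P A N) ((M + N.-1) %/ N).
Proof.
move=> FM A0 Ac PN; have N0 : (0 < N)%N by apply: prime_gt0; exact: Pprime.
apply/eqP; rewrite eq_sym subr_eq; apply/eqP.
rewrite {1}/setsum (bigID (fun n => (N %| n)%N)) /= addrC; congr (_ + _).
  rewrite /setsum; apply: eq_bigl => n; rewrite sieved_in//.
  apply/andP/idP => [[/set_mem h1 h2]|/set_mem[h1 h2]]; first exact/mem_set.
  by split => //; exact/mem_set.
rewrite sum_multiples//; last by move=> n; exact: sieved_closed.
rewrite /setsum big_distrr/=; apply: eq_bigr => n /set_mem[An _].
by rewrite FM// lt0n; apply: contra_notN A0 => /eqP <-.
Qed.

End Sieve.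

Section EulerBound.
Variable R : realType.
Variable P : set nat.
Hypothesis Pprime : P `<=` primeset.

Lemma invn_mult m n : (0 < m)%N -> (0 < n)%N -> ((m * n)%:R^-1 : R) = m%:R^-1 * n%:R^-1.
Proof. by move=> _ _; rewrite natrM invfM. Qed.

Lemma setsum_inv_ge0 A M : 0 <= setsum (fun n => n%:R^-1 : R) A M.
Proof. by rewrite sumr_ge0. Qed.

Lemma setsum_inv_le A M M' : (M <= M')%N ->
  setsum (fun n => n%:R^-1 : R) A M <= setsum (fun n => n%:R^-1) A M'.
Proof.
move=> MM; rewrite /setsum [leRHS](big_cat_nat (n:=M))//= lerDl sumr_ge0//.
Qed.

(** Iterating [setsum_sieve] with F n = 1/n, where shortening the subtracted sum
    only helps. *)
Lemma prod_setsum_le A N M : ~ A 0%N -> mult_closed P A ->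
  (\prod_(0 <= p < N | p \in P) (1 - p%:R^-1)) * setsum (fun n => n%:R^-1 : R) A M <=
  setsum (fun n => n%:R^-1) (sieved P A N) M.
Proof.
move=> A0 Ac; elim: N => [|N IH]; first by rewrite big_geq// mul1r sieved0.
rewrite big_mkcond big_nat_recr//= -big_mkcond.
have [/set_mem PN|PN] := boolP (N \in P); last first.
  by rewrite mulr1 sieved_notin// => /mem_set; exact/negP.
have N0 : (0 < N)%N by apply: prime_gt0; exact: Pprime.
rewrite setsum_sieve//; last exact: invn_mult.
rewrite mulrAC (le_trans (ler_wpM2r _ IH))//.
  by rewrite subr_ge0 invf_le1 ?ler1n// ltr0n.
rewrite mulrBr mulr1 mulrC lerB// ler_wpM2l//.
(* the subtracted sum is shorter: the upper integral part of M / N is at most M *)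
apply: setsum_inv_le; rewrite -ltnS ltn_divLR//.
by rewrite -{2}(prednK N0); nia.
Qed.
End EulerBound.

(** * The Euler product over the removed primes *)

Section SetsumLimit.
Variable R : realType.
Implicit Types (A B P : set nat) (F : nat -> R[i]).

Lemma setsum_series (V : zmodType) (F : nat -> V) A N :
  setsum F A N = \sum_(0 <= n < N) (if n \in A then F n else 0).
Proof. by rewrite /setsum big_mkcond. Qed.

Lemma setsumS (V : zmodType) (F : nat -> V) A N :
  setsum F A N.+1 = setsum F A N + (if N \in A then F N else 0).
Proof. by rewrite !setsum_series big_nat_recr. Qed.

Lemma cvgC_setsum F A (m : nat -> R) : cvgn (series m) -> (forall n, 0 <= m n) ->
  (forall n, A n -> cabs (F n) <= m n) -> exists z, cvgC \oo (setsum F A) z.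
Proof.
move=> mc m0 Fm; apply: (@cvgC_of_summable R _ m) => // n.
rewrite setsumS addrAC subrr add0r.
by case: ifPn => [/set_mem/Fm//|_]; rewrite cabs0.
Qed.

(** Below N the two sums have the same terms, and beyond N each set contributes
    at most the majorant. *)
Lemma cabs_setsum_sub F A B (m : nat -> R) N M :
  (forall n, 0 <= m n) -> cvgn (series m) ->
  (forall n, (n < N)%N -> A n <-> B n) ->
  (forall n, A n \/ B n -> cabs (F n) <= m n) ->
  cabs (setsum F A M - setsum F B M) <= tail m N.
Proof.
move=> m0 mc AB Fm.
have m'P : forall n, cabs ((if n \in A then F n else 0) - (if n \in B then F n else 0)) <=
    (if (n < N)%N then 0 else m n).
  move=> n; case: ltnP => nN.
    have [/set_mem h|h] := boolP (n \in A).
      by rewrite mem_set ?subrr ?cabs0//; apply/AB.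
    rewrite memNset ?subrr ?cabs0//; apply: contraNnot h => h; apply/mem_set; exact/AB.
  have [/set_mem hA|hA] := boolP (n \in A); have [/set_mem hB|hB] := boolP (n \in B).
  - by rewrite subrr cabs0.
  - by rewrite subr0; apply: Fm; left.
  - by rewrite sub0r cabsN; apply: Fm; right.
  - by rewrite subrr cabs0.
rewrite !setsum_series -sumrB (le_trans (cabs_sum _ _ _))//.
rewrite (le_trans (ler_sum _ (fun n _ => m'P n)))//.
have [MN|NM] := leqP M N.
  rewrite big_nat big1 ?subr_ge0 ?series_le_lim// => n /andP[_ nM].
  by rewrite (leq_trans nM MN).
rewrite (big_cat_nat (n := N))//= ?(ltnW NM)// big_nat big1 ?add0r; last first.
  by move=> n /andP[_ ->].
rewrite (@eq_big_nat _ _ _ _ _ _ m); last by move=> n /andP[nN _]; rewrite ltnNge nN.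
by rewrite -sub_series_geq ?(ltnW NM)// lerB// series_le_lim.
Qed.

Lemma cabs_sub_le_lim (u v : nat -> R[i]) (y z : R[i]) (e : R) :
  cvgC \oo u y -> cvgC \oo v z -> (forall n, cabs (u n - v n) <= e) -> cabs (y - z) <= e.
Proof.
move=> uy vz h.
have H : cabs (u n - v n) @[n --> \oo] --> cabs (y - z) by apply: cvg_cabs; exact: cvgC_B.
by apply: (cvgr_to_le H); near=> n; exact: h.
Unshelve. all: by end_near. Qed.

Lemma cvgC_le0 (u : nat -> R[i]) (z : R[i]) (e : nat -> R) :
  e n @[n --> \oo] --> (0 : R) -> (forall n, cabs (u n - z) <= e n) -> cvgC \oo u z.
Proof.
move=> e0 h; apply/cvgC_dist => eps eps0.
have [N _ HN] := proj1 (cvgrPdist_lt _ _) e0 _ eps0; exists N => // n /HN.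
rewrite /= sub0r normrN => /(le_lt_trans (ler_norm _)); apply: le_lt_trans.
by rewrite cabs_distrC.
Qed.

Lemma cvg_ceil_div (N : nat) : (0 < N)%N -> ((M + N.-1) %/ N)%N @[M --> \oo] --> \oo.
Proof.
move=> N0; apply/cvgnyPge => A; near=> M.
rewrite leq_divRL// (@leq_trans M)// ?leq_addr//.
by near: M; exact: nbhs_infty_ge.
Unshelve. all: by end_near. Qed.

End SetsumLimit.

Section Euler.
Variable R : realType.
Variable P : set nat.
Hypothesis Pprime : P `<=` primeset.
Implicit Types (s : R[i]).

Definition euler (N : nat) s : R[i] := \prod_(0 <= p < N | p \in P) (1 - dirichlet_term p s).

Lemma eulerS N s : euler N.+1 s = euler N s * (if N \in P then 1 - dirichlet_term N s else 1).
Proof. by rewrite /euler big_mkcond big_nat_recr//= -big_mkcond. Qed.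

(** In the limit the sum on the right of [setsum_sieve] has the same value as the
    sum to its left, so each step multiplies the limit by 1 - N^(-s). *)
Lemma cvgC_sieved A N s z : ~ A 0%N -> mult_closed P A ->
  cvgC \oo (setsum (fun n => dirichlet_term n s) A) z ->
  cvgC \oo (setsum (fun n => dirichlet_term n s) (sieved P A N)) (euler N s * z).
Proof.
move=> A0 Ac h; elim: N => [|N IH].
  by rewrite sieved0 /euler big_geq// mul1r.
rewrite eulerS; have [/set_mem PN|PN] := boolP (N \in P); last first.
  by rewrite mulr1 sieved_notin// => /mem_set; exact/negP.
have N0 : (0 < N)%N by apply: prime_gt0; exact: Pprime.
have -> : euler N s * (1 - dirichlet_term N s) * z =
   euler N s * z - dirichlet_term N s * (euler N s * z) by ring.
have -> : setsum (fun n => dirichlet_term n s) (sieved P A N.+1) = (fun M =>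
    setsum (fun n => dirichlet_term n s) (sieved P A N) M - dirichlet_term N s *
    setsum (fun n => dirichlet_term n s) (sieved P A N) ((M + N.-1) %/ N)).
  apply/funext => M; rewrite setsum_sieve// => m n; exact: dirichlet_termM.
apply: cvgC_B => //; apply: cvgC_M; first exact: cvgC_cst.
split; [move: IH.1|move: IH.2] => IH'; exact: (cvg_comp _ _ (cvg_ceil_div N0) IH').
Qed.

Definition invP (p : nat) : R := if p \in P then p%:R^-1 else 0.
Hypothesis invP_cvg : cvgn (series invP).

Lemma invP_ge0 p : 0 <= invP p.
Proof. by rewrite /invP; case: ifP. Qed.

(** An upper bound for the products of 1 + 1/p over [P], hence for all partial
    Euler products on Re s >= 1. *)
Definition eulerC : R := expR (limn (series invP)).

Lemma eulerC_gt0 : 0 < eulerC. Proof. exact: expR_gt0. Qed.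

Lemma prod_1Dinv_le N : \prod_(0 <= p < N) (1 + invP p) <= eulerC.
Proof.
rewrite /eulerC (@le_trans _ _ (expR (series invP N)))//; last first.
  by rewrite ler_expR series_le_lim//; exact: invP_ge0.
rewrite /series /= expR_sum; apply: ler_prod => p _; rewrite expR_ge1Dx andbT.
by rewrite addr_ge0// invP_ge0.
Qed.

Lemma cabs_dirichlet_term_le (n : nat) s : (0 < n)%N -> 1 <= complex.Re s ->
  cabs (dirichlet_term n s) <= n%:R^-1.
Proof.
move=> n0 s1; rewrite cabs_dirichlet_term// powRN lef_pV2 ?posrE ?ltr0n//.
  by rewrite le1r_powR// ler1n.
by rewrite powR_gt0// ltr0n.
Qed.

Definition efac (p : nat) s : R[i] := if p \in P then 1 - dirichlet_term p s else 1.

Lemma eulerE N s : euler N s = \prod_(0 <= p < N) efac p s.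
Proof. by rewrite /euler big_mkcond. Qed.

Lemma P_gt0 p : p \in P -> (0 < p)%N.
Proof. by move=> /set_mem h; apply: prime_gt0; exact: Pprime. Qed.

Lemma cabs_efac_le p s : 1 <= complex.Re s -> cabs (efac p s) <= 1 + invP p.
Proof.
move=> s1; rewrite /efac /invP; case: ifPn => [pP|_]; last by rewrite cabs1 addr0.
by rewrite (le_trans (cabsB _ _))// cabs1 lerD2l cabs_dirichlet_term_le// P_gt0.
Qed.

Lemma cabs_euler_le_prod N s : 1 <= complex.Re s ->
  cabs (euler N s) <= \prod_(0 <= p < N) (1 + invP p).
Proof.
move=> s1; rewrite eulerE cabs_prod; apply: ler_prod => p _.
by rewrite cabs_ge0 cabs_efac_le.
Qed.

Lemma cabs_euler_le N s : 1 <= complex.Re s -> cabs (euler N s) <= eulerC.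
Proof. by move=> s1; rewrite (le_trans (cabs_euler_le_prod _ _))// prod_1Dinv_le. Qed.

Lemma cabs_eulerS_sub N s : 1 <= complex.Re s ->
  cabs (euler N.+1 s - euler N s) <= eulerC * invP N.
Proof.
move=> s1; rewrite eulerS /invP; case: ifPn => [NP|_]; last first.
  by rewrite mulr1 subrr cabs0 mulr0.
have -> : euler N s * (1 - dirichlet_term N s) - euler N s = - (euler N s * dirichlet_term N s).
  by ring.
rewrite cabsN cabsM ler_pM ?cabs_ge0 ?cabs_euler_le//.
by rewrite cabs_dirichlet_term_le// P_gt0.
Qed.

Lemma series_mulC_cvg : cvgn (series (fun p => eulerC * invP p)).
Proof.
have -> : (fun p => eulerC * invP p) = eulerC *: invP by apply/funext.
exact: is_cvg_seriesZ.
Qed.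

Definition etail := tail (fun p => eulerC * invP p).

Lemma etail_cvg0 : etail N @[N --> \oo] --> (0 : R).
Proof. apply: cvg_tail; exact: series_mulC_cvg. Qed.

(** The factor G with zeta_K = zeta G ([zetaK]). *)
Definition eulerL s : R[i] := limn (euler^~ s : nat -> (R[i] : numFieldType)).

Lemma cvg_euler s : 1 <= complex.Re s -> cvgC \oo (euler^~ s) (eulerL s).
Proof.
move=> s1; have [l hl] := cvgC_of_summable series_mulC_cvg (fun n => cabs_eulerS_sub n s1).
by rewrite /eulerL (limnC_eq hl).
Qed.

Lemma cabs_eulerL_sub N s : 1 <= complex.Re s -> cabs (eulerL s - euler N s) <= etail N.
Proof.
move=> s1; apply: (@cabs_lim_tail R (euler^~ s)); last exact: cvg_euler.
- by move=> n; rewrite mulr_ge0 ?invP_ge0 ?ltW ?eulerC_gt0.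
- exact: series_mulC_cvg.
- by move=> n; exact: cabs_eulerS_sub.
Qed.

Lemma cabs_eulerL_le s : 1 <= complex.Re s -> cabs (eulerL s) <= eulerC.
Proof.
move=> s1; apply: (cvgr_to_le (cvg_cabs (cvg_euler s1))).
by near=> n; exact: cabs_euler_le.
Unshelve. all: by end_near. Qed.

(** A difference of products telescopes into a sum of differences of single
    factors, the other factors being bounded by 1 + 1/p. *)
Lemma cabs_euler_dist N s s' : 1 <= complex.Re s -> 1 <= complex.Re s' ->
  cabs (euler N s - euler N s') <=
  eulerC * setsum (fun p => cabs (dirichlet_term p s - dirichlet_term p s')) P N.
Proof.
move=> s1 s'1; apply: (@le_trans _ _ (\prod_(0 <= p < N) (1 + invP p) *
  setsum (fun p => cabs (dirichlet_term p s - dirichlet_term p s')) P N)); last first.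
  by rewrite ler_wpM2r ?prod_1Dinv_le// sumr_ge0// => p _; exact: cabs_ge0.
elim: N => [|N IH].
  by rewrite !eulerE ![\prod_(_ <= _ < _) _]big_geq// subrr cabs0 /setsum big_geq// mulr0.
have q0 : 0 <= \prod_(0 <= p < N) (1 + invP p).
  by apply: prodr_ge0 => p _; rewrite addr_ge0 ?invP_ge0.
have i0 := invP_ge0 N.
have eS z : euler N.+1 z = euler N z * efac N z by rewrite !eulerE big_nat_recr.
have pS : \prod_(0 <= p < N.+1) (1 + invP p) = \prod_(0 <= p < N) (1 + invP p) * (1 + invP N).
  by rewrite big_nat_recr.
rewrite !eS pS setsumS.
have -> : euler N s * efac N s - euler N s' * efac N s' =
  (euler N s - euler N s') * efac N s + euler N s' * (efac N s - efac N s') by ring.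
rewrite (le_trans (cabsD _ _))// [leRHS]mulrDr lerD//.
  rewrite cabsM mulrAC ler_pM ?cabs_ge0//.
  exact: cabs_efac_le.
rewrite cabsM ler_pM ?cabs_ge0//.
  by rewrite (le_trans (cabs_euler_le_prod _ _))// ler_peMr// lerDl.
rewrite /efac; case: ifP => _; last by rewrite subrr cabs0.
have -> : 1 - dirichlet_term N s - (1 - dirichlet_term N s') =
  dirichlet_term N s' - dirichlet_term N s by ring.
by rewrite cabs_distrC.
Qed.

End Euler.

(** * The zeta function near its pole *)

Section ZetaPole.
Variable R : realType.
Implicit Types (s z : R[i]) (d : R).

Definition dln (n : nat) : R := ln n.+1%:R - ln n%:R.

Lemma dln_ge (n : nat) : (0 < n)%N -> n.+1%:R^-1 <= dln n.
Proof.
move=> n0; have n0' : 0 < n%:R :> R by rewrite ltr0n.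
have n1' : 0 < n.+1%:R :> R by rewrite ltr0n.
have h : ln (1 + - n.+1%:R^-1 : R) <= - n.+1%:R^-1.
  by apply: le_ln1Dx; rewrite ltrN2 invf_lt1// ltr1n.
have e : 1 + - n.+1%:R^-1 = n%:R / n.+1%:R :> R.
  by rewrite -[in n%:R](addrK 1 n%:R) -natr1; field; rewrite natr1; apply: lt0r_neq0.
by rewrite e ln_div ?posrE// -lerN2 opprB opprK in h.
Qed.

Lemma dln_le (n : nat) : (0 < n)%N -> dln n <= n%:R^-1.
Proof.
move=> n0; have n0' : 0 < n%:R :> R by rewrite ltr0n.
have n1' : 0 < n.+1%:R :> R by rewrite ltr0n.
have h : ln (1 + n%:R^-1 : R) <= n%:R^-1.
  by apply: le_ln1Dx; rewrite (@lt_trans _ _ 0)// invr_gt0.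
have e : 1 + n%:R^-1 = n.+1%:R / n%:R :> R.
  by rewrite -natr1; field; apply: lt0r_neq0.
by rewrite e ln_div ?posrE// in h.
Qed.

Lemma dln_ge0 (n : nat) : (0 < n)%N -> 0 <= dln n.
Proof. by move=> /dln_ge; apply: le_trans. Qed.

Definition zsum_bound d (n : nat) : R := if n == 0%N then 0 else n%:R `^ (- (1 + d)).

Lemma zsum_bound_ge0 d n : 0 <= zsum_bound d n.
Proof. by rewrite /zsum_bound; case: ifP => // _; exact: powR_ge0. Qed.

Lemma powR_nat (n : nat) a : (0 < n)%N -> n%:R `^ a = expR (a * ln n%:R) :> R.
Proof. by move=> n0; rewrite /powR pnatr_eq0 gtn_eqF. Qed.

(** The mean value estimate behind the integral test: the increment of -n^(-d)
    dominates d (n+1)^(-1-d). *)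
Lemma zsum_bound_telescope d n : 0 < d -> (0 < n)%N ->
  d * zsum_bound d n.+1 <= n%:R `^ (- d) - n.+1%:R `^ (- d).
Proof.
move=> d0 n0; rewrite /zsum_bound /= !powR_nat//.
have -> : expR (- d * ln n%:R) = expR (- d * ln n.+1%:R) * expR (d * dln n).
  by rewrite -expRD /dln; congr expR; ring.
have -> : expR (- (1 + d) * ln n.+1%:R) = expR (- d * ln n.+1%:R) * n.+1%:R^-1.
  have -> : n.+1%:R^-1 = expR (- ln n.+1%:R) :> R by rewrite expRN lnK// posrE ltr0n.
  by rewrite -expRD; congr expR; ring.
rewrite -[X in _ <= _ - X]mulr1 -mulrBr mulrCA ler_wpM2l ?expR_ge0//.
rewrite lerBrDl (le_trans _ (expR_ge1Dx _))// lerD2l ler_wpM2l ?(ltW d0)//.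
exact: dln_ge.
Qed.

Lemma cvg_zsum_bound d : 0 < d -> cvgn (series (zsum_bound d)).
Proof.
move=> d0; apply: (@is_cvg_bounded_series _ _ (1 + d^-1)); first exact: zsum_bound_ge0.
(* indices are shifted by 2: term 0 is 0 and term 1 is 1, then telescope *)
suff H : forall N, series (zsum_bound d) N.+2 <= 1 + d^-1 * (1 - N.+1%:R `^ (- d)).
  have H' N : series (zsum_bound d) N.+2 <= 1 + d^-1.
    by rewrite (le_trans (H N))// lerD2l ler_piMr ?invr_ge0 ?ltW// gerBl powR_ge0.
  move=> N; apply: le_trans (H' N); rewrite -subr_ge0 sub_series_geq; last first.
    by rewrite (leq_trans (leqnSn _)).
  by rewrite sumr_ge0// => n _; exact: zsum_bound_ge0.
elim=> [|N IH].
  rewrite /series /= big_nat_recr//= big_nat1 /zsum_bound /= powR1 add0r.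
  by rewrite subrr mulr0 addr0.
rewrite /series/= big_nat_recr//= (le_trans (lerD IH (lexx _)))//.
have := @zsum_bound_telescope d N.+1 d0 isT; move: (zsum_bound d _) => b.
move: (_ `^ _) (_ `^ _) => x y h.
rewrite -addrA lerD2l -(ler_pM2l d0) mulrDr !mulrA divff ?gt_eqF// !mul1r; lra.
Qed.

(** A telescoping majorant of 1/n^2, so that summability is immediate. *)
Definition sqb (n : nat) : R := if n == 0%N then 0 else 2 * (n%:R^-1 - n.+1%:R^-1).

Lemma sqb_ge0 n : 0 <= sqb n.
Proof.
rewrite /sqb; case: n => //= n; rewrite mulr_ge0// subr_ge0 lef_pV2 ?posrE ?ltr0n//.
by rewrite ler_nat.
Qed.

Lemma series_sqb N : series sqb N <= 2.
Proof.
have H n : series sqb n.+1 = 2 * (1 - n.+1%:R^-1).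
  elim: n => [|n IH]; first by rewrite /series /= big_nat1 /sqb /= invr1 subrr mulr0.
  rewrite /series/= big_nat_recr//=; rewrite /series/= in IH; rewrite IH /sqb /=; ring.
case: N => [|N]; first by rewrite /series /= big_geq.
by rewrite H -[leRHS]mulr1 ler_wpM2l// gerBl.
Qed.

Lemma cvg_sqb : cvgn (series sqb).
Proof. by apply: (@is_cvg_bounded_series _ _ 2); [exact: sqb_ge0|exact: series_sqb]. Qed.

Lemma inv_sqr_le_sqb n : (0 < n)%N -> n%:R^-1 ^+ 2 <= sqb n.
Proof.
case: n => // n _; rewrite /sqb /=.
have n0 : 0 < n.+1%:R :> R by rewrite ltr0n.
have n1 : 1 <= n.+1%:R :> R by rewrite ler1n.
have -> : n.+2%:R = n.+1%:R + 1 :> R by rewrite natr1.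
move: (n.+1%:R : R) n0 n1 => x x0 x1.
have -> : 2 * (x^-1 - (x + 1)^-1) = x^-1 ^+ 2 * (2 * x / (x + 1)).
  by field; apply/andP; split; apply: lt0r_neq0 => //; rewrite ltr_wpDr.
by rewrite ler_peMr ?sqr_ge0// ler_pdivlMr ?ltr_wpDr// mul1r; lra.
Qed.

(** The bracket telescopes to 1 on Re z > 0, so there the sum [zreg] of these terms
    is z zeta(1 + z) - 1; unlike the series of zeta it converges on Re z >= 0. *)
Definition zterm (n : nat) z : R[i] :=
  if n == 0%N then 0 else z * cexpN (ln n%:R) (1 + z) - (cexpN (ln n%:R) z - cexpN (ln n.+1%:R) z).

Definition ztermK z : R := 4 * cabs z ^+ 2 + cabs z.

Lemma ztermK_ge0 z : 0 <= ztermK z.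
Proof. by rewrite addr_ge0 ?mulr_ge0 ?sqr_ge0 ?cabs_ge0. Qed.

(** After factoring out n^(-z), expand (n+1)^(-z) / n^(-z) = e^(-z (ln (n+1) - ln n))
    to second order; its linear term z (ln (n+1) - ln n) is z/n up to
    |z| (1/n - 1/(n+1)). *)
Lemma cabs_zterm z n : 0 <= complex.Re z -> cabs (zterm n z) <= ztermK z * sqb n.
Proof.
move=> z0; rewrite /zterm; case: ifPn => [_|]; first by rewrite cabs0 mulr_ge0 ?ztermK_ge0 ?sqb_ge0.
rewrite -lt0n => n0; have n0' : 0 < n%:R :> R by rewrite ltr0n.
have e1 : cexpN (ln n%:R) (1 + z) = cexpN (ln n%:R) z * (n%:R^-1)%:C :> R[i].
  by rewrite cexpNDr mulrC; congr (_ * _); rewrite cexpN_real mulr1 expRN lnK// posrE.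
have e2 : cexpN (ln n.+1%:R) z = cexpN (ln n%:R) z * cexpN (dln n) z.
  by rewrite -cexpND /dln addrC subrK.
rewrite e1 e2.
have -> : z * (cexpN (ln n%:R) z * (n%:R^-1)%:C) - (cexpN (ln n%:R) z - cexpN (ln n%:R) z * cexpN (dln n) z) =
  cexpN (ln n%:R) z * ((cexpN (dln n) z - 1 + (dln n)%:C * z) + (n%:R^-1 - dln n)%:C * z).
  have -> : (n%:R^-1 - dln n)%:C = (n%:R^-1)%:C - (dln n)%:C :> R[i].
    by apply: eq_ReIm; rewrite ?cReD ?cImD ?cReN ?cImN //= subr0.
  by ring.
have s0 := sqb_ge0 n.
rewrite cabsM cabs_cexpN (@le_trans _ _ (1 * (ztermK z * sqb n)))//; last by rewrite mul1r.
apply: ler_pM; rewrite ?expR_ge0 ?cabs_ge0//.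
  by rewrite expR_le1 oppr_le0 mulr_ge0// ln_ge0// ler1n.
rewrite (le_trans (cabsD _ _))// mulrDl lerD//.
  rewrite (le_trans (cabs_cexpN_sub1D (dln_ge0 n0) z0))// exprMn -mulrA ler_wpM2l//.
  rewrite mulrC ler_wpM2l ?sqr_ge0// (le_trans _ (inv_sqr_le_sqb n0))//.
  by rewrite lerXn2r// ?nnegrE ?invr_ge0 ?ler0n ?dln_ge0// dln_le.
rewrite cabsM cabsR mulrC ler_wpM2l ?cabs_ge0// ger0_norm ?subr_ge0 ?dln_le//.
rewrite /sqb gtn_eqF//.
have h := dln_ge n0.
apply: (@le_trans _ _ (n%:R^-1 - n.+1%:R^-1)); first by rewrite lerB.
rewrite ler_peMl// ?ler1n// subr_ge0 lef_pV2 ?posrE ?ltr0n//.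
by rewrite ler_nat.
Qed.

Definition zreg_ (N : nat) z : R[i] := \sum_(0 <= n < N) zterm n z.
Definition zreg z : R[i] := limn (zreg_^~ z : nat -> (R[i] : numFieldType)).

Lemma cvg_Ksqb z : cvgn (series (fun n => ztermK z * sqb n)).
Proof.
have -> : (fun n => ztermK z * sqb n) = ztermK z *: sqb by apply/funext.
by apply: is_cvg_seriesZ; exact: cvg_sqb.
Qed.

Lemma cabs_zregS z n : 0 <= complex.Re z -> cabs (zreg_ n.+1 z - zreg_ n z) <= ztermK z * sqb n.
Proof.
by move=> z0; rewrite /zreg_ big_nat_recr//= addrAC subrr add0r cabs_zterm.
Qed.

Lemma cvg_zreg z : 0 <= complex.Re z -> cvgC \oo (zreg_^~ z) (zreg z).
Proof.
move=> z0; have [l hl] := cvgC_of_summable (@cvg_Ksqb z) (fun n => cabs_zregS n z0).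
by rewrite /zreg (limnC_eq hl).
Qed.

Lemma tail_Ksqb z N : tail (fun n => ztermK z * sqb n) N = ztermK z * tail sqb N.
Proof.
rewrite /tail; have -> : (fun n => ztermK z * sqb n) = ztermK z *: sqb by apply/funext.
rewrite lim_seriesZ; last exact: cvg_sqb.
by rewrite mulrBr; congr (_ - _); rewrite /series /= mulr_sumr.
Qed.

Lemma cabs_zreg_sub z N : 0 <= complex.Re z -> cabs (zreg z - zreg_ N z) <= ztermK z * tail sqb N.
Proof.
move=> z0; rewrite -tail_Ksqb; apply: (@cabs_lim_tail R (zreg_^~ z)).
- by move=> n; rewrite mulr_ge0 ?ztermK_ge0 ?sqb_ge0.
- exact: cvg_Ksqb.
- by move=> n; exact: cabs_zregS.
- exact: cvg_zreg.
Qed.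

Lemma cabs_zreg_le z : 0 <= complex.Re z -> cabs (zreg z) <= 2 * ztermK z.
Proof.
move=> z0; have := cabs_zreg_sub 0 z0.
rewrite /zreg_ big_geq// subr0 => /le_trans; apply.
rewrite mulrC ler_wpM2r ?ztermK_ge0// /tail /series /= big_geq// subr0.
apply: limr_le; first exact: cvg_sqb.
by near=> n; exact: series_sqb.
Unshelve. all: by end_near. Qed.

Definition posnat : set nat := [set n | (0 < n)%N].

(** Summation of the telescoping part of [zterm]. *)
Lemma zreg_eq N z : z * setsum (fun n => dirichlet_term n (1 + z)) posnat N.+1 =
  zreg_ N.+1 z + (1 - cexpN (ln N.+1%:R) z).
Proof.
elim: N => [|N IH].
  rewrite /setsum /zreg_ big_mkcond !big_nat1 /zterm /= ln1 cexpN0l subrr addr0.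
  by rewrite memNset ?mulr0.
rewrite setsumS mulrDr IH [in RHS]/zreg_ big_nat_recr//= -/(zreg_ _ _).
rewrite mem_set//= dirichlet_termE// /zterm /=; ring.
Qed.

Lemma cvg_cexpN_ln z : 0 < complex.Re z -> cvgC \oo (fun N => cexpN (ln N.+1%:R) z) 0.
Proof.
move=> z0; apply/cvgC_dist => e e0.
near=> N; rewrite sub0r cabsN cabs_cexpN.
rewrite -[e](@lnK R) ?posrE// ltr_expR ltrNl.
rewrite mulrC -ltr_pdivrMl//.
rewrite -[X in X < _](@expRK R) ltr_ln ?posrE ?expR_gt0 ?ltr0n//.
rewrite (@lt_trans _ _ N%:R)// ?ltr_nat//.
near: N; exact: nbhs_infty_gtr.
Unshelve. all: by end_near. Qed.

Lemma zeta_posnat z : 0 < complex.Re z ->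
  cvgC \oo (setsum (fun n => dirichlet_term n (1 + z)) posnat) (z^-1 * (1 + zreg z)).
Proof.
move=> z0; have zn0 : z != 0 by apply: contraTneq z0 => ->; rewrite ltxx.
have H : cvgC \oo (fun N => setsum (fun n => dirichlet_term n (1 + z)) posnat N.+1)
   (z^-1 * (1 + zreg z)).
  have -> : (fun N => setsum (fun n => dirichlet_term n (1 + z)) posnat N.+1) =
    (fun N => z^-1 * (zreg_ N.+1 z + (1 - cexpN (ln N.+1%:R) z))).
    by apply/funext => N; rewrite -zreg_eq mulKf.
  apply: cvgC_M; first exact: cvgC_cst.
  have -> : 1 + zreg z = zreg z + (1 - 0) by rewrite subr0 addrC.
  apply: cvgC_D; last by apply: cvgC_B; [exact: cvgC_cst|exact: cvg_cexpN_ln].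
  have [h1 h2] := cvg_zreg (ltW z0).
  by split; rewrite (cvg_shiftS (fun n => _ (zreg_ n z))).
by case: H => h1 h2; split; rewrite -(cvg_shiftS (fun n => _ (setsum _ _ n))).
Qed.
End ZetaPole.

(** * A formula for psi on the closed half-plane *)

Section PsiFormula.
Variable R : realType.
Variable Q : set nat.
Notation P := (primeset `\` Q).
Hypothesis invP_cvg : cvgn (series (invP R P)).
Implicit Types (s z : R[i]).

Let Pprime : P `<=` primeset. Proof. by move=> p []. Qed.

Lemma mult_closed_posnat : mult_closed P posnat.
Proof. by move=> p n /Pprime/prime_gt0 p0; rewrite /posnat /= muln_gt0 p0. Qed.

Lemma mult_closed_generated : mult_closed P (generated P).
Proof.
move=> p n Pp; have p0 := prime_gt0 (Pprime Pp); split=> -[h1 h2]; split.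
- by move: h1; rewrite muln_gt0 p0.
- by move=> q qp qn; apply: h2 => //; rewrite dvdn_mull.
- by rewrite muln_gt0 p0.
- move=> q qp; rewrite Euclid_dvdM// => /orP[|qn]; last exact: h2.
  by rewrite dvdn_prime2// ?(Pprime Pp)// => /eqP ->.
Qed.

(** An integer below N has only prime factors below N, so sieving by the primes of
    [P] below N already removes everything outside [generated Q]. *)
Lemma sieved_posnat N n : (n < N)%N -> (sieved P posnat N n <-> generated Q n).
Proof.
move=> nN; split=> -[n0 h]; split=> //.
- move=> p pp pn; apply: contrapT => Qp.
  have := h p (conj pp Qp) (leq_ltn_trans (dvdn_leq n0 pn) nN).
  by rewrite pn.
- by move=> p [pp nQp] _; apply/negP => /(h p pp).
Qed.

Lemma sieved_generated N n : (1 < N)%N -> (n < N)%N -> (sieved P (generated P) N n <-> n = 1%N).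
Proof.
move=> N1 nN; split=> [[[n0 h] h']|->]; last first.
  split; first by split=> // p pp; rewrite dvdn1 => /eqP p1; rewrite p1 in pp.
  by move=> p [pp _] _; rewrite dvdn1; apply: contraTN (prime_gt1 pp) => /eqP ->.
apply/eqP; rewrite eqn_leq n0 andbT leqNgt; apply/negP => n1.
have pp := pdiv_prime n1; have pn := pdiv_dvd n.
by have := h' _ (h _ pp pn) (leq_ltn_trans (dvdn_leq n0 pn) nN); rewrite pn.
Qed.

Definition eulerR (N : nat) : R := \prod_(0 <= p < N | p \in P) (1 - p%:R^-1).

Lemma euler1 N : euler P N 1 = (eulerR N)%:C :> R[i].
Proof.
rewrite /euler /eulerR rmorph_prod; apply: eq_bigr => p /set_mem/Pprime/prime_gt0 p0.
by rewrite dirichlet_term1// rmorphB.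
Qed.

(** On [0, 1/2] one has 1 - x >= e^(-2x), and 1/p lies in that interval. *)
Lemma eulerR_ge N : expR (- (2 * limn (series (invP R P)))) <= eulerR N.
Proof.
apply: (@le_trans _ _ (expR (- (2 * series (invP R P) N)))).
  by rewrite ler_expR lerN2 ler_wpM2l// series_le_lim//; exact: invP_ge0.
rewrite /series /= /eulerR [leRHS]big_mkcond mulr_sumr -sumrN expR_sum; apply: ler_prod => p _.
rewrite expR_ge0 /= /invP; case: ifPn => [pP|_]; last by rewrite mulr0 oppr0 expR0.
have p1 : 2 <= p%:R :> R by rewrite ler_nat prime_gt1//; move/set_mem: pP => /Pprime.
have p0 : 0 < p%:R :> R by rewrite (lt_le_trans _ p1).
have x1 : p%:R^-1 <= 2^-1 :> R by rewrite lef_pV2 ?posrE.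
have x0 : 0 <= p%:R^-1 :> R by rewrite invr_ge0 ltW.
move: (p%:R^-1 : R) x0 x1 => x x0 x1.
rewrite expRN -[leRHS]invrK lef_pV2 ?posrE ?expR_gt0 ?invr_gt0//; last by lra.
apply: le_trans (expR_ge1Dx _); rewrite -[leLHS]mul1r ler_pdivrMr; nra.
Qed.

(** By [prod_setsum_le], the partial sum times the Euler product at 1 is at most a
    sum over integers of [J] with no small prime factor, which only contains 1. *)
Lemma setsum_J_le M : setsum (fun n => n%:R^-1 : R) (generated P) M <=
  expR (2 * limn (series (invP R P))).
Proof.
have h := @prod_setsum_le R P Pprime (generated P) M.+2 M (fun h => Bool.diff_false_true h.1)
  mult_closed_generated.
have h1 : setsum (fun n => n%:R^-1 : R) (sieved P (generated P) M.+2) M <= 1.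
  rewrite /setsum big_mkcond /=.
  apply: (@le_trans _ _ (\sum_(0 <= n < M) (if n == 1%N then 1 else 0))).
    rewrite big_nat [leRHS]big_nat; apply: ler_sum => n /andP[_ nM].
    case: ifPn => [/set_mem|_]; last by case: ifP.
    have nM2 : (n < M.+2)%N by lia.
    by move=> /(sieved_generated (isT : (1 < M.+2)%N) nM2) ->; rewrite eqxx invr1.
  case: M {h} => [|[|M]]; [by rewrite big_geq|by rewrite big_nat1|].
  rewrite big_ltn// big_ltn//= add0r big_nat big1 ?addr0// => n /andP[n2 _].
  by rewrite gtn_eqF.
have := le_trans h h1; rewrite -/(eulerR _) => H.
have E := eulerR_ge M.+2.
have s0 := setsum_inv_ge0 R (generated P) M.
rewrite -[2 * _]opprK expRN -[leRHS]mul1r ler_pdivlMr ?expR_gt0// mulrC.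
by rewrite (le_trans _ H)// ler_wpM2r.
Qed.

Definition invJ (n : nat) : R := if n \in generated P then n%:R^-1 else 0.

Lemma invJ_ge0 n : 0 <= invJ n.
Proof. by rewrite /invJ; case: ifP. Qed.

Lemma cvg_invJ : cvgn (series invJ).
Proof.
apply: (is_cvg_bounded_series (B := expR (2 * limn (series (invP R P))))); first exact: invJ_ge0.
by move=> N; rewrite /series /= /invJ -big_mkcond; exact: setsum_J_le.
Qed.

Lemma zetaE (K : set nat) s z :
  cvgC \oo (setsum (fun n => dirichlet_term n s) K) z -> zeta K s = z.
Proof. exact: limnC_eq. Qed.

Lemma cvg_setsum_J : exists z, cvgC \oo (setsum (fun n => dirichlet_term n (1 : R[i])) (generated P)) z.
Proof.
apply: (cvgC_setsum cvg_invJ invJ_ge0) => n hn; rewrite /invJ mem_set//.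
by rewrite dirichlet_term1 ?hn.1// cabsR ger0_norm.
Qed.

(** Sieving [J] by all of [P] leaves {1}. *)
Lemma eulerL1_zetaJ : eulerL P (1 : R[i]) * zeta (generated P) 1 = 1.
Proof.
have [z hz] := cvg_setsum_J; rewrite (zetaE hz).
have s1 : 1 <= complex.Re (1 : R[i]) by [].
have H1 : cvgC \oo (fun N => euler P N 1 * z) (eulerL P 1 * z).
  by apply: cvgC_M; [exact: (cvg_euler Pprime invP_cvg s1)|exact: cvgC_cst].
(* shifted by 2 so that the sieved set agrees with {1} below the index *)
have H2 : cvgC \oo (fun N => euler P N.+2 1 * z) (1 : R[i]).
  apply: (@cvgC_le0 _ _ _ (fun N => tail invJ N.+2)).
    by rewrite (cvg_shiftS (fun n => tail invJ n.+1)) (cvg_shiftS (tail invJ)); exact: (cvg_tail cvg_invJ).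
  move=> N; have J0 : ~ generated P 0%N by case.
  have h1 := cvgC_sieved Pprime N.+2 J0 mult_closed_generated hz.
  have h2 : cvgC \oo (setsum (fun n => dirichlet_term n (1 : R[i])) [set 1%N]) 1.
    apply: (@cvgC_le0 _ _ _ (fun N => if (N < 2)%N then 1 else 0)).
      apply: cvg_near_cst; exists 2%N => // n /= n2.
      by rewrite ltnNge n2.
    move=> n; rewrite /setsum big_mkcond /=.
    case: n => [|[|n]].
    - by rewrite big_geq// sub0r cabsN cabs1.
    - by rewrite big_nat1 memNset// sub0r cabsN cabs1.
    rewrite big_ltn// big_ltn// big_nat big1 ?addr0; last first.
      by move=> k /andP[k2 _]; rewrite memNset// => k1; rewrite k1 in k2.
    by rewrite memNset// mem_set// add0r dirichlet_term1// invr1 subrr cabs0.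
  apply: (cabs_sub_le_lim h1 h2) => M.
  apply: cabs_setsum_sub; [exact: invJ_ge0|exact: cvg_invJ| |].
    by move=> n nN; exact: sieved_generated.
  move=> n [[nJ _]|->].
    by rewrite /invJ mem_set// dirichlet_term1 ?nJ.1// cabsR ger0_norm.
  rewrite /invJ mem_set ?dirichlet_term1 ?cabsR ?ger0_norm//.
  by split=> // p pp; rewrite dvdn1 => /eqP p1; rewrite p1 in pp.
apply: (cvgC_unique _ _ H2).
by case: H1 => h1 h2; split; rewrite (cvg_shiftS (fun n => _ (euler P n.+1 1 * z))) (cvg_shiftS (fun n => _ (euler P n 1 * z))).
Qed.

Lemma zetaJ_inv : (zeta (generated P) 1)^-1 = eulerL P (1 : R[i]).
Proof.
have h := eulerL1_zetaJ; have n0 : zeta (generated P) (1 : R[i]) != 0.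
  by apply: contra_eq_neq h => ->; rewrite mulr0 eq_sym oner_eq0.
by apply: (mulIf n0); rewrite mulVf// h.
Qed.

(** Sieving the positive integers by all of [P] leaves [generated Q]. *)
Lemma zetaK z : 0 < complex.Re z ->
  zeta (generated Q) (1 + z) = eulerL P (1 + z) * (z^-1 * (1 + zreg z)).
Proof.
move=> z0; have hz := zeta_posnat z0; set Z := _ * (1 + _) in hz *.
have s1 : 1 <= complex.Re (1 + z) by rewrite cReD /= lerDl ltW.
pose m := zsum_bound (complex.Re z).
have m0 : forall n, 0 <= m n by exact: zsum_bound_ge0.
have mc : cvgn (series m) by exact: cvg_zsum_bound.
have Fm : forall n, (0 < n)%N -> cabs (dirichlet_term n (1 + z)) <= m n.
  by move=> n n0; rewrite cabs_dirichlet_term// /m /zsum_bound gtn_eqF// cReD.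
have [y hy] : exists y, cvgC \oo (setsum (fun n => dirichlet_term n (1 + z)) (generated Q)) y.
  by apply: (cvgC_setsum mc m0) => n [n0 _]; exact: Fm.
rewrite (zetaE hy).
have H1 : cvgC \oo (fun N => euler P N (1 + z) * Z) (eulerL P (1 + z) * Z).
  by apply: cvgC_M; [exact: (cvg_euler Pprime invP_cvg s1)|exact: cvgC_cst].
apply: (cvgC_unique _ _ H1).
apply: (@cvgC_le0 _ _ _ (tail m)); first exact: cvg_tail.
move=> N; have h1 := cvgC_sieved Pprime N (fun h => Bool.diff_false_true h) mult_closed_posnat hz.
apply: (cabs_sub_le_lim h1 hy) => M.
apply: cabs_setsum_sub => //; first by move=> n nN; exact: sieved_posnat.
by move=> n [[n0 _]|[n0 _]]; exact: Fm.
Qed.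

(** A formula for psi(1 + z) that only involves the functions [zreg] and [eulerL],
    which are continuous up to Re z = 0: the poles of the two terms of [psi] at
    z = 0 have been cancelled against each other. *)
Definition psi_ext z : R[i] :=
  (zreg z / z - 1) / (1 + z) * eulerL P (1 + z) + (eulerL P (1 + z) - eulerL P 1) / z.

Lemma psiE z : 0 < complex.Re z -> psi Q (1 + z) = psi_ext z.
Proof.
move=> z0; have zn0 : z != 0 by apply: contraTneq z0 => ->; rewrite ltxx.
have sn0 : 1 + z != 0.
  apply: contraTneq z0 => /(congr1 (@complex.Re R)); rewrite cReD /=.
  by move: (complex.Re z) => x h; rewrite -leNgt; lra.
rewrite /psi zetaJ_inv zetaK// /psi_ext addrAC subrr add0r.
by field; rewrite sn0 zn0.
Qed.

(** A positive lower bound for the Euler product at 1 ([eulerR_ge]). *)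
Definition eulerR_inf : R := expR (- (2 * limn (series (invP R P)))).

End PsiFormula.

(** * Two-sided bounds for the boundary function *)

Section PsiBounds.
Variable R : realType.
Variable Q : set nat.
Notation P := (primeset `\` Q).
Hypothesis invP_cvg : cvgn (series (invP R P)).
Implicit Types (s z : R[i]) (t : R).

Let Pprime : P `<=` primeset. Proof. by move=> p []. Qed.
Let C0 : R := eulerC R P.

(** The bound for |p^(-z) - 1| / |z|, up to a factor 6; it depends on z only through
    t = Im z, so it can dominate psi uniformly in Re z. *)
Definition hker (p : nat) t : R := ln p%:R / (1 + `|t| * ln p%:R).

Lemma ln_nat_ge0 (p : nat) : 0 <= ln p%:R :> R.
Proof. by case: p => [|p]; [rewrite ln0|rewrite ln_ge0// ler1n]. Qed.

Lemma hker_den p t : 0 < 1 + `|t| * ln p%:R :> R.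
Proof. by rewrite ltr_wpDr// mulr_ge0// ln_nat_ge0. Qed.

Lemma hker_ge0 p t : 0 <= hker p t.
Proof. by rewrite divr_ge0 ?ln_nat_ge0// ltW// hker_den. Qed.

Definition hpart t (p : nat) : R := if p \in P then p%:R^-1 * hker p t else 0.
Definition Hs (N : nat) t : R := series (hpart t) N.

Lemma hpart_ge0 t p : 0 <= hpart t p.
Proof. by rewrite /hpart; case: ifP => // _; rewrite mulr_ge0// hker_ge0. Qed.

(** Interpolates between the bounds 2 and 3x, x = |z| ln p, by
    min (2, 3x) <= 6x / (1 + x). *)
Lemma cabs_cexpN_hker (p : nat) z : 0 <= complex.Re z -> z != 0 ->
  cabs (cexpN (ln p%:R) z - 1) <= 6 * hker p (complex.Im z) * cabs z.
Proof.
move=> z0; rewrite -cabs_gt0 => zp; have L0 := ln_nat_ge0 p.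
have h1 := cabs_cexpN_sub1_le2 L0 z0; have h2 := cabs_cexpN_sub1 L0 z0.
have h3 := Im_le_cabs z.
rewrite /hker -mulrA mulrAC mulrA ler_pdivlMr ?hker_den//.
move: (cabs (_ - 1)) (cabs_ge0 (cexpN (ln p%:R) z - 1)) h1 h2 => w w0 h1 h2.
move: (ln p%:R : R) L0 h2 => L L0 h2.
apply: (@le_trans _ _ (w * (1 + cabs z * L))).
  by rewrite ler_wpM2l// lerD2l ler_wpM2r.
have x0 : 0 <= L * cabs z by rewrite mulr_ge0// ltW.
rewrite (mulrC (cabs z)); move: (L * cabs z) x0 h2 => x x0 h2.
by rewrite mulrDr mulr1; nra.
Qed.

Lemma Re1D z : 0 <= complex.Re z -> 1 <= complex.Re (1 + z).
Proof. by move=> z0; rewrite cReD /= lerDl. Qed.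

Lemma cabs_euler_sub1 N z : 0 <= complex.Re z -> z != 0 ->
  cabs (euler P N (1 + z) - euler P N 1) <= C0 * 6 * Hs N (complex.Im z) * cabs z.
Proof.
move=> z0 zn0; have s1 : 1 <= complex.Re (1 : R[i]) by [].
rewrite (le_trans (cabs_euler_dist Pprime invP_cvg N (Re1D z0) s1))//.
rewrite -!mulrA ler_wpM2l ?(ltW (eulerC_gt0 _ _))// /setsum big_mkcond /Hs /series /= mulrCA mulrC.
rewrite mulr_sumr; apply: ler_sum => p _; rewrite /hpart; case: ifPn => [pP|_]; last first.
  by rewrite mulr0.
have p0 := P_gt0 Pprime pP.
rewrite [X in X - _]dirichlet_termE// cexpNDr -[X in X * _]dirichlet_termE//.
have -> : dirichlet_term p 1 * cexpN (ln p%:R) z - dirichlet_term p 1 =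
  dirichlet_term p 1 * (cexpN (ln p%:R) z - 1) by ring.
rewrite cabsM dirichlet_term1// cabsR ger0_norm//.
rewrite [leRHS]mulrCA ler_wpM2l//.
by rewrite (le_trans (cabs_cexpN_hker p z0 zn0))// mulrAC.
Qed.

Lemma cabs_eulerL_sub1 z (B : R) : 0 <= complex.Re z -> z != 0 ->
  (forall N, Hs N (complex.Im z) <= B) ->
  cabs (eulerL P (1 + z) - eulerL P 1) <= C0 * 6 * B * cabs z.
Proof.
move=> z0 zn0 HB; have s1 : 1 <= complex.Re (1 : R[i]) by [].
apply: (cabs_sub_le_lim (cvg_euler Pprime invP_cvg (Re1D z0)) (cvg_euler Pprime invP_cvg s1)).
move=> N; rewrite (le_trans (cabs_euler_sub1 N z0 zn0))// ler_wpM2r ?cabs_ge0//.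
by rewrite ler_wpM2l// mulr_ge0// ltW// eulerC_gt0.
Qed.

(** The function H that dominates the difference quotient of the Euler product. *)
Definition Hlim t : R := limn (Hs^~ t).

Lemma hpart_le t p : t != 0 -> hpart t p <= `|t|^-1 * invP R P p.
Proof.
move=> t0; rewrite /hpart /invP; case: ifP => _; last by rewrite mulr0.
rewrite mulrC ler_wpM2r// /hker ler_pdivrMr ?hker_den// mulrDr mulr1 mulrA mulVf ?normr_eq0//.
by rewrite mul1r lerDr.
Qed.

Lemma cvg_Hs t : t != 0 -> Hs N t @[N --> \oo] --> Hlim t.
Proof.
move=> t0; apply: (series_le_cvg (v_ := fun p => `|t|^-1 * invP R P p)).
- by move=> p; exact: hpart_ge0.
- by move=> p; rewrite mulr_ge0// invP_ge0.
- by move=> p; exact: hpart_le.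
- have -> : (fun p => `|t|^-1 * invP R P p) = `|t|^-1 *: invP R P by apply/funext.
  exact: is_cvg_seriesZ.
Qed.

Lemma Hs_nd t : {homo (fun N => Hs N t) : n m / (n <= m)%N >-> n <= m}.
Proof.
by move=> i j ij; rewrite -subr_ge0 /Hs sub_series_geq// sumr_ge0// => p _; exact: hpart_ge0.
Qed.

Lemma Hs_le_Hlim N t : t != 0 -> Hs N t <= Hlim t.
Proof.
move=> t0; apply: (nondecreasing_cvgn_le (@Hs_nd t)).
by apply/cvg_ex; eexists; exact: cvg_Hs.
Qed.

Lemma Hs_ge0 N t : 0 <= Hs N t.
Proof. by rewrite /Hs /series /= sumr_ge0// => p _; exact: hpart_ge0. Qed.

Lemma Im_neq0 z : complex.Im z != 0 -> z != 0.
Proof. by apply: contra_neq => ->. Qed.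

(** The part of [psi_ext] that is bounded near z = 0, since [zreg z] vanishes there
    to first order. *)
Lemma cabs_psi_reg z : 0 <= complex.Re z -> z != 0 ->
  cabs ((zreg z / z - 1) / (1 + z) * eulerL P (1 + z)) <= C0 * (8 * cabs z + 3).
Proof.
move=> z0 zn0; rewrite cabsM mulrC ler_pM ?cabs_ge0//.
  exact: (cabs_eulerL_le Pprime invP_cvg (Re1D z0)).
have s1 : 1 <= cabs (1 + z) by rewrite (le_trans (Re1D z0))// cabs_ge_Re.
rewrite cabsM cabsV ler_pdivrMr ?(lt_le_trans _ s1)//.
have zp : 0 < cabs z by rewrite cabs_gt0.
apply: (@le_trans _ _ (8 * cabs z + 3)); last first.
  by rewrite ler_peMr// addr_ge0// mulr_ge0// ltW.
rewrite (le_trans (cabsB _ _))// cabs1 cabsM cabsV.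
have : cabs (zreg z) / cabs z <= 8 * cabs z + 2.
  rewrite ler_pdivrMr// (le_trans (cabs_zreg_le z0))// /ztermK; lra.
lra.
Qed.

Lemma cabs_psi_ext_le z : 0 <= complex.Re z -> complex.Im z != 0 ->
  cabs (psi_ext Q z) <= C0 * (8 * cabs z + 3) + C0 * 6 * Hlim (complex.Im z).
Proof.
move=> z0 Iz; have zn0 := Im_neq0 Iz; rewrite /psi_ext (le_trans (cabsD _ _))// lerD//.
  exact: cabs_psi_reg.
rewrite cabsM cabsV ler_pdivrMr ?cabs_gt0//; apply: cabs_eulerL_sub1 => // N.
exact: Hs_le_Hlim.
Qed.

Definition cosker (p : nat) t : R := (1 - cos (t * ln p%:R)) / p%:R.
Definition cospart t (p : nat) : R := if p \in P then cosker p t else 0.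
Definition Cs (N : nat) t : R := series (cospart t) N.

Lemma cospart_ge0 t p : 0 <= cospart t p.
Proof. by rewrite /cospart; case: ifP => // _; rewrite divr_ge0// one_sub_cos_ge0. Qed.

(** Already the real part 1 - cos (t ln p) / p is large enough: it exceeds the
    left-hand side by (1 - cos (t ln p)) / p^2. *)
Lemma cabs_efac_ge p t : p \in P ->
  (1 - p%:R^-1) * (1 + cospart t p) <= cabs (efac P p (1 + (0 +i* t))).
Proof.
move=> pP; have p0 := P_gt0 Pprime pP; rewrite /efac /cospart pP /cosker.
apply: le_trans (cabs_ge_Re _); rewrite cReD cReN dirichlet_termE// Re_cexpN cReD cImD /=.
rewrite addr0 add0r mulr1 expRN lnK ?posrE ?ltr0n// (mulrC _ t).
have x0 : 0 <= p%:R^-1 :> R by [].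
have := one_sub_cos_ge0 (t * ln p%:R : R).
move: (p%:R^-1 : R) x0 (cos _) => x x0 c h.
have -> : (1 - x) * (1 + (1 - c) * x) = 1 - x * c - (1 - c) * x ^+ 2 by ring.
by rewrite gerBl mulr_ge0// sqr_ge0.
Qed.

Lemma cabs_euler_ge N t :
  eulerR R Q N * (1 + Cs N t) <= cabs (euler P N (1 + (0 +i* t))).
Proof.
rewrite eulerE cabs_prod /Cs; elim: N => [|N IH].
  by rewrite /eulerR /series /= !big_geq// addr0 mulr1.
rewrite [leRHS]big_nat_recr//= /eulerR big_mkcond [X in X * _]big_nat_recr//= -big_mkcond -/(eulerR _ _ _).
rewrite seriesS; have g0 : 0 <= eulerR R Q N.
  by apply: le_trans (eulerR_ge invP_cvg N); exact: expR_ge0.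
have c0 := cospart_ge0 t N.
have S0 : 0 <= series (cospart t) N by rewrite /series /= sumr_ge0// => p _; exact: cospart_ge0.
case: ifPn => NP; last first.
  by rewrite /efac (negbTE NP) {1}/cospart (negbTE NP) cabs1 !mulr1 add0r.
have x1 : 0 <= 1 - N%:R^-1 :> R by rewrite subr_ge0 invf_le1 ?ler1n ?ltr0n ?(P_gt0 Pprime NP).
apply: (@le_trans _ _ (eulerR R Q N * (1 + series (cospart t) N) * ((1 - N%:R^-1) * (1 + cospart t N)))).
  rewrite -!mulrA ler_wpM2l// [leRHS]mulrCA ler_wpM2l//.
  by move: (series _ _) S0 (cospart t N) c0 => S S0 c c0; nra.
apply: ler_pM => //.
- by rewrite mulr_ge0// addr_ge0.
- by rewrite mulr_ge0// addr_ge0.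
- exact: cabs_efac_ge.
Qed.

Lemma Cs_nd t : {homo (fun N => Cs N t) : n m / (n <= m)%N >-> n <= m}.
Proof.
by move=> i j ij; rewrite -subr_ge0 /Cs sub_series_geq// sumr_ge0// => p _; exact: cospart_ge0.
Qed.

(** By [cabs_euler_ge], |G(1 + it)| - G(1) is at least G(1) times the sum of
    (1 - cos (t ln p)) / p. *)
Lemma cabs_eulerL_sub1_ge M t :
  eulerR_inf R Q * Cs M t <= cabs (eulerL P (1 + (0 +i* t)) - eulerL P 1).
Proof.
have s1 : 1 <= complex.Re (1 : R[i]) by [].
have H : cvgC \oo (fun N => euler P N (1 + (0 +i* t)) - euler P N 1)
   (eulerL P (1 + (0 +i* t)) - eulerL P 1).
  by apply: cvgC_B; apply: (cvg_euler Pprime invP_cvg) => //; exact: Re1D.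
apply: (cvgr_to_ge (cvg_cabs H)); near=> N.
rewrite (le_trans _ (cabs_sub_le _ _))//.
rewrite [X in _ - cabs X]euler1 cabsR.
have g0 : eulerR_inf R Q <= eulerR R Q N := eulerR_ge invP_cvg N.
have gi : 0 <= eulerR_inf R Q by exact: expR_ge0.
rewrite ger0_norm ?(le_trans gi)//.
rewrite (le_trans _ (lerB (cabs_euler_ge N t) (lexx _)))// mulrDr mulr1 addrAC subrr add0r.
apply: ler_pM => //.
  by rewrite /Cs /series /= sumr_ge0// => p _; exact: cospart_ge0.
(* the partial sum at M is below the one at the larger index N *)
by apply: Cs_nd; near: N; exact: nbhs_infty_ge.
Unshelve. all: by end_near. Qed.

Lemma cabs_psi_ext_ge M t : t != 0 ->
  eulerR_inf R Q * Cs M t / `|t| <= cabs (psi_ext Q (0 +i* t)) + C0 * (8 * `|t| + 3).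
Proof.
move=> t0; have zn0 : (0 +i* t) != 0 by apply: Im_neq0.
have zt : cabs (0 +i* t) = `|t| by rewrite cabs_def /= expr0n add0r sqrtr_sqr.
rewrite -zt.
apply: (@le_trans _ _ (cabs ((eulerL P (1 + (0 +i* t)) - eulerL P 1) / (0 +i* t)))).
  by rewrite cabsM cabsV ler_wpM2r ?invr_ge0 ?cabs_ge0// cabs_eulerL_sub1_ge.
have gen (a b : R[i]) : cabs b <= cabs (a + b) + cabs a.
  by have := cabsB (a + b) a; rewrite addrAC subrr add0r.
apply: le_trans (gen ((zreg (0 +i* t) / (0 +i* t) - 1) / (1 + (0 +i* t)) *
  eulerL P (1 + (0 +i* t))) _) _; rewrite lerD2l.
exact: cabs_psi_reg.
Qed.

End PsiBounds.

(** * Measurability and the pointwise boundary limit *)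

Section Measurability.
Variable R : realType.

Definition measC (f : R -> R[i]) : Prop :=
  measurable_fun setT (fun t => complex.Re (f t)) /\
  measurable_fun setT (fun t => complex.Im (f t)).

Lemma measC_cst c : measC (fun=> c).
Proof. by split; exact: measurable_cst. Qed.

Lemma measC_D f g : measC f -> measC g -> measC (fun t => f t + g t).
Proof.
move=> [f1 f2] [g1 g2]; split.
  by under eq_fun do rewrite cReD; exact: measurable_funD.
by under eq_fun do rewrite cImD; exact: measurable_funD.
Qed.

Lemma measC_N f : measC f -> measC (fun t => - f t).
Proof.
move=> [f1 f2]; split.
  by under eq_fun do rewrite cReN; exact: measurableT_comp.
by under eq_fun do rewrite cImN; exact: measurableT_comp.
Qed.

Lemma measC_B f g : measC f -> measC g -> measC (fun t => f t - g t).
Proof. by move=> mf mg; apply: measC_D mf _; exact: measC_N. Qed.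

Lemma measC_M f g : measC f -> measC g -> measC (fun t => f t * g t).
Proof.
move=> [f1 f2] [g1 g2]; split.
  under eq_fun do rewrite cReM.
  by apply: measurable_funB; exact: measurable_funM.
under eq_fun do rewrite cImM.
by apply: measurable_funD; exact: measurable_funM.
Qed.

Lemma measC_V f : measC f -> measC (fun t => (f t)^-1).
Proof.
move=> [f1 f2].
have D : measurable_fun setT (fun t => (complex.Re (f t) ^+ 2 + complex.Im (f t) ^+ 2)^-1).
  under eq_fun do rewrite -powR_inv1 ?addr_ge0 ?sqr_ge0//.
  apply: (measurableT_comp (measurable_powR (-1))).
  by apply: measurable_funD; exact: measurable_funX.
split.
  by under eq_fun do rewrite cReV; exact: measurable_funM.
under eq_fun do rewrite cImV.
by apply: measurableT_comp => //; exact: measurable_funM.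
Qed.

Lemma measC_sum (I : Type) (r : seq I) (P : pred I) (f : I -> R -> R[i]) :
  (forall i, measC (f i)) -> measC (fun x => \sum_(i <- r | P i) f i x).
Proof.
move=> h; elim: r => [|i r IH].
  by under eq_fun do rewrite big_nil; exact: measC_cst.
under eq_fun do rewrite big_cons.
by case: (P i); [exact: measC_D|exact: IH].
Qed.

Lemma measC_prod (I : Type) (r : seq I) (P : pred I) (f : I -> R -> R[i]) :
  (forall i, measC (f i)) -> measC (fun x => \prod_(i <- r | P i) f i x).
Proof.
move=> h; elim: r => [|i r IH].
  by under eq_fun do rewrite big_nil; exact: measC_cst.
under eq_fun do rewrite big_cons.
by case: (P i); [exact: measC_M|exact: IH].
Qed.

Lemma measC_lim (f_ : nat -> R -> R[i]) (f : R -> R[i]) :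
  (forall n, measC (f_ n)) -> (forall t, cvgC \oo (f_ ^~ t) (f t)) -> measC f.
Proof.
move=> mf h; split.
  by apply: (measurable_fun_cvg (fun n => (mf n).1)) => t _; exact: (h t).1.
by apply: (measurable_fun_cvg (fun n => (mf n).2)) => t _; exact: (h t).2.
Qed.

Lemma measC_vert (d : R) : measC (fun t => d +i* t).
Proof. by split=> /=; [exact: measurable_cst|exact: measurable_id]. Qed.

Lemma measC_cexpN (x : R) f : measC f -> measC (fun t => cexpN x (f t)).
Proof.
move=> [f1 f2].
have E : measurable_fun setT (fun t => expR (- (x * complex.Re (f t)))).
  apply: measurableT_comp => //; apply: measurableT_comp => //.
  by apply: measurable_funM => //; exact: measurable_cst.
have I : measurable_fun setT (fun t => x * complex.Im (f t)).
  by apply: measurable_funM => //; exact: measurable_cst.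
split.
  under eq_fun do rewrite Re_cexpN; apply: measurable_funM => //.
  by apply: measurableT_comp => //; apply: continuous_measurable_fun; exact: continuous_cos.
under eq_fun do rewrite Im_cexpN; apply: measurableT_comp => //; apply: measurable_funM => //.
by apply: measurableT_comp => //; apply: continuous_measurable_fun; exact: continuous_sin.
Qed.

Lemma measurable_cabs f : measC f -> measurable_fun setT (fun t => cabs (f t)).
Proof.
move=> [f1 f2]; under eq_fun do rewrite cabs_def.
under eq_fun do rewrite -powR12_sqrt ?addr_ge0 ?sqr_ge0//.
apply: (measurableT_comp (measurable_powR 2^-1)).
by apply: measurable_funD; exact: measurable_funX.
Qed.
End Measurability.

Section PsiLimit.
Variable R : realType.
Variable Q : set nat.
Notation P := (primeset `\` Q).
Hypothesis invP_cvg : cvgn (series (invP R P)).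
Implicit Types (s z : R[i]) (t : R).

Let Pprime : P `<=` primeset. Proof. by move=> p []. Qed.

Lemma measC_zreg (d : R) : 0 <= d -> measC (fun t => zreg (d +i* t)).
Proof.
move=> d0; apply: (measC_lim (f_ := fun n t => zreg_ n (d +i* t))) => [n|t]; last exact: cvg_zreg.
apply: measC_sum => k; rewrite /zterm; case: eqP => _; first exact: measC_cst.
have V := measC_vert d.
apply: measC_B; first apply: measC_M => //.
  by apply: measC_cexpN; apply: measC_D => //; exact: measC_cst.
by apply: measC_B; exact: measC_cexpN.
Qed.

Lemma measC_eulerL (d : R) : 0 <= d -> measC (fun t => eulerL P (1 + (d +i* t))).
Proof.
move=> d0; apply: (measC_lim (f_ := fun n t => euler P n (1 + (d +i* t)))) => [n|t]; last first.
  by apply: (cvg_euler Pprime invP_cvg); exact: Re1D.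
under eq_fun do rewrite eulerE.
apply: measC_prod => p; rewrite /efac; have [pP|_] := boolP (p \in P); last exact: measC_cst.
apply: measC_B; first exact: measC_cst.
under eq_fun do rewrite dirichlet_termE ?(P_gt0 Pprime pP)//.
by apply: measC_cexpN; apply: measC_D; [exact: measC_cst|exact: measC_vert].
Qed.

Lemma measC_psi_ext (d : R) : 0 <= d -> measC (fun t => psi_ext Q (d +i* t)).
Proof.
move=> d0; have mz := measC_vert d; have m1 := measC_cst (1 : R[i]).
have mE := measC_eulerL d0; have mZ := measC_zreg d0.
rewrite /psi_ext; apply: measC_D; last first.
  by apply: measC_M; [apply: measC_B => //; exact: measC_cst|exact: measC_V].
apply: measC_M => //; apply: measC_M; last by apply: measC_V; exact: measC_D.
by apply: measC_B => //; apply: measC_M => //; exact: measC_V.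
Qed.

Section Vertical.
Variables (u : nat -> R) (t : R).
Hypotheses (u0 : forall n, 0 < u n) (u_cvg : u n @[n --> \oo] --> (0 : R)).

Lemma cvgC_vert : cvgC \oo (fun n => u n +i* t) (0 +i* t).
Proof. by split => //=; exact: cvg_cst. Qed.

(** On a bounded part of the half-plane the series of [zreg] converges uniformly. *)
Lemma cvgC_zreg_vert : cvgC \oo (fun n => zreg (u n +i* t)) (zreg (0 +i* t)).
Proof.
pose K : R := 4 * (1 + `|t|) ^+ 2 + (1 + `|t|).
have K0 : 0 <= K by rewrite addr_ge0// ?mulr_ge0 ?sqr_ge0// addr_ge0.
have HK (d : R) : 0 <= d -> d <= 1 -> ztermK (d +i* t) <= K.
  move=> d0 d1; have H : cabs (d +i* t) <= 1 + `|t|.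
    by rewrite (le_trans (cabs_le_ReIm _))//= lerD2r ger0_norm.
  rewrite /ztermK lerD// ler_wpM2l// lerXn2r// nnegrE ?cabs_ge0// addr_ge0.
have T0 N : 0 <= tail (@sqb R) N.
  by rewrite subr_ge0 series_le_lim//; [exact: sqb_ge0|exact: cvg_sqb].
apply: (@cvgC_uniform R _ _ _ (fun N n => zreg_ N (u n +i* t)) _
  (fun N => zreg_ N (0 +i* t)) _ (fun N => K * tail (@sqb R) N)).
- rewrite -(mulr0 K); apply: cvgM; [exact: cvg_cst|exact: (cvg_tail (@cvg_sqb R))].
- move=> N; apply: cvgC_sum => k; rewrite /zterm; case: eqP => _; first exact: cvgC_cst.
  have V := cvgC_vert.
  apply: cvgC_B; first apply: cvgC_M => //.
    by apply: cvgC_cexpN; apply: cvgC_D => //; exact: cvgC_cst.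
  by apply: cvgC_B; exact: cvgC_cexpN.
- move=> N; near=> n.
  have un0 : 0 <= complex.Re (u n +i* t) by exact: ltW (u0 n).
  rewrite (le_trans (cabs_zreg_sub N un0))// ler_wpM2r//; apply: HK => //.
  near: n; have [M _ HM] := proj1 (cvgrPdist_lt _ _) u_cvg _ ltr01.
  exists M => // n /HM; rewrite /= sub0r normrN => /ltW; apply: le_trans; exact: ler_norm.
- by move=> N; rewrite (le_trans (cabs_zreg_sub N _))//= ler_wpM2r// HK.
Unshelve. all: by end_near. Qed.

Lemma cvgC_eulerL_vert :
  cvgC \oo (fun n => eulerL P (1 + (u n +i* t))) (eulerL P (1 + (0 +i* t))).
Proof.
apply: (@cvgC_uniform R _ _ _ (fun N n => euler P N (1 + (u n +i* t))) _
  (fun N => euler P N (1 + (0 +i* t))) _ (fun N => etail R P N)).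
- exact: etail_cvg0.
- move=> N; under eq_fun do rewrite eulerE; rewrite eulerE.
  apply: cvgC_prod => p; rewrite /efac; case: ifPn => [pP|_]; last exact: cvgC_cst.
  under eq_fun do rewrite dirichlet_termE ?(P_gt0 Pprime pP)//.
  rewrite dirichlet_termE ?(P_gt0 Pprime pP)//.
  apply: cvgC_B; first exact: cvgC_cst.
  by apply: cvgC_cexpN; apply: cvgC_D; [exact: cvgC_cst|exact: cvgC_vert].
- move=> N; near=> n; apply: (cabs_eulerL_sub Pprime invP_cvg); apply: Re1D => /=.
  exact: ltW.
- by move=> N; apply: (cabs_eulerL_sub Pprime invP_cvg); exact: Re1D.
Unshelve. all: by end_near. Qed.

Lemma cvgC_psi_ext_vert : t != 0 ->
  cvgC \oo (fun n => psi_ext Q (u n +i* t)) (psi_ext Q (0 +i* t)).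
Proof.
move=> t0; have z0 : (0 +i* t) != 0 by apply: Im_neq0.
have s0 : 1 + (0 +i* t) != 0.
  by apply/eqP => /(congr1 (@complex.Re R)) /=/eqP; rewrite addr0 oner_eq0.
have mz := cvgC_vert; have m1 : cvgC \oo (fun _ : nat => 1) (1 : R[i]) by exact: cvgC_cst.
have mE := cvgC_eulerL_vert; have mZ := cvgC_zreg_vert.
rewrite /psi_ext; apply: cvgC_D; last first.
  by apply: cvgC_M; [apply: cvgC_B => //; exact: cvgC_cst|exact: cvgC_V].
apply: cvgC_M => //; apply: cvgC_M; last by apply: cvgC_V => //; exact: cvgC_D.
by apply: cvgC_B => //; apply: cvgC_M => //; exact: cvgC_V.
Qed.
End Vertical.
End PsiLimit.

(** * Integrals of the kernels *)

Section FTC.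
Variable R : realType.
Notation mu := (@lebesgue_measure R).
Implicit Types (a b t x L M q e : R).

(** A plain proposition wrapping the class [is_derive], so that a function and its
    derivative can be quantified over without triggering instance search. *)
Definition deriv_at (F : R -> R) x d : Prop := is_derive x 1 F d.

Lemma FTC_derive (F f : R -> R) a b : a < b ->
  (forall x, a <= x -> x <= b -> deriv_at F x (f x)) ->
  (forall x, a <= x -> x <= b -> {for x, continuous f}) ->
  (\int[mu]_(x in `[a, b]) (f x)%:E)%E = (F b - F a)%:E.
Proof.
move=> ab dF cf.
have cF x : a <= x -> x <= b -> {for x, continuous F}.
  move=> ax xb; apply: differentiable_continuous; apply/derivable1_diffP.
  by have [] := dF x ax xb.
rewrite (continuous_FTC2 (F := F) ab)//.
- by apply: continuous_in_subspaceT => x /set_mem; rewrite /= in_itv /= => /andP[]; exact: cf.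
- split.
  + move=> x; rewrite in_itv /= => /andP[ax xb].
    by have [] := dF x (ltW ax) (ltW xb).
  + by apply: cvg_at_right_filter; apply: cF => //; exact: ltW.
  + by apply: cvg_at_left_filter; apply: cF => //; exact: ltW.
- move=> x; rewrite in_itv /= => /andP[ax xb].
  have h : is_derive x 1 F (f x) := dF x (ltW ax) (ltW xb).
  by rewrite derive1E derive_val.
Qed.

Lemma integral_even (f : R -> R) M : 0 < M -> (forall x, 0 <= f x) ->
  (forall x, f (- x) = f x) -> continuous f ->
  (\int[mu]_(x in `[(- M)%R, M]) (f x)%:E = \int[mu]_(x in `[0%R, M]) (f x)%:E +
     \int[mu]_(x in `[0%R, M]) (f x)%:E)%E.
Proof.
move=> M0 f0 fe cf.
have mf : measurable_fun setT (EFin \o f).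
  by apply/measurable_EFinP; exact: continuous_measurable_fun.
have -> : `[- M, M]%classic = `[- M, 0%R] `|` `]0%R, M] :> set R.
  by rewrite -itv_bndbnd_setU// bnd_simp ?oppr_le0 ltW.
rewrite ge0_integral_setU//=; last 3 first.
- exact: measurable_funTS.
- by move=> x _; rewrite lee_fin.
- apply/disj_setPS => x [] /=; rewrite !in_itv /= => /andP[_ h] /andP[h' _].
  by have := le_lt_trans h h'; rewrite ltxx.
congr (_ + _)%E; last by rewrite integral_itv_obnd_cbnd//; exact: measurable_funTS.
rewrite -[X in `[_, X]]oppr0 integration_by_substitution_oppr ?ltW//.
  by apply: eq_integral => x _ /=; rewrite fe.
exact: continuous_subspaceT.
Qed.

(** The kernel [hker] as a function of L = ln p. *)
Definition kerL L t : R := L / (1 + `|t| * L).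

Lemma kerL_den L t : 0 <= L -> 0 < 1 + `|t| * L.
Proof. by move=> L0; rewrite ltr_wpDr// mulr_ge0. Qed.

Lemma kerL_ge0 L t : 0 <= L -> 0 <= kerL L t.
Proof. by move=> L0; rewrite divr_ge0// ltW// kerL_den. Qed.

Lemma continuous_kerL L : 0 <= L -> continuous (kerL L).
Proof.
move=> L0 x; apply: cvgM; first exact: cvg_cst.
apply: cvgV; first exact: lt0r_neq0 (kerL_den _ L0).
apply: cvgD; first exact: cvg_cst.
apply: cvgM; last exact: cvg_cst.
exact: norm_continuous.
Qed.

Lemma is_derive_scale L x : is_derive x 1 (fun t => t * L) L.
Proof.
have H := is_deriveZ L (is_derive_id x (1 : R)).
have -> : (fun t => t * L) = L \*: (id : R -> R) by apply/funext => t /=; rewrite mulrC.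
by apply: (is_derive_eq H); rewrite /GRing.scale /= mulr1.
Qed.

Lemma is_derive_affine L x : is_derive x 1 (fun t => 1 + t * L) L.
Proof.
have H := is_deriveD (is_derive_cst (1 : R) x (1 : R)) (is_derive_scale L x).
by apply: (is_derive_eq H); rewrite add0r.
Qed.

Lemma continuous_powR_at q x : 0 < x -> {for x, continuous (fun y => y `^ q)}.
Proof.
move=> x0; apply: differentiable_continuous; apply/derivable1_diffP.
by have [] := @is_derive1_powR R q _ x0.
Qed.

Lemma integral_kerL L M : 0 <= L -> 0 < M ->
  (\int[mu]_(x in `[(- M)%R, M]) (kerL L x)%:E = (2 * ln (1 + M * L))%:E)%E.
Proof.
move=> L0 M0; rewrite integral_even//; last 3 first.
- by move=> x; exact: kerL_ge0.
- by move=> x; rewrite /kerL normrN.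
- exact: continuous_kerL.
have -> : (\int[mu]_(x in `[0%R, M]) (kerL L x)%:E = (ln (1 + M * L))%:E)%E.
  transitivity (\int[mu]_(x in `[0%R, M]) (((1 + x * L)^-1 * L)%:E)%E)%E.
    apply: eq_integral => x; rewrite inE /= in_itv /= => /andP[x0 _].
    by rewrite /kerL ger0_norm// mulrC.
  have pos x : 0 <= x -> 0 < 1 + x * L by move=> x0; rewrite ltr_wpDr// mulr_ge0.
  rewrite (FTC_derive (F := fun x => ln (1 + x * L)) M0).
  - by rewrite mul0r addr0 ln1 subr0.
  - move=> x x0 _; rewrite /deriv_at; apply: (is_derive1_comp (f := @ln R)); last exact: is_derive_affine.
    exact: is_derive1_ln (pos _ x0).
  - move=> x x0 _; apply: cvgM; last exact: cvg_cst.
    apply: cvgV; first exact: lt0r_neq0 (pos _ x0).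
    by apply: cvgD; [exact: cvg_cst|apply: cvgM => //; exact: cvg_cst].
by rewrite -EFinD mulr2n mulrDl mul1r.
Qed.

Lemma integral_kerL_powR L M q : 0 < L -> 0 < M -> 1 < q ->
  (\int[mu]_(x in `[(- M)%R, M]) (kerL L x `^ q)%:E <= (2 * (L `^ (q - 1) / (q - 1)))%:E)%E.
Proof.
move=> L0 M0 q1; have q10 : 0 < q - 1 by rewrite subr_gt0.
have L0' := ltW L0.
have ckq : continuous (fun x : R => kerL L x `^ q).
  move=> x; have ck := @continuous_kerL L L0' x.
  have k0 : 0 < kerL L x by rewrite divr_gt0// kerL_den.
  exact: (cvg_comp _ _ ck (@continuous_powR_at q _ k0)).
rewrite integral_even//; last 2 first.
- by move=> x; exact: powR_ge0.
- by move=> x; rewrite /kerL normrN.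
have -> : (\int[mu]_(x in `[0%R, M]) (kerL L x `^ q)%:E =
   (L `^ (q - 1) / (q - 1) * (1 - (1 + M * L) `^ (1 - q)))%:E)%E.
  pose f x := L `^ (q - 1) / (q - 1) * - ((1 - q) * (1 + x * L) `^ (1 - q - 1) * L).
  have pos x : 0 <= x -> 0 < 1 + x * L by move=> x0; rewrite ltr_wpDr// mulr_ge0.
  transitivity (\int[mu]_(x in `[0%R, M]) ((f x)%:E)%E)%E.
    apply: eq_integral => x; rewrite inE /= in_itv /= => /andP[x0 _]; congr EFin.
    rewrite /kerL ger0_norm// powRM ?invr_ge0 ?(ltW (pos _ x0))//.
    rewrite -powR_inv1 ?(ltW (pos _ x0))// -powRrM mulN1r /f.
    have -> : 1 - q - 1 = - q by ring.
    have -> : L `^ q = L `^ (q - 1) * L.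
      by rewrite -{3}(@powRr1 _ L)// -powRD ?subrK ?(gt_eqF L0) ?implybT.
    field; exact: lt0r_neq0.
  rewrite (FTC_derive (F := fun x => L `^ (q - 1) / (q - 1) * - ((1 + x * L) `^ (1 - q))) M0).
  - by congr EFin; rewrite mul0r addr0 powR1; ring.
  - move=> x x0 _; rewrite /f /deriv_at.
    apply: (is_deriveZ (f := fun x => - ((1 + x * L) `^ (1 - q)))).
    apply: is_deriveN.
    apply: (is_derive1_comp (f := fun y => y `^ (1 - q))); last exact: is_derive_affine.
    exact: is_derive1_powR (pos _ x0).
  - move=> x x0 _; apply: cvgM; first exact: cvg_cst.
    apply: cvgN; apply: cvgM; last exact: cvg_cst.
    apply: cvgM; first exact: cvg_cst.
    have ca : {for x, continuous (fun t => 1 + t * L)}.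
      by apply: cvgD; [exact: cvg_cst|apply: cvgM => //; exact: cvg_cst].
    exact: (cvg_comp _ _ ca (@continuous_powR_at (1 - q - 1) _ (pos _ x0))).
rewrite -EFinD lee_fin mulr2n mulrDl mul1r.
have h : L `^ (q - 1) / (q - 1) * (1 - (1 + M * L) `^ (1 - q)) <= L `^ (q - 1) / (q - 1).
  rewrite ler_piMr ?gerBl ?powR_ge0// divr_ge0 ?powR_ge0// ltW//.
exact: lerD.
Qed.

Lemma integral_powR_le e b : 0 < e -> e < 1 -> 0 < b -> b < 1 ->
  (\int[mu]_(x in `[e, 1%R]) (x `^ (- b))%:E <= ((1 - b)^-1)%:E)%E.
Proof.
move=> e0 e1 b0 b1; have b10 : 0 < 1 - b by rewrite subr_gt0.
have -> : (\int[mu]_(x in `[e, 1%R]) (x `^ (- b))%:E =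
   \int[mu]_(x in `[e, 1%R]) ((1 - b)^-1 * ((1 - b) * x `^ (1 - b - 1)))%:E)%E.
  apply: eq_integral => x _; rewrite mulrA mulVf ?mul1r ?lt0r_neq0//.
  by have -> : 1 - b - 1 = - b by ring.
have pos x : e <= x -> 0 < x by apply: lt_le_trans.
rewrite (FTC_derive (F := fun x => (1 - b)^-1 * x `^ (1 - b)) e1).
- by rewrite lee_fin powR1 mulr1 gerBl mulr_ge0 ?powR_ge0// invr_ge0 ltW.
- move=> x ex _; rewrite /deriv_at; apply: (is_deriveZ (f := fun x => x `^ (1 - b))).
  exact: is_derive1_powR (pos _ ex).
- move=> x ex _; have cp := @continuous_powR_at (1 - b - 1) _ (pos _ ex).
  apply: cvgM; first exact: cvg_cst.
  by apply: cvgM; [exact: cvg_cst|exact: cp].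
Qed.

(** The function ln x + (1 - sin (xL)) / (xL) varies by at least ln L - 2 on the
    interval, and its derivative is at most the integrand. *)
Lemma integral_cos_log L : 1 < L ->
  ((ln L - 2)%:E <= \int[mu]_(x in `[(L^-1)%R, 1%R]) ((1 - cos (x * L)) / x)%:E)%E.
Proof.
move=> L1; have L0 : 0 < L by rewrite (lt_trans _ L1).
have L1' : L^-1 < 1 by rewrite invf_lt1.
have pos x : L^-1 <= x -> 0 < x by apply: lt_le_trans; rewrite invr_gt0.
pose F x := ln x + (1 - sin (x * L)) * (x * L)^-1.
pose f x := x^-1 + ((1 - sin (x * L)) * (- (x * L) ^- 2 * L) + (x * L)^-1 * - (cos (x * L) * L)).
have dx x : is_derive x 1 (fun t => t * L) L := is_derive_scale L x.
have cx x : {for x, continuous (fun t => t * L)}.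
  by apply: cvgM => //; exact: cvg_cst.
have cxV x : 0 < x -> {for x, continuous (fun t => (t * L)^-1)}.
  by move=> x0; apply: cvgV; [rewrite mulf_neq0// lt0r_neq0|exact: cx].
have csin x : {for x, continuous (fun t => sin (t * L))}.
  exact: (cvg_comp _ _ (cx x) (@continuous_sin R _)).
have ccos x : {for x, continuous (fun t => cos (t * L))}.
  exact: (cvg_comp _ _ (cx x) (@continuous_cos R _)).
have cf x : 0 < x -> {for x, continuous f}.
  move=> x0; apply: cvgD; first by apply: cvgV => //; exact: lt0r_neq0.
  apply: cvgD.
    apply: cvgM; first by apply: cvgB; [exact: cvg_cst|exact: csin].
    apply: cvgM; last exact: cvg_cst.
    apply: cvgN; rewrite /=; apply: cvgV; first by rewrite expf_neq0// mulf_neq0// lt0r_neq0.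
    under eq_fun do rewrite expr2; rewrite expr2; apply: cvgM; exact: cx.
  apply: cvgM; first exact: cxV.
  by apply: cvgN; apply: cvgM; [exact: ccos|exact: cvg_cst].
have Ef := @FTC_derive F f L^-1 1 L1'.
apply: (@le_trans _ _ (\int[mu]_(x in `[(L^-1)%R, 1%R]) (f x)%:E)%E).
  rewrite Ef; last 2 first.
  - move=> x xL _; rewrite /F /f /deriv_at; have x0 := pos _ xL; apply: is_deriveD.
      exact: is_derive1_ln.
    have xL0 : x * L != 0 by rewrite mulf_neq0// lt0r_neq0.
    have H0 : is_derive x 1 (fun t => sin (t * L)) (cos (x * L) * L).
      exact: (is_derive1_comp (f := @sin R)).
    have H1 : is_derive x 1 (fun t => 1 - sin (t * L)) (0 - cos (x * L) * L).
      exact: is_deriveB.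
    have H2 : is_derive x 1 (fun t => (t * L)^-1) (- (x * L) ^- 2 *: L).
      exact: (@is_deriveV R (fun t => t * L) x L 1 xL0 (dx x)).
    by apply: (is_derive_eq (is_deriveM H1 H2)); rewrite /GRing.scale /= sub0r.
  - by move=> x xL _; exact/cf/pos.
  rewrite lee_fin /F mul1r ln1 add0r mulVf ?lt0r_neq0// invr1 mulr1 lnV ?posrE//.
  (* at 1/L the value is - ln L + 1 - sin 1 and sin 1 >= -1; at 1 it is nonnegative *)
  have : 0 <= (1 - sin L) * L^-1 by rewrite mulr_ge0 ?subr_ge0 ?sin_le1// invr_ge0 ltW.
  have := sin_geN1 (1 : R); lra.
apply: le_integral => //.
- apply: continuous_compact_integrable; first exact: segment_compact.
  by apply: continuous_in_subspaceT => x /set_mem; rewrite /= in_itv /= => /andP[/pos + _]; exact: cf.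
- apply: continuous_compact_integrable; first exact: segment_compact.
  apply: continuous_in_subspaceT => x /set_mem; rewrite /= in_itv /= => /andP[/pos x0 _].
  apply: cvgM; first by apply: cvgB; [exact: cvg_cst|exact: ccos].
  by apply: cvgV => //; exact: lt0r_neq0.
move=> x; rewrite inE /= in_itv /= => /andP[/pos x0 _]; rewrite lee_fin /f.
rewrite -subr_ge0.
have -> : (1 - cos (x * L)) / x - (x^-1 + ((1 - sin (x * L)) * (- (x * L) ^- 2 * L) + (x * L)^-1 * - (cos (x * L) * L)))
  = (1 - sin (x * L)) * ((x * L) ^- 2 * L).
  by field; rewrite !lt0r_neq0.
rewrite mulr_ge0 ?subr_ge0 ?sin_le1// mulr_ge0 ?(ltW L0)// invr_ge0 sqr_ge0//.
Qed.
End FTC.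

(** * Passing to the limit under the integral *)

Section DominatedC.
Variable R : realType.
Notation mu := (@lebesgue_measure R).

(** The boundary values may be unbounded near 0, so no pointwise information is
    asked for at that single point. *)
Lemma dct_R (f_ : nat -> R -> R) (f H : R -> R) :
  (forall n, measurable_fun setT (f_ n)) -> measurable_fun setT f ->
  (forall t, t != 0 -> f_ n t @[n --> \oo] --> f t) ->
  mu.-integrable setT (EFin \o H) ->
  (forall n t, t != 0 -> `|f_ n t| <= H t) ->
  (\int[mu]_t f_ n t)%R @[n --> \oo] --> (\int[mu]_t f t)%R.
Proof.
move=> mf_ mf ff iH fH.
have ae0 (P : R -> Prop) : (forall t, t != 0 -> P t) -> {ae mu, forall t, P t}.
  move=> h; exists [set 0 : R]; split; [exact: measurable_set1|exact: lebesgue_measure_set1|].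
  by move=> t /= Pt; apply: contrapT => /eqP t0; apply: Pt; exact: h.
have mE n : measurable_fun setT (EFin \o f_ n) by exact/measurable_EFinP.
have mE0 : measurable_fun setT (EFin \o f) by exact/measurable_EFinP.
have [||||i _ c] := @dominated_convergence _ _ _ mu setT measurableT
  (fun n => EFin \o f_ n) (EFin \o f) (EFin \o H) _ _ _ iH _.
- exact: mE.
- exact: mE0.
- by apply: ae0 => t t0 _; apply: cvg_EFin; [by near=> n|exact: ff].
- by apply: ae0 => t t0 n _ /=; rewrite lee_fin fH.
rewrite /Rintegral; apply: fine_cvg; rewrite fineK//.
exact: integrable_fin_num.
Unshelve. all: by end_near. Qed.

Lemma dct_C (F : R -> R -> R[i]) (F0 : R -> R[i]) (H : R -> R) :
  (forall d, 0 < d -> measC (F d)) -> measC F0 ->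
  (forall (u : nat -> R) t, (forall n, 0 < u n) -> u n @[n --> \oo] --> (0 : R) -> t != 0 ->
     cvgC \oo (fun n => F (u n) t) (F0 t)) ->
  mu.-integrable setT (EFin \o H) ->
  (forall d t, 0 < d -> d <= 1 -> t != 0 -> cabs (F d t) <= H t) ->
  cvgC (0^'+) (fun d => integralC (F d)) (integralC F0).
Proof.
move=> mF mF0 FF0 iH FH.
have shift (u : nat -> R) : u n @[n --> \oo] --> (0 : R) -> exists N, forall n, u (n + N)%N <= 1.
  move=> uc; have [N _ HN] := proj1 (cvgrPdist_lt _ _) uc _ ltr01.
  exists N => n; have := HN (n + N)%N (leq_addl _ _); rewrite /= sub0r normrN => /ltW.
  by apply: le_trans; exact: ler_norm.
split; rewrite /integralC /=; apply/cvg_at_rightP => u [u0 uc]; have [N HN] := shift u uc.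
  rewrite -(cvg_shiftn N (fun n => \int[mu]_t complex.Re (F (u n) t))).
  apply: dct_R iH _ => [n||t t0|n t t0]; first exact: (mF _ (u0 _)).1.
  - exact: mF0.1.
  - rewrite (cvg_shiftn N (fun n => complex.Re (F (u n) t))).
    exact: (FF0 u t u0 uc t0).1.
  - by rewrite (le_trans (Re_le_cabs _))// FH.
rewrite -(cvg_shiftn N (fun n => \int[mu]_t complex.Im (F (u n) t))).
apply: dct_R iH _ => [n||t t0|n t t0]; first exact: (mF _ (u0 _)).2.
- exact: mF0.2.
- rewrite (cvg_shiftn N (fun n => complex.Im (F (u n) t))).
  exact: (FF0 u t u0 uc t0).2.
- by rewrite (le_trans (Im_le_cabs _))// FH.
Qed.

Lemma smooth_continuous (g : R -> R) : smooth g -> continuous g.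
Proof.
move=> sg x; apply: differentiable_continuous; apply/derivable1_diffP.
exact: (sg 0%N x).
Qed.

Lemma measC_test (phi : R -> R[i]) : test_function phi -> measC phi.
Proof.
move=> [s1 s2 _]; split; apply: continuous_measurable_fun; exact: smooth_continuous.
Qed.

Lemma compact_itv (E : set R) : compact E -> exists2 M : R, 0 < M & E `<=` `[- M, M].
Proof.
move=> /compact_bounded [M [_ HM]]; exists (Num.max M 0 + 1).
  by rewrite ltr_pwDr// le_max lexx orbT.
move=> x Ex; have /HM : M < Num.max M 0 + 1 by rewrite ltr_pwDr// le_max lexx.
by move=> /(_ x Ex); rewrite /= in_itv /= -ler_norml.
Qed.

Lemma test_bounded (phi : R -> R[i]) : test_function phi ->
  exists M K : R, [/\ 0 < M, 0 <= K, forall t, cabs (phi t) <= K &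
    forall t, ~ `[- M, M]%classic t -> phi t = 0].
Proof.
move=> [s1 s2 /compact_itv[M M0 HM]].
have out t : ~ `[- M, M]%classic t -> phi t = 0.
  move=> tM; apply: contrapT => /eqP p0; apply: tM; apply: HM.
  exact: subset_closure.
have cabs_c : continuous (fun t => `|complex.Re (phi t)| + `|complex.Im (phi t)|).
  move=> t; apply: cvgD; apply: cvg_norm; exact: smooth_continuous.
have MM : - M <= M by rewrite (@le_trans _ _ 0)// ?oppr_le0 ltW.
have [c cM Hc] := EVT_max MM (continuous_subspaceT cabs_c).
exists M, (`|complex.Re (phi c)| + `|complex.Im (phi c)|); split=> //.
move=> t; have [tM|tM] := pselect (`[- M, M]%classic t).
  by rewrite (le_trans (cabs_le_ReIm _))// Hc.
by rewrite out// cabs0 addr_ge0.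
Qed.
End DominatedC.

(** * Integrals of the dominating function *)

Section Jensen.
Variable R : realType.

(** Convexity of x^q, obtained from Young's inequality between each u i and the
    weighted mean y of the u i. *)
Lemma jensen_powR (q q' : R) (I : eqType) (r : seq I) (a u : I -> R) :
  1 < q -> 1 < q' -> q^-1 + q'^-1 = 1 ->
  (forall i, 0 <= a i) -> (forall i, 0 <= u i) ->
  (\sum_(i <- r) a i * u i) `^ q <=
  (\sum_(i <- r) a i) `^ (q - 1) * \sum_(i <- r) a i * u i `^ q.
Proof.
move=> q1 q'1 qq' a0 u0.
have q0 : 0 < q by rewrite (lt_trans _ q1).
have q'0 : 0 < q' by rewrite (lt_trans _ q'1).
set W := \sum_(i <- r) a i; set S := \sum_(i <- r) a i * u i.
set T := \sum_(i <- r) a i * u i `^ q.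
have W0 : 0 <= W by rewrite sumr_ge0.
have S0 : 0 <= S by rewrite sumr_ge0// => i _; rewrite mulr_ge0.
have T0 : 0 <= T by rewrite sumr_ge0// => i _; rewrite mulr_ge0// powR_ge0.
have [S00|Sn0] := eqVneq S 0.
  by rewrite S00 powR0 ?gt_eqF// mulr_ge0// powR_ge0.
have Wp : 0 < W.
  rewrite lt_def W0 andbT; apply: contra Sn0; rewrite /W psumr_eq0// => /allP h.
  rewrite /S big_seq big1// => i ir.
  by have /eqP -> : a i == 0 := h i ir; rewrite mul0r.
pose y := S / W.
have y0 : 0 <= y by rewrite divr_ge0.
have Sy : S = W * y by rewrite /y mulrCA mulfV ?mulr1// gt_eqF.
have yq : y * y `^ (q - 1) = y `^ q by rewrite mulr_powRB1.
have eq' : (q - 1) * q' = q.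
  have : q'^-1 = 1 - q^-1 by rewrite -qq' addrC addKr.
  move=> e; have {1}-> : q - 1 = q * q'^-1 by rewrite e mulrBr mulr1 mulfV// gt_eqF.
  by rewrite -mulrA mulVf ?mulr1// gt_eqF.
(* Young's inequality for u i and the constant y^(q-1) *)
have H : S * y `^ (q - 1) <= T / q + W * (y `^ q / q').
  rewrite /S /T /W !mulr_suml -big_split /=; apply: ler_sum => i _.
  rewrite -!mulrA -mulrDr ler_wpM2l//.
  rewrite (le_trans (conjugate_powR (u0 i) (powR_ge0 y (q - 1)) q0 q'0 qq'))//.
  by rewrite -powRrM eq'.
have H2 : W * y `^ q <= T.
  have e : q^-1 = 1 - q'^-1 by rewrite -qq' addrK.
  move: H; rewrite {1}Sy -mulrA yq => H.
  have : W * y `^ q * q^-1 <= T / q by rewrite e mulrBr mulr1 lerBlDr -e -mulrA.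
  by rewrite ler_pM2r// invr_gt0.
rewrite Sy powRM// -[W `^ q](mulr_powRB1 W0 q0) [W * _]mulrC -mulrA.
by rewrite ler_wpM2l ?powR_ge0.
Qed.
End Jensen.

Section HlimIntegral.
Variable R : realType.
Variable Q : set nat.
Notation P := (primeset `\` Q).
Hypothesis invP_cvg : cvgn (series (invP R P)).
Notation mu := (@lebesgue_measure R).
Let Pprime : P `<=` primeset. Proof. by move=> p []. Qed.

(** The origin is removed because H need not be finite there. *)
Definition Dm (M : R) : set R := `[- M, M] `\ 0.

Lemma measurable_Dm M : measurable (Dm M).
Proof. by apply: measurableD => //; exact: measurable_set1. Qed.

Lemma Dm_neq0 M t : Dm M t -> t != 0.
Proof. by move=> [_ /= /eqP]. Qed.

Lemma measurable_Hs N : measurable_fun setT (Hs (R := R) Q N).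
Proof.
rewrite /Hs /series /=; apply: measurable_sum => p; rewrite /hpart.
case: (p \in P); last exact: measurable_cst.
apply: measurable_funM; first exact: measurable_cst.
by apply: continuous_measurable_fun; exact: continuous_kerL (ln_nat_ge0 _ _).
Qed.

Lemma measurable_Hlim M : measurable_fun (Dm M) (Hlim (R := R) Q).
Proof.
apply: (measurable_fun_cvg (h := fun N => Hs (R := R) Q N)) => [N|t /Dm_neq0 t0].
  exact: measurable_funTS (measurable_Hs N).
exact: cvg_Hs.
Qed.

Lemma Hlim_ge0 t : t != 0 -> 0 <= Hlim Q t :> R.
Proof. by move=> t0; apply: le_trans (Hs_le_Hlim invP_cvg 0 t0); exact: Hs_ge0. Qed.

Lemma integral_Hlim_le (q : R) M (B : R) : 0 < q ->
  (forall N, (\int[mu]_(t in `[(- M)%R, M]) (Hs (R := R) Q N t `^ q)%:E <= B%:E)%E) ->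
  (\int[mu]_(t in Dm M) (Hlim (R := R) Q t `^ q)%:E <= B%:E)%E.
Proof.
move=> q0 HB.
have mq N : measurable_fun setT (fun t => (Hs (R := R) Q N t `^ q)%:E).
  apply/measurable_EFinP; exact: (measurableT_comp (measurable_powR q) (measurable_Hs N)).
have nd t : {homo (fun N => (Hs (R := R) Q N t `^ q)%:E) : n m / (n <= m)%N >-> (n <= m)%E}.
  move=> i j ij; rewrite lee_fin ge0_ler_powR ?nnegrE ?Hs_ge0//; first exact: ltW.
  exact: Hs_nd.
have E : (\int[mu]_(t in Dm M) (Hlim (R := R) Q t `^ q)%:E =
   \int[mu]_(t in Dm M) limn (fun N => (Hs (R := R) Q N t `^ q)%:E))%E.
  apply: eq_integral => t /set_mem/Dm_neq0 t0; apply/esym/cvg_lim => //.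
  have c := cvg_Hs invP_cvg t0.
  suff c' : Hs (R := R) Q N t `^ q @[N --> \oo] --> Hlim Q t `^ q.
    by apply: cvg_EFin; [by near=> N|exact: c'].
  (* x^q is only used as a continuous function on x > 0 *)
  have [H0|H0] := eqVneq (Hlim Q t : R) 0.
    have -> : (fun N => Hs (R := R) Q N t `^ q) = (fun=> 0 `^ q).
      apply/funext => N; congr (_ `^ _); apply/eqP; rewrite eq_le Hs_ge0 andbT.
      by rewrite -H0 Hs_le_Hlim.
    by rewrite H0; exact: cvg_cst.
  have Hp : 0 < Hlim Q t :> R by rewrite lt_def H0 Hlim_ge0.
  exact: (cvg_comp _ _ c (@continuous_powR_at R q _ Hp)).
rewrite E monotone_convergence; last 4 first.
- exact: measurable_Dm.
- by move=> n; apply: measurable_funTS; exact: mq.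
- by move=> n t _; rewrite lee_fin powR_ge0.
- by move=> t _; exact: nd.
apply: lime_le.
  apply: ereal_nondecreasing_is_cvgn => i j ij; apply: ge0_le_integral => //.
  - exact: measurable_Dm.
  - by move=> t _; rewrite lee_fin powR_ge0.
  - by apply: measurable_funTS; exact: mq.
  - by apply: measurable_funTS; exact: mq.
  - by move=> t _; exact: nd.
near=> N; apply: le_trans (HB N); apply: ge0_subset_integral => //.
- exact: measurable_Dm.
- by apply: measurable_funTS; exact: mq.
- by move=> t _; rewrite lee_fin powR_ge0.
- by move=> t [].
Unshelve. all: by end_near. Qed.

Lemma integral_Hs1 M N : 0 < M ->
  (\int[mu]_(t in `[(- M)%R, M]) (Hs (R := R) Q N t `^ 1)%:E =
   (2 * \sum_(0 <= p < N | p \in P) ln (1 + M * ln p%:R) / p%:R)%:E)%E.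
Proof.
move=> M0; under eq_integral do rewrite powRr1 ?Hs_ge0//.
rewrite /Hs /series /=; under eq_integral do rewrite -sumEFin.
rewrite ge0_integral_sum//; last 2 first.
- move=> p; apply/measurable_EFinP; apply: measurable_funTS; rewrite /hpart.
  case: (p \in P); last exact: measurable_cst.
  by apply: continuous_measurable_fun => t; apply: cvgM; [exact: cvg_cst|exact: continuous_kerL (ln_nat_ge0 _ _) _].
- by move=> p t _; rewrite lee_fin hpart_ge0.
rewrite [in RHS]big_mkcond mulr_sumr -sumEFin; apply: eq_bigr => p _; rewrite /hpart.
case: ifPn => [pP|_]; last by rewrite integral0 mulr0.
under eq_integral do rewrite EFinM.
rewrite ge0_integralZl_EFin//.
- by rewrite integral_kerL ?ln_nat_ge0// -EFinM; congr EFin; ring.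
- by move=> t _; rewrite lee_fin hker_ge0.
- apply/measurable_EFinP; apply: measurable_funTS; apply: continuous_measurable_fun.
  exact: continuous_kerL (ln_nat_ge0 _ _).
Qed.

(** In Jensen's inequality the weights (ln p)^(1/q') / p and the values
    hker p t (ln p)^(-1/q') are used: the factor (ln p)^(q/q') = (ln p)^(q-1) then
    cancels exactly the integral of the q-th power of the kernel. *)
Lemma integral_Hsq (q q' : R) M N : 0 < M -> 1 < q -> 1 < q' -> q^-1 + q'^-1 = 1 ->
  (\int[mu]_(t in `[(- M)%R, M]) (Hs (R := R) Q N t `^ q)%:E <=
   ((\sum_(0 <= p < N | p \in P) ln p%:R `^ q'^-1 / p%:R) `^ q * (2 / (q - 1)))%:E)%E.
Proof.
move=> M0 q1 q'1 qq'.
have q0 : 0 < q by rewrite (lt_trans _ q1).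
have q10 : 0 < q - 1 by rewrite subr_gt0.
pose w (p : nat) : R := ln p%:R `^ q'^-1.
pose a (p : nat) : R := if p \in P then w p / p%:R else 0.
pose u t (p : nat) : R := hker p t / w p.
have a0 p : 0 <= a p by rewrite /a; case: ifP => // _; rewrite divr_ge0// powR_ge0.
have u0 t p : 0 <= u t p by rewrite divr_ge0 ?powR_ge0// hker_ge0.
have Lp p : p \in P -> 0 < ln p%:R :> R.
  by move=> /set_mem/Pprime/prime_gt1 p1; rewrite ln_gt0// ltr1n.
have wp p : p \in P -> 0 < w p by move=> pP; rewrite powR_gt0// Lp.
have HsE t : Hs (R := R) Q N t = \sum_(0 <= p < N) a p * u t p.
  apply: eq_bigr => p _; rewrite /hpart /a /u; case: ifPn => [pP|_]; last by rewrite mul0r.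
  have := gt_eqF (wp p pP); move: (p%:R^-1) (hker p t) (w p) => x h v /negbT v0.
  by field.
set W := \sum_(0 <= p < N | p \in P) ln p%:R `^ q'^-1 / p%:R.
have WE : \sum_(0 <= p < N) a p = W by rewrite /W [RHS]big_mkcond.
have W0 : 0 <= W by rewrite -WE sumr_ge0.
have mk p (c : R) : measurable_fun setT (fun t : R => (c * u t p `^ q)%:E).
  apply/measurable_EFinP; apply: measurable_funM; first exact: measurable_cst.
  apply: (measurableT_comp (measurable_powR q)); apply: continuous_measurable_fun => t.
  by apply: cvgM; [exact: continuous_kerL (ln_nat_ge0 _ _) _|exact: cvg_cst].
have step1 : (\int[mu]_(t in `[(- M)%R, M]) (Hs (R := R) Q N t `^ q)%:E <=
  \int[mu]_(t in `[(- M)%R, M]) ((W `^ (q - 1))%:E * \sum_(0 <= p < N) (a p * u t p `^ q)%:E))%E.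
  apply: ge0_le_integral => //.
  - by move=> t _; rewrite lee_fin powR_ge0.
  - apply: measurable_funTS; apply/measurable_EFinP.
    exact: (measurableT_comp (measurable_powR q) (measurable_Hs N)).
  - apply: measurable_funTS; apply: emeasurable_funM; first exact: measurable_cst.
    by apply: emeasurable_sum => p; exact: mk.
  - move=> t _; rewrite sumEFin -EFinM lee_fin HsE -WE.
    exact: (@jensen_powR R q q' _ _ a (u t)).
apply: (le_trans step1); rewrite ge0_integralZl_EFin ?powR_ge0//; last 2 first.
- by move=> t _; rewrite sume_ge0// => p _; rewrite lee_fin mulr_ge0// powR_ge0.
- by apply: measurable_funTS; apply: emeasurable_sum => p; exact: mk.
rewrite ge0_integral_sum//; last 2 first.
- by move=> p; apply: measurable_funTS; exact: mk.
- by move=> p t _; rewrite lee_fin mulr_ge0// powR_ge0.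
have wq p : p \in P -> w p `^ q = ln p%:R `^ (q - 1).
  move=> pP; rewrite /w -powRrM; congr (_ `^ _).
  have -> : q'^-1 = 1 - q^-1 by rewrite -qq' addrC addKr.
  by rewrite mulrBl mul1r mulVf// gt_eqF.
have step2 p : (\int[mu]_(t in `[(- M)%R, M]) (a p * u t p `^ q)%:E <= (a p * (2 / (q - 1)))%:E)%E.
  rewrite {1 2}/a; case: ifPn => [pP|_]; last first.
    by rewrite mul0r (eq_integral (fun=> 0%E)) ?integral0// => t _; rewrite mul0r.
  under eq_integral do rewrite EFinM.
  have ap : 0 <= w p / p%:R by rewrite divr_ge0// powR_ge0.
  have mu1 : measurable_fun setT (fun t : R => (u t p `^ q)%:E).
    by have := mk p 1; under eq_fun do rewrite mul1r.
  rewrite ge0_integralZl_EFin//; last 2 first.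
  - by move=> t _; rewrite lee_fin powR_ge0.
  - exact: measurable_funTS.
  rewrite [X in (_ <= X)%E]EFinM lee_wpmul2l ?lee_fin//.
  have e t : u t p `^ q = (ln p%:R `^ (q - 1))^-1 * hker p t `^ q.
    rewrite /u powRM ?hker_ge0 ?invr_ge0 ?powR_ge0// mulrC; congr (_ * _).
    by rewrite -powR_inv1 ?powR_ge0// -powRrM mulrC powRrM wq// powR_inv1 ?powR_ge0.
  under eq_integral do rewrite e EFinM.
  rewrite ge0_integralZl_EFin ?invr_ge0 ?powR_ge0//; last 2 first.
  - by move=> t _; rewrite lee_fin powR_ge0.
  - apply: measurable_funTS; apply/measurable_EFinP.
    apply: (measurableT_comp (measurable_powR q)); apply: continuous_measurable_fun.
    exact: continuous_kerL (ln_nat_ge0 _ _).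
  have -> : 2 / (q - 1) = (ln p%:R `^ (q - 1))^-1 * (2 * (ln p%:R `^ (q - 1) / (q - 1))).
    have x0 : 0 < ln p%:R `^ (q - 1) :> R by rewrite powR_gt0// Lp.
    by move: (ln p%:R `^ (q - 1)) x0 => x x0; field; rewrite !lt0r_neq0.
  rewrite [X in (_ <= X)%E]EFinM lee_wpmul2l ?lee_fin ?invr_ge0 ?powR_ge0//.
  by apply: integral_kerL_powR => //; exact: Lp.
apply: (@le_trans _ _ ((W `^ (q - 1))%:E * \sum_(0 <= p < N) (a p * (2 / (q - 1)))%:E)%E).
  by rewrite lee_wpmul2l ?lee_fin ?powR_ge0// lee_sum.
rewrite sumEFin -EFinM lee_fin -mulr_suml WE mulrA.
by rewrite (mulrC _ W) mulr_powRB1.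
Qed.

End HlimIntegral.

(** * Test functions and the fundamental lemma *)

Section Bump.
Variable R : realType.
Implicit Types (f g : R -> R) (x : R).

(** The functions x^(-k) e^(-1/x), extended by 0: a family that contains the usual
    flat function (k = 0) and whose linear span is stable under differentiation. *)
Definition flat (k : nat) x : R := if 0 < x then x^-1 ^+ k * expR (- x^-1) else 0.

(** Shows that the difference quotient of [flat k] at 0 tends to 0. *)
Lemma flat_bound k x : 0 < x -> `|x^-1 * flat k x| <= (k.+2)`!%:R * x.
Proof.
move=> x0; rewrite /flat x0 ger0_norm; last first.
  by rewrite !mulr_ge0// ?exprn_ge0 ?expR_ge0 ?invr_ge0// ltW.
have y0 : 0 <= x^-1 by rewrite invr_ge0 ltW.
(* one term of the exponential series at 1/x *)
have := expR_ge1Dxn k.+1 y0; rewrite expRN.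
have fp : 0 < (k.+2)`!%:R :> R by rewrite ltr0n fact_gt0.
move=> h; rewrite mulrA -exprS ler_pdivrMr ?expR_gt0//.
have e1 : x^-1 ^+ k.+1 = x^-1 ^+ k.+2 * x by rewrite [in RHS]exprS mulrAC mulVf ?mul1r// gt_eqF.
by rewrite e1 [leRHS]mulrAC ler_pM2r// -ler_pdivrMl// mulrC (le_trans _ h)// lerDr.
Qed.

Lemma is_derive_flat_pos k x : 0 < x ->
  is_derive x 1 (flat k) (flat k.+2 x - k%:R * flat k.+1 x).
Proof.
move=> x0; have xn0 : x != 0 by rewrite gt_eqF.
pose F y : R := y^-1 ^+ k * expR (- y^-1).
have near_F : \forall y \near x, flat k y = F y.
  near=> y; rewrite /flat ifT//; near: y; exact: lt_nbhsr.
have dV : is_derive x 1 (fun y : R => y^-1) (- x ^- 2 *: 1).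
  exact: (@is_deriveV R id x 1 1).
have dE : is_derive x 1 (fun y : R => expR (- y^-1)) (expR (- x^-1) * (- (- x ^- 2 *: 1))).
  apply: (is_derive1_comp (f := @expR R)); exact: is_deriveN.
have dX : is_derive x 1 (fun y : R => y^-1 ^+ k) (k%:R * x^-1 ^+ k.-1 * (- x ^- 2)).
  have -> : (fun y : R => y^-1 ^+ k) = (fun y : R => y^-1) ^+ k.
    by rewrite exprfctE.
  by apply: (is_derive_eq (is_deriveX k dV)); rewrite /GRing.scale /= mulr1.
have dF : is_derive x 1 F (flat k.+2 x - k%:R * flat k.+1 x).
  apply: (is_derive_eq (is_deriveM dX dE)).
  rewrite /GRing.scale /= /flat x0 mulr1 opprK.
  have -> : (x ^+ 2)^-1 = x^-1 ^+ 2 by rewrite exprVn.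
  case: (k) => [|n]; first by rewrite !mul0r mulr0 subr0 addr0 !expr0; ring.
  rewrite /= !exprS; ring.
apply: near_eq_is_derive dF; near=> y; apply/esym; near: y; exact: near_F.
Unshelve. all: by end_near. Qed.

Lemma is_derive_flat k x : is_derive x 1 (flat k) (flat k.+2 x - k%:R * flat k.+1 x).
Proof.
have [x0|x0|<-] := ltgtP 0 x; first exact: is_derive_flat_pos.
  have -> : flat k.+2 x - k%:R * flat k.+1 x = 0.
    by rewrite /flat ltNge (ltW x0) /= mulr0 subr0.
  apply: near_eq_is_derive (is_derive_cst (0 : R) x (1 : R)); near=> y.
  by rewrite /flat ltNge ifF//; apply/negbTE; rewrite negbK ltW//; near: y; exact: lt_nbhsl.
have -> : flat k.+2 0 - k%:R * flat k.+1 0 = 0.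
  by rewrite /flat ltxx mulr0 subr0.
have c : h^-1 *: ((flat k \o shift 0) (h *: 1) - flat k 0) @[h --> 0^'] --> (0 : R).
  apply/cvgrPdist_le => e e0.
  have fp : 0 < (k.+2)`!%:R :> R by rewrite ltr0n fact_gt0.
  near=> h; rewrite sub0r normrN /= addr0 /GRing.scale /= mulr1.
  have -> : flat k 0 = 0 by rewrite /flat ltxx.
  rewrite subr0; have [h0|h0] := leP h 0.
    by rewrite {1}/flat ltNge h0 /= mulr0 normr0 ltW.
  rewrite (le_trans (flat_bound k h0))// mulrC -ler_pdivlMr//.
  rewrite (le_trans (ler_norm _))//.
  near: h; apply: dnbhs0_le; exact: divr_gt0.
apply: DeriveDef; first by apply/cvg_ex; exists 0.
by rewrite /derive; apply/cvg_lim.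
Unshelve. all: by end_near. Qed.

(** n-fold differentiability, set up recursively so that the closure properties
    follow by induction on n. *)
Fixpoint Cn (n : nat) f : Prop :=
  if n is n'.+1 then (forall x, derivable f x 1) /\ Cn n' (derive1 f) else True.

Lemma CnW n f : Cn n.+1 f -> Cn n f.
Proof. by elim: n f => [//|n IH] f [df /IH h]; split. Qed.

Lemma Cn_smooth f : (forall n, Cn n f) -> smooth f.
Proof.
move=> h k; move: (h k.+1); elim: k f {h} => [|k IH] f; first by move=> [].
by move=> [_ /IH]; rewrite derive1Sn.
Qed.

Lemma CnS n f f' : (forall x, is_derive x 1 f (f' x)) -> Cn n f' -> Cn n.+1 f.
Proof.
move=> df h; split; first by move=> x; have [] := df x.
suff -> : derive1 f = f' by [].
by apply/funext => x; rewrite derive1E derive_val.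
Qed.

Lemma Cn_derive n f : Cn n.+1 f -> forall x, is_derive x 1 f (derive1 f x).
Proof.
by move=> [df _] x; apply: DeriveDef; [exact: df|rewrite derive1E].
Qed.

Lemma Cn_cst n (c : R) : Cn n (cst c).
Proof.
elim: n c => [//|n IH] c; apply: (CnS (f' := cst 0)) (IH 0) => x; exact: is_derive_cst.
Qed.

Lemma Cn_D n f g : Cn n f -> Cn n g -> Cn n (fun x => f x + g x).
Proof.
elim: n f g => [//|n IH] f g cf cg.
apply: (CnS (f' := fun x => derive1 f x + derive1 g x)); last by apply: IH; [case: cf|case: cg].
by move=> x; apply: is_deriveD; exact: (@Cn_derive n).
Qed.

Lemma Cn_M n f g : Cn n f -> Cn n g -> Cn n (fun x => f x * g x).
Proof.
elim: n f g => [//|n IH] f g cf cg.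
apply: (CnS (f' := fun x => f x * derive1 g x + g x * derive1 f x)).
  by move=> x; apply: is_deriveM; exact: (@Cn_derive n).
by apply: Cn_D; apply: IH; [exact: CnW|case: cg|exact: CnW|case: cf].
Qed.

Lemma Cn_affine n f (a b : R) : Cn n f -> Cn n (fun x => f (x * a + b)).
Proof.
elim: n f => [//|n IH] f cf.
apply: (CnS (f' := fun x => derive1 f (x * a + b) * a)).
  move=> x; apply: (is_derive1_comp (f := f) (g := fun x => x * a + b)).
    exact: (@Cn_derive n).
  apply: (is_derive_eq (is_deriveD (is_derive_scale a x) (is_derive_cst b x (1 : R)))).
  by rewrite addr0.
by apply: Cn_M; [apply: IH; case: cf|exact: Cn_cst].
Qed.

Lemma Cn_flat n k : Cn n (flat k).
Proof.
elim: n k => [//|n IH] k; apply: (CnS (@is_derive_flat k)).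
apply: Cn_D => //; under eq_fun do rewrite -mulNr.
by apply: Cn_M => //; exact: Cn_cst.
Qed.

(** Smooth functions supported in [a, b] that increase to the indicator of ]a, b[. *)
Definition bumpfn (a b : R) (n : nat) x : R :=
  flat 0 (x * n.+1%:R + - (a * n.+1%:R)) * flat 0 (x * - n.+1%:R + b * n.+1%:R).

Lemma smooth_bump a b n : smooth (bumpfn a b n).
Proof. by apply: Cn_smooth => k; apply: Cn_M; apply: Cn_affine; exact: Cn_flat. Qed.

Lemma flat0_bounds x : 0 <= flat 0 x <= 1.
Proof.
rewrite /flat; case: ifPn => x0; last by rewrite lexx ler01.
by rewrite expr0 mul1r expR_ge0 expR_le1 oppr_le0 invr_ge0 ltW.
Qed.

Lemma bump_bounds a b n x : 0 <= bumpfn a b n x <= 1.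
Proof.
have /andP[h1 h2] := flat0_bounds (x * n.+1%:R + - (a * n.+1%:R)).
have /andP[h3 h4] := flat0_bounds (x * - n.+1%:R + b * n.+1%:R).
by rewrite mulr_ge0//= mulr_ile1.
Qed.

Lemma bump_out a b n x : ~ `]a, b[%classic x -> bumpfn a b n x = 0.
Proof.
move=> h; have n0 : 0 < n.+1%:R :> R by rewrite ltr0n.
have e1 : x * n.+1%:R + - (a * n.+1%:R) = (x - a) * n.+1%:R by ring.
have e2 : x * - n.+1%:R + b * n.+1%:R = (b - x) * n.+1%:R by ring.
rewrite /bumpfn e1 e2 /flat !pmulr_lgt0// !subr_gt0.
case: ltP => ax; last by rewrite mul0r.
by case: ltP => xb; rewrite ?mulr0//; exfalso; apply: h; rewrite /= in_itv /= ax xb.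
Qed.

Lemma flat0_cvg (c : R) : 0 < c -> flat 0 (c * n.+1%:R) @[n --> \oo] --> (1 : R).
Proof.
move=> c0.
have -> : (fun n => flat 0 (c * n.+1%:R)) = (fun n => expR (- (c^-1 * n.+1%:R^-1))).
  by apply/funext => n; rewrite /flat mulr_gt0// expr0 mul1r invfM.
have H : - (c^-1 * n.+1%:R^-1) @[n --> \oo] --> (0 : R).
  rewrite -oppr0; apply: cvgN; rewrite -(mulr0 c^-1); apply: cvgM; first exact: cvg_cst.
  exact: (@cvg_harmonic R).
by have := cvg_comp _ _ H (@continuous_expR R 0); rewrite expR0.
Qed.

Lemma bump_cvg a b x : bumpfn a b n x @[n --> \oo] --> (\1_(`]a, b[) x : R).
Proof.
have [xab|nxab] := pselect (`]a, b[%classic x); last first.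
  under eq_fun do rewrite (bump_out _ nxab).
  by rewrite indicE memNset//; exact: cvg_cst.
rewrite indicE mem_set//; move: xab; rewrite /= in_itv /= => /andP[ax xb].
rewrite /= -[X in _ --> X](mulr1 (1 : R)); apply: cvgM.
  have e n : x * n.+1%:R + - (a * n.+1%:R) = (x - a) * n.+1%:R by ring.
  by under eq_fun do rewrite e; apply: flat0_cvg; rewrite subr_gt0.
have e n : x * - n.+1%:R + b * n.+1%:R = (b - x) * n.+1%:R by ring.
by under eq_fun do rewrite e; apply: flat0_cvg; rewrite subr_gt0.
Qed.

Definition cbump (a b : R) (n : nat) x : R[i] := (bumpfn a b n x)%:C.

Lemma test_cbump a b n : test_function (cbump a b n).
Proof.
split; first exact: smooth_bump.
  apply: Cn_smooth => k; exact: (Cn_cst k 0).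
apply: (@subclosed_compact _ _ `[a, b]%classic).
- exact: closed_closure.
- exact: segment_compact.
have -> : `[a, b]%classic = closure (`[a, b]%classic : set R).
  by apply/closure_id; exact: interval_closed.
apply: closure_subset => x /= h.
apply: contrapT => hx; move/eqP: h; apply.
rewrite /cbump bump_out// => hx'; apply: hx; move: hx'; rewrite /= !in_itv /= => /andP[h1 h2].
by rewrite !ltW.
Qed.
End Bump.

Section FundamentalLemma.
Variable R : realType.
Notation mu := (@lebesgue_measure R).

(** Almost every point is a Lebesgue point: if u x <> 0 there, the mean of
    |u - u x| over small intervals around x is at least |u x|, because u has mean 0
    on them, and so cannot tend to 0. *)
Lemma ae_zero_of_integrals (u : R -> R) (c d : R) :
  mu.-integrable setT (EFin \o u) ->
  (forall a b, c < a -> a < b -> b < d -> (\int[mu]_(x in `]a, b[) (u x)%:E = 0)%E) ->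
  {ae mu, forall x, `]c, d[%classic x -> u x = 0}.
Proof.
move=> iu Hu; have lu : locally_integrable setT u.
  by apply: open_integrable_locally => //; exact: openT.
have mu' : measurable_fun setT u by case: lu.
have [A [mA A0 hA]] := lebesgue_differentiation lu; exists A; split=> // x /= nx.
apply: hA => /= lx; apply: nx; rewrite in_itv /= => /andP[cx xd].
apply: contrapT => /eqP ux0.
have ux : 0 < `|u x| by rewrite normr_gt0.
(* [davg u x r] is the mean of |u - u x| over the ball of radius r *)
have key : \forall r \near (0 : R)^'+, ((`|u x|)%:E <= davg u x r)%E.
  near=> r; have r0 : 0 < r by [].
  have h1 : c < x - r.
    by rewrite ltrBrDr -ltrBrDl; near: r; apply: nbhs_right_lt; rewrite subr_gt0.
  have h2 : x + r < d.
    by rewrite -ltrBrDl; near: r; apply: nbhs_right_lt; rewrite subr_gt0.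
  rewrite /davg /iavg lebesgue_measure_ball ?(ltW r0)// inver mulrn_eq0 /= gt_eqF//.
  rewrite -(@lee_pmul2l _ (r *+ 2)%:E) ?lte_fin ?mulrn_wgt0// muleA -EFinM.
  rewrite [X in (_ <= X * _)%E](_ : _ = 1%E) ?mul1e; last first.
    by rewrite -EFinM divff// mulrn_eq0 /= gt_eqF.
  have mb : measurable (ball x r) by exact: measurable_ball.
  have iub : mu.-integrable (ball x r) (EFin \o u) by exact: integrableS iu.
  have fin : (mu (ball x r) < +oo)%E by rewrite lebesgue_measure_ball ?ltry ?(ltW r0).
  have icb : mu.-integrable (ball x r) (EFin \o cst (u x)).
    have mc : measurable_fun setT (EFin \o cst (u x) : R -> \bar R).
      by apply/measurable_EFinP; exact: measurable_cst.
    apply/integrableP; split; first exact: measurable_funTS mc.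
    rewrite (eq_integral (cst `|u x|%:E))//= integral_cst//.
    by rewrite lte_mul_pinfty// abse_ge0.
  have -> : ((r *+ 2 * `|u x|)%:E = `|\int[mu]_(y in ball x r) ((u y)%:E - (u x)%:E)|)%E.
    rewrite integralB_EFin// [X in (X - _)%E](_ : _ = 0%E); last first.
      by rewrite ball_itv; apply: Hu => //; rewrite (@lt_trans _ _ x) ?ltrDl ?gtrDl ?oppr_lt0.
    rewrite integral_cst//= sub0e abseN abseM lebesgue_measure_ball ?(ltW r0)//= EFinM muleC.
    by rewrite (@ger0_norm _ (r *+ 2))// mulrn_wge0// ltW.
  apply: le_trans (le_abse_integral _ _ _) _ => //.
  apply: emeasurable_funB; apply/measurable_EFinP; last exact: measurable_cst.
  exact: measurable_funTS.
have h : ((`|u x|)%:E <= 0)%E := cvge_to_ge lx key.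
rewrite lee_fin in h; have h0 : `|u x| <= 0 by apply: h; exact: at_right_proper_filter.
by have := lt_le_trans ux h0; rewrite ltxx.
Unshelve. all: by end_near. Qed.

(** Testing against the bump functions and letting them tend to the indicator of
    the interval. *)
Lemma integral_zero_of_test (u : R -> R) (a b : R) :
  mu.-integrable setT (EFin \o u) ->
  (forall n, (\int[mu]_t (u t * bumpfn a b n t))%R = 0) ->
  (\int[mu]_(x in `]a, b[) (u x)%:E = 0)%E.
Proof.
move=> iu H; have mu' : measurable_fun setT u.
  by case/integrableP: iu => /measurable_EFinP.
have mB n : measurable_fun setT (bumpfn a b n).
  by apply: continuous_measurable_fun; apply: smooth_continuous; exact: smooth_bump.
have c : (\int[mu]_t (u t * bumpfn a b n t))%R @[n --> \oo] -->
    (\int[mu]_t (u t * \1_(`]a, b[) t))%R.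
  apply: (@dct_R R _ _ (fun t => `|u t|)).
  - by move=> n; exact: measurable_funM.
  - by apply: measurable_funM => //; exact: measurable_indic.
  - by move=> t _; apply: cvgM; [exact: cvg_cst|exact: bump_cvg].
  - exact: integrable_norm iu.
  - move=> n t _; have /andP[h1 h2] := bump_bounds a b n t.
    by rewrite normrM ler_piMr// ger0_norm.
have E : (\int[mu]_t (u t * \1_(`]a, b[) t))%R = 0.
  move: c; under eq_fun do rewrite H.
  by move=> c; rewrite -(cvg_lim _ c)//; apply: lim_cst.
have iab : mu.-integrable `]a, b[%classic (EFin \o u) by exact: integrableS iu.
have iab' : mu.-integrable setT ((EFin \o u) \_ `]a, b[).
  by apply: (proj1 (@integrable_mkcond _ _ _ mu _ (EFin \o u) _)).
rewrite integral_mkcond -[LHS]fineK; last exact: (integrable_fin_num measurableT iab').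
have -> : fine (\int[mu]_x ((fun x => (u x)%:E) \_ `]a, b[) x)%E =
   (\int[mu]_t (u t * \1_(`]a, b[) t))%R.
  rewrite /Rintegral; congr fine; apply: eq_integral => x _.
  by rewrite patchE indicE; case: ifPn => _; rewrite ?mulr1 ?mulr0.
by rewrite E.
Qed.
End FundamentalLemma.

(** * Sums over primes *)

Section PrimeSums.
Variable R : realType.
Implicit Types (c : nat -> R) (A : set nat).

(** Finitely many terms may be negative: this is the case of ln (ln p) / p at
    p = 2. *)
Lemma eseries_lty_bounded c A k : (forall p, (k <= p)%N -> A p -> 0 <= c p) ->
  (\sum_(p <oo | p \in A) (c p)%:E < +oo)%E <->
  exists B : R, forall N, \sum_(0 <= p < N | p \in A) c p <= B.
Proof.
move=> c0; set S := fun N => \sum_(0 <= p < N | p \in A) c p.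
have SE N : (\sum_(0 <= p < N | p \in A) (c p)%:E)%E = (S N)%:E by rewrite sumEFin.
have nd n m : (k <= n)%N -> (n <= m)%N -> S n <= S m.
  move=> kn nm; rewrite /S [leRHS](big_cat_nat (n := n))//= lerDl big_nat_cond sumr_ge0//.
  by move=> i /andP[/andP[ni _] /set_mem Ai]; apply: c0 => //; exact: leq_trans ni.
have cv : (fun N => (S (N + k)%N)%:E) N @[N --> \oo] --> ereal_sup (range (fun N => (S (N + k)%N)%:E)).
  apply: ereal_nondecreasing_cvgn => n m nm; rewrite lee_fin; apply: nd; first exact: leq_addl.
  by rewrite leq_add2r.
have limE : (\sum_(p <oo | p \in A) (c p)%:E)%E = ereal_sup (range (fun N => (S (N + k)%N)%:E)).
  have H : (S N)%:E @[N --> \oo] --> ereal_sup (range (fun N => (S (N + k)%N)%:E)).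
    by rewrite -(cvg_shiftn k (fun N => (S N)%:E)).
  by apply/cvg_lim => //; under eq_fun do rewrite SE; exact: H.
rewrite limE; split=> [h|[B HB]].
  have [B HB] : exists B : R, forall N, S (N + k)%N <= B.
    have ub N : ((S (N + k)%N)%:E <= ereal_sup (range (fun N => (S (N + k)%N)%:E)))%E.
      by apply: ereal_sup_ubound; exists N.
    case E : (ereal_sup _) h ub => [B| |] // _ ub.
      by exists B => N; rewrite -lee_fin.
    by have := ub 0%N; rewrite leNgt ltNyr.
  exists (\sum_(0 <= n < k) `|S n| + B + `|B|) => N.
  have [kN|Nk] := leqP k N.
    have := HB (N - k)%N; rewrite subnK// => /le_trans; apply.
    by rewrite addrAC lerDr addr_ge0// sumr_ge0.
  apply: (@le_trans _ _ (\sum_(0 <= n < k) `|S n|)); last first.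
    by rewrite -addrA lerDl -lerBlDl sub0r ler_normr lexx orbT.
  rewrite (bigD1_seq N)/= ?mem_index_iota ?iota_uniq//.
  by rewrite (le_trans (ler_norm _))// lerDl sumr_ge0.
apply: (@le_lt_trans _ _ B%:E); last exact: ltry.
by apply: ge_ereal_sup => _ [N _ <-]; rewrite lee_fin HB.
Qed.

Lemma eseries_y_unbounded c A k : (forall p, (k <= p)%N -> A p -> 0 <= c p) ->
  (\sum_(p <oo | p \in A) (c p)%:E = +oo)%E ->
  ~ exists B : R, forall N, \sum_(0 <= p < N | p \in A) c p <= B.
Proof. by move=> c0 h /(eseries_lty_bounded c0); rewrite h ltxx. Qed.

Variable Q : set nat.
Notation P := (primeset `\` Q).

Lemma cvg_invP_of_sum : (\sum_(p <oo | p \in P) ((p%:R : R)^-1)%:E < +oo)%E ->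
  cvgn (series (invP R P)).
Proof.
move=> /(@eseries_lty_bounded _ _ 0%N) []; first by move=> p _ _; rewrite invr_ge0.
move=> B HB; apply: (is_cvg_bounded_series (B := B)); first exact: invP_ge0.
by move=> N; rewrite /series /= /invP -big_mkcond.
Qed.

Lemma sum_le_bounded c c' A (B : R) (K1 K2 : R) (d : nat -> R) (B' : R) :
  0 <= K1 -> 0 <= K2 ->
  (forall N, \sum_(0 <= p < N | p \in A) c p <= B) ->
  (forall N, \sum_(0 <= p < N | p \in A) d p <= B') ->
  (forall p, A p -> c' p <= K1 * c p + K2 * d p) ->
  forall N, \sum_(0 <= p < N | p \in A) c' p <= K1 * B + K2 * B'.
Proof.
move=> K10 K20 HB HB' h N.
apply: (@le_trans _ _ (\sum_(0 <= p < N | p \in A) (K1 * c p + K2 * d p))).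
  by apply: ler_sum => p /set_mem; exact: h.
by rewrite big_split /= -!mulr_sumr lerD// ler_wpM2l.
Qed.

Lemma invP_bounded : cvgn (series (invP R P)) ->
  forall N, \sum_(0 <= p < N | p \in P) (p%:R^-1 : R) <= limn (series (invP R P)).
Proof.
by move=> cP N; rewrite big_mkcond; exact: (series_le_lim N (@invP_ge0 R P) cP).
Qed.

Lemma ln_ge_ln2 p : prime p -> ln 2 <= ln p%:R :> R.
Proof.
move=> /prime_gt1 p1; rewrite ler_ln ?posrE ?ltr0n//; last exact: ltnW.
by rewrite ler_nat.
Qed.

Lemma ln2_gt0 : 0 < ln 2 :> R.
Proof. by rewrite ln_gt0// ltr1n. Qed.

(** The terms of the integral of H are ln (ln p) / p up to a multiple of 1/p. *)
Lemma ln1D_le_lnln M p : 0 < M -> prime p ->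
  ln (1 + M * ln p%:R) <= ln (ln p%:R) + ln ((ln 2)^-1 + M) :> R.
Proof.
move=> M0 pp; have L2 := ln_ge_ln2 pp; have l2 := ln2_gt0.
have L0 : 0 < ln p%:R :> R by apply: lt_le_trans L2.
have c0 : 0 < (ln 2)^-1 + M by rewrite addr_gt0// invr_gt0.
rewrite -lnM ?posrE// ler_ln ?posrE ?mulr_gt0 ?addr_gt0 ?mulr_gt0 ?invr_gt0//.
by rewrite mulrDr [M * _]mulrC lerD2r ler_pdivlMr// mul1r.
Qed.

Lemma ln1D_bounded M : 0 < M -> cvgn (series (invP R P)) ->
  (exists B : R, forall N, \sum_(0 <= p < N | p \in P) ln (ln p%:R) / p%:R <= B) ->
  exists B : R, forall N, \sum_(0 <= p < N | p \in P) ln (1 + M * ln p%:R) / p%:R <= B.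
Proof.
move=> M0 cP [B HB].
exists (1 * B + `|ln ((ln 2)^-1 + M)| * limn (series (invP R P))).
apply: (sum_le_bounded ler01 (normr_ge0 _) HB (invP_bounded cP)) => p [pp _].
rewrite mul1r -mulrDl ler_wpM2r// (le_trans (ln1D_le_lnln M0 pp))// lerD2l ler_norm//.
Qed.

Lemma ln_ge1 p : (4 <= p)%N -> 1 <= ln p%:R :> R.
Proof.
move=> p4; apply: (@le_trans _ _ (ln 4)); last first.
  by rewrite ler_ln ?posrE ?ltr0n ?(leq_trans _ p4)// ler_nat.
have -> : 4 = 2 ^+ 2 :> R by rewrite -natrX.
rewrite lnXn// mulr2n.
(* ln 4 = - 2 ln (1 - 1/2) >= 1 *)
have h : ln (1 + - 2^-1 : R) <= - 2^-1 by apply: le_ln1Dx; lra.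
have e : 1 + - 2^-1 = 2^-1 :> R by lra.
by rewrite e lnV ?posrE// in h; lra.
Qed.

Lemma lnln_ge0 p : (4 <= p)%N -> 0 <= ln (ln p%:R) / p%:R :> R.
Proof. by move=> p4; rewrite divr_ge0// ln_ge0// ln_ge1. Qed.

(** From ln x <= x at x = (ln p)^(1/q'). *)
Lemma lnln_bounded_of_power q' : 0 < q' :> R ->
  (exists B : R, forall N, \sum_(0 <= p < N | p \in P) ln p%:R `^ q'^-1 / p%:R <= B) ->
  exists B : R, forall N, \sum_(0 <= p < N | p \in P) ln (ln p%:R) / p%:R <= B.
Proof.
move=> q0 [B HB]; exists (q' * B + 0 * 0).
apply: (sum_le_bounded (d := fun=> 0) (ltW q0) (lexx 0) HB).
  by move=> N; rewrite big1.
move=> p [pp _]; rewrite mul0r addr0 mulrA ler_wpM2r// -ler_pdivrMl// -ln_powR.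
have L0 : 0 < ln p%:R :> R by apply: lt_le_trans (ln_ge_ln2 pp); exact: ln2_gt0.
by rewrite ltW// ln_sublinear// powR_gt0.
Qed.
End PrimeSums.

(** * Lower bounds for cosine integrals *)

Section LowerIntegrals.
Variable R : realType.
Notation mu := (@lebesgue_measure R).
Implicit Types (L e : R).

Lemma measurable_invR : measurable_fun setT (fun t : R => t^-1).
Proof.
have [+ _] : measC (fun t : R => (t +i* 0)^-1).
  by apply: measC_V; split => /=; [exact: measurable_id|exact: measurable_cst].
apply: eq_measurable_fun => t _; rewrite cReV /= expr0n addr0.
have [->|t0] := eqVneq t 0; first by rewrite mul0r invr0.
by rewrite expr2 invfM mulrA mulfV// mul1r.
Qed.

Lemma measurable_coskerV L : measurable_fun setT (fun t : R => (1 - cos (t * L)) / t).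
Proof.
apply: measurable_funM; last exact: measurable_invR.
apply: continuous_measurable_fun => t; apply: cvgB; first exact: cvg_cst.
have c : {for t, continuous (fun x : R => x * L)} by apply: cvgM => //; exact: cvg_cst.
exact: (cvg_comp _ _ c (@continuous_cos R _)).
Qed.

Lemma cos_integral_ge_ln L e : 0 < L -> 0 < e -> e <= L^-1 ->
  ((ln L - 2)%:E <= \int[mu]_(t in `]e, 1%R[) ((1 - cos (t * L)) / t * 1)%:E)%E.
Proof.
move=> L0 e0 eL; under eq_integral do rewrite mulr1.
have m (D : set R) : measurable_fun D (fun t : R => ((1 - cos (t * L)) / t)%:E).
  by apply: measurable_funTS; apply/measurable_EFinP; exact: measurable_coskerV.
have nn (x t : R) : 0 < x -> `]x, 1[%classic t -> (0 <= ((1 - cos (t * L)) / t)%:E)%E.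
  move=> x0; rewrite /= in_itv /= => /andP[xt _].
  by rewrite lee_fin divr_ge0 ?one_sub_cos_ge0// ltW// (lt_trans x0).
have [L1|L1] := leP L 1.
  apply: (@le_trans _ _ 0%E); first by rewrite lee_fin; have := ln_le0 L1; lra.
  by apply: integral_ge0 => t; exact: nn.
have Li0 : 0 < L^-1 by rewrite invr_gt0.
apply: (le_trans (integral_cos_log L1)).
rewrite -integral_itv_obnd_cbnd; last exact: m.
rewrite -integral_itv_bndo_bndc; last exact: m.
apply: ge0_subset_integral => //.
- exact: m.
- by move=> t; exact: nn.
- by move=> t; rewrite /= !in_itv /= => /andP[h ->]; rewrite (le_lt_trans eL h).
Qed.

Lemma sin_ge_quad (y : R) : y - y ^+ 2 <= sin y.
Proof. by have := norm_id_sub_sin_le y; rewrite ler_norml; lra. Qed.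

Lemma one_sub_cos_ge (x : R) : 2^-1 <= x -> x <= 1 -> 32^-1 <= 1 - cos x.
Proof.
move=> x1 x2; rewrite one_sub_cos_half.
have h := sin_ge_quad (x / 2).
have : 8^-1 <= sin (x / 2).
  apply: le_trans h; rewrite expr2; nra.
move: (sin _) => s hs; rewrite expr2; nra.
Qed.

(** The part of the integral where t lies between 1/(2L) and 1/L suffices: there
    1 - cos (tL) >= 1/32, 1/t >= L and t^(-a) >= L^a, on an interval of length
    1/(2L). *)
Lemma cos_integral_ge_powR L e (a : R) : 0 < a -> 1 <= L -> 0 < e -> e <= (2 * L)^-1 ->
  ((L `^ a / 64)%:E <= \int[mu]_(t in `]e, 1%R[) ((1 - cos (t * L)) / t * t `^ (- a))%:E)%E.
Proof.
move=> a0 L1 e0 eL; have L0 : 0 < L by rewrite (lt_le_trans _ L1).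
have m (D : set R) : measurable_fun D (fun t : R => ((1 - cos (t * L)) / t * t `^ (- a))%:E).
  apply: measurable_funTS; apply/measurable_EFinP; apply: measurable_funM.
    exact: measurable_coskerV.
  exact: measurable_powR.
have nn (x t : R) : 0 < x -> x < t -> (0 <= ((1 - cos (t * L)) / t * t `^ (- a))%:E)%E.
  move=> x0 xt.
  by rewrite lee_fin mulr_ge0 ?powR_ge0// divr_ge0 ?one_sub_cos_ge0// ltW// (lt_trans x0).
have L20 : 0 < (2 * L)^-1 by rewrite invr_gt0 mulr_gt0.
apply: (@le_trans _ _ (\int[mu]_(t in `]((2 * L)^-1)%R, (L^-1)%R[) ((1 - cos (t * L)) / t * t `^ (- a))%:E)%E); last first.
  apply: ge0_subset_integral => //.
  - exact: m.
  - by move=> t; rewrite /= in_itv /= => /andP[h _]; exact: nn h.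
  - move=> t; rewrite /= !in_itv /= => /andP[h h2]; rewrite (le_lt_trans eL h)/=.
    by rewrite (lt_le_trans h2)// invf_le1.
apply: (@le_trans _ _ (\int[mu]_(t in `]((2 * L)^-1)%R, (L^-1)%R[) (cst (32^-1 * (L * L `^ a))%:E t))%E).
  rewrite integral_cst//= lebesgue_measure_itv /= lte_fin.
  have -> : (2 * L)^-1 < L^-1 by rewrite ltf_pV2 ?posrE ?mulr_gt0//; lra.
  rewrite -EFinB -EFinM lee_fin.
  have -> : 32^-1 * (L * L `^ a) * (L^-1 - (2 * L)^-1) = L `^ a / 64.
    by move: (L `^ a) => z; field; rewrite lt0r_neq0.
  exact: lexx.
apply: ge0_le_integral => //.
- by move=> t _; rewrite lee_fin !mulr_ge0 ?powR_ge0// ltW.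
- exact: m.
- move=> t; rewrite /= in_itv /= => /andP[h1 h2]; rewrite lee_fin.
  have t0 : 0 < t by apply: lt_trans h1.
  have hL : L <= t^-1 by rewrite -[L]invrK lef_pV2 ?posrE ?invr_gt0// ltW.
  rewrite -[leRHS]mulrA ler_pM//.
  + by rewrite mulr_ge0// ?powR_ge0// ltW.
  + apply: one_sub_cos_ge.
      by rewrite -ler_pdivrMr// -invfM ltW.
    by rewrite -ler_pdivlMr// div1r ltW.
  + rewrite ler_pM ?powR_ge0 ?(ltW L0)//.
    have -> : t `^ (- a) = t^-1 `^ a by rewrite -[t^-1](powR_inv1 (ltW t0)) -powRrM mulN1r.
    by rewrite ge0_ler_powR ?nnegrE ?(ltW a0) ?(ltW L0)// invr_ge0 ltW.
Qed.
End LowerIntegrals.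

(** * Convergent prime sums give integrable boundary values *)

Section Sufficiency.
Variable R : realType.
Variable Q : set nat.
Notation P := (primeset `\` Q).
Hypothesis invP_cvg : cvgn (series (invP R P)).
Notation mu := (@lebesgue_measure R).

Lemma psi_ext_vert (d t : R) : 0 < d -> psi Q ((1 + d) +i* t) = psi_ext Q (d +i* t).
Proof.
move=> d0; rewrite -(psiE invP_cvg)//; congr psi.
by apply: eq_ReIm => /=; rewrite ?add0r.
Qed.

(** The pointwise boundary value of psi on the line Re s = 1. *)
Definition psi_line (t : R) : R[i] := psi_ext Q (0 +i* t).

Lemma measC_psi_line : measC psi_line.
Proof. exact: (measC_psi_ext invP_cvg (lexx 0)). Qed.

Let A0 (M : R) : R := eulerC R P * (8 * (1 + M) + 3).
Let B0 : R := eulerC R P * 6.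

Lemma A0_ge0 M : 0 <= M -> 0 <= A0 M.
Proof. by move=> M0; rewrite mulr_ge0 ?(ltW (eulerC_gt0 _ _))// addr_ge0// mulr_ge0// addr_ge0. Qed.

Lemma B0_ge0 : 0 <= B0.
Proof. by rewrite mulr_ge0// ltW// eulerC_gt0. Qed.

(** A bound independent of d, as needed for dominated convergence as d -> 0+. *)
Lemma cabs_psi_ext_vert_le (M d t : R) : 0 <= d -> d <= 1 -> `|t| <= M -> t != 0 ->
  cabs (psi_ext Q (d +i* t)) <= A0 M + B0 * Hlim Q t.
Proof.
move=> d0 d1 tM t0; rewrite (le_trans (cabs_psi_ext_le invP_cvg _ _))//= lerD2r.
rewrite ler_wpM2l ?(ltW (eulerC_gt0 _ _))// lerD2r ler_wpM2l//.
by rewrite (le_trans (cabs_le_ReIm _))//= lerD// ger0_norm.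
Qed.

Lemma Dm_norm (M t : R) : Dm M t -> `|t| <= M.
Proof. by move=> [+ _]; rewrite /= in_itv /= -ler_norml. Qed.

Lemma Hlim_integrable (M : R) : 0 < M ->
  (exists B : R, forall N, \sum_(0 <= p < N | p \in P) ln (ln p%:R) / p%:R <= B) ->
  mu.-integrable (Dm M) (EFin \o Hlim (R := R) Q).
Proof.
move=> M0 HB; have [B hB] := ln1D_bounded M0 invP_cvg HB.
have mH : measurable_fun (Dm M) (EFin \o Hlim (R := R) Q).
  by apply/measurable_EFinP; exact: measurable_Hlim.
apply/integrableP; split; first exact: mH.
apply: (@le_lt_trans _ _ (2 * B)%:E); last exact: ltry.
rewrite (@eq_integral _ _ _ mu _ (fun t => (Hlim (R := R) Q t `^ 1)%:E)); last first.
  move=> t /set_mem/Dm_neq0 t0; have h := Hlim_ge0 invP_cvg t0.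
  by rewrite /= powRr1// ger0_norm.
apply: (integral_Hlim_le invP_cvg ltr01) => N.
by rewrite integral_Hs1// lee_fin ler_wpM2l.
Qed.

(** Dominated convergence for one test function; the majorant may use its support. *)
Lemma boundary_of_bounded (phi : R -> R[i]) (H : R -> R) : test_function phi ->
  mu.-integrable setT (EFin \o H) ->
  (forall d t, 0 < d -> d <= 1 -> t != 0 -> cabs (psi_ext Q (d +i* t) * phi t) <= H t) ->
  cvgC (0^'+) (fun d => integralC (fun t => psi Q ((1 + d) +i* t) * phi t))
    (integralC (fun t => psi_line t * phi t)).
Proof.
move=> tphi iH HH; have mphi := measC_test tphi.
apply: dct_C iH _.
- move=> d d0; have -> : (fun t => psi Q ((1 + d) +i* t) * phi t) =
    (fun t => psi_ext Q (d +i* t) * phi t).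
    by apply/funext => t; rewrite psi_ext_vert.
  by apply: measC_M => //; exact: (measC_psi_ext invP_cvg (ltW d0)).
- by apply: measC_M => //; exact: measC_psi_line.
- move=> u t u0 uc t0; apply: cvgC_M; last exact: cvgC_cst.
  have -> : (fun n => psi Q ((1 + u n) +i* t)) = (fun n => psi_ext Q (u n +i* t)).
    by apply/funext => n; rewrite psi_ext_vert.
  exact: cvgC_psi_ext_vert.
- by move=> d t d0 d1 t0; rewrite psi_ext_vert// HH.
Qed.

Lemma integrable_cst_Dm (M c : R) : mu.-integrable (Dm M) (EFin \o cst c).
Proof.
have mc : measurable_fun setT (EFin \o cst c : R -> \bar R).
  by apply/measurable_EFinP; exact: measurable_cst.
apply/integrableP; split; first exact: measurable_funTS mc.
rewrite (eq_integral (cst `|c|%:E))//= integral_cst//; last exact: measurable_Dm.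
rewrite lte_mul_pinfty ?abse_ge0//.
apply: (@le_lt_trans _ _ (mu `[- M, M])); last by rewrite lebesgue_measure_itv /=; case: ifP; rewrite ?ltry.
by apply: le_measure; rewrite ?inE//; [exact: measurable_Dm|move=> t []].
Qed.

Lemma boundary_psi_line :
  (exists B : R, forall N, \sum_(0 <= p < N | p \in P) ln (ln p%:R) / p%:R <= B) ->
  boundary_distribution (psi Q) psi_line.
Proof.
move=> HB phi tphi; apply/cvgCE.
have [M [K [M0 K0 HK out]]] := test_bounded tphi.
pose H := (fun t => K * (A0 M + B0 * Hlim Q t)) \_ (Dm M).
have iH : mu.-integrable setT (EFin \o H).
  rewrite /H -restrict_EFin.
  apply: (proj1 (@integrable_mkcond _ _ _ mu _ _ _)); first exact: measurable_Dm.
  have i1 := Hlim_integrable M0 HB; have i2 := integrable_cst_Dm M (A0 M).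
  have mD : measurable (Dm M) by exact: measurable_Dm.
  have i3 : mu.-integrable (Dm M) (fun t => B0%:E * (EFin \o Hlim (R := R) Q) t)%E.
    by apply: integrableZl i1; exact: mD.
  have i4 : mu.-integrable (Dm M)
    (fun t => (EFin \o cst (A0 M)) t + B0%:E * (EFin \o Hlim (R := R) Q) t)%E.
    by apply: integrableD i2 i3; exact: mD.
  have i5 : mu.-integrable (Dm M) (fun t => K%:E *
     ((EFin \o cst (A0 M)) t + B0%:E * (EFin \o Hlim (R := R) Q) t))%E.
    by apply: integrableZl i4; exact: mD.
  by apply: eq_integrable i5; first exact: mD.
apply: (boundary_of_bounded tphi iH) => d t d0 d1 t0.
rewrite /H patchE; case: ifPn => [/set_mem tD|tD].
  rewrite cabsM mulrC ler_pM ?cabs_ge0//.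
  by apply: cabs_psi_ext_vert_le => //; [exact: ltW|exact: Dm_norm].
rewrite out ?mulr0 ?cabs0// => tM; move/negP: tD; apply; apply/mem_set; split=> //.
by apply/eqP.
Qed.

Lemma powR_addr_le (q x y : R) : 0 < q -> 0 <= x -> 0 <= y ->
  (x + y) `^ q <= 2 `^ q * x `^ q + 2 `^ q * y `^ q.
Proof.
move=> q0 x0 y0; rewrite -!powRM//; have q0' := ltW q0.
have [xy|yx] := leP x y.
  apply: (@le_trans _ _ ((2 * y) `^ q)); last by rewrite lerDr powR_ge0.
  by rewrite ge0_ler_powR ?nnegrE ?addr_ge0 ?mulr_ge0//; lra.
apply: (@le_trans _ _ ((2 * x) `^ q)); last by rewrite lerDl powR_ge0.
by rewrite ge0_ler_powR ?nnegrE ?addr_ge0 ?mulr_ge0//; lra.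
Qed.

Lemma Lloc_psi_line (q : R) : 0 < q ->
  (forall M, 0 < M -> exists B : R, forall N,
     (\int[mu]_(t in `[(- M)%R, M]) (Hs (R := R) Q N t `^ q)%:E <= B%:E)%E) ->
  Lloc q psi_line.
Proof.
move=> q0 HB E cE; have [m1 m2] := measC_psi_line.
have mE : measurable E by exact: compact_measurable.
split; [exact: measurable_funTS m1|exact: measurable_funTS m2|].
have [M M0 EM] := compact_itv cE.
have [B HBM] := HB M M0.
have mcq : measurable_fun setT (fun t => (cabs (psi_line t) `^ q)%:E).
  apply/measurable_EFinP; apply: (measurableT_comp (measurable_powR q)).
  exact: measurable_cabs measC_psi_line.
rewrite -/(cabs _) -(integral_setD1 (r := 0)); last 2 first.
- by apply: measurableD => //; exact: measurable_set1.
- exact: measurable_funTS mcq.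
pose a := 2 `^ q * A0 M `^ q; pose b := 2 `^ q * B0 `^ q.
have a0 : 0 <= a by rewrite mulr_ge0 ?powR_ge0.
have b0 : 0 <= b by rewrite mulr_ge0 ?powR_ge0.
have mD := measurable_Dm M.
have mH : measurable_fun (Dm M) (fun t => (Hlim (R := R) Q t `^ q)%:E).
  apply/measurable_EFinP; apply: (measurable_comp measurableT _ (measurable_powR q)) => //.
  exact: measurable_Hlim.
apply: (@le_lt_trans _ _ (\int[mu]_(t in Dm M) (a%:E + b%:E * (Hlim (R := R) Q t `^ q)%:E))%E).
  apply: (@le_trans _ _ (\int[mu]_(t in Dm M) (cabs (psi_line t) `^ q)%:E)%E).
    apply: ge0_subset_integral => //.
    - by apply: measurableD => //; exact: measurable_set1.
    - exact: measurable_funTS mcq.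
    - by move=> t _; rewrite lee_fin powR_ge0.
    - by move=> t [Et t0]; split=> //; exact: EM.
  apply: ge0_le_integral => //.
  - by move=> t _; rewrite lee_fin powR_ge0.
  - exact: measurable_funTS mcq.
  - apply: emeasurable_funD; first exact: measurable_cst.
    by apply: emeasurable_funM => //; exact: measurable_cst.
  - move=> t tD; rewrite -EFinM -EFinD lee_fin; have t0 := Dm_neq0 tD.
    have hq := cabs_psi_ext_vert_le (lexx 0) ler01 (Dm_norm tD) t0.
    have h0 := Hlim_ge0 invP_cvg t0.
    have hA := A0_ge0 (ltW M0); have hB := B0_ge0.
    apply: (@le_trans _ _ ((A0 M + B0 * Hlim Q t) `^ q)).
      apply: (ge0_ler_powR (ltW q0)) => //; first exact: cabs_ge0.
      by rewrite nnegrE; apply: addr_ge0 => //; exact: mulr_ge0.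
    have hBH : 0 <= B0 * Hlim Q t by exact: mulr_ge0.
    apply: (le_trans (powR_addr_le q0 hA hBH)); rewrite /a /b.
    by rewrite powRM// mulrA.
rewrite ge0_integralD//; last 2 first.
- by move=> t _; rewrite mule_ge0// lee_fin ?powR_ge0.
- by apply: emeasurable_funM => //; exact: measurable_cst.
rewrite ge0_integralZl_EFin//; last by move=> t _; rewrite lee_fin powR_ge0.
rewrite lte_add_pinfty//.
  have /integrableP[_ h] := integrable_cst_Dm M a; apply: le_lt_trans h.
  by rewrite le_eqVlt; apply/orP; left; apply/eqP/eq_integral => t _ /=; rewrite ger0_norm.
rewrite lte_mul_pinfty//; apply: (@le_lt_trans _ _ B%:E); last exact: ltry.
exact: integral_Hlim_le.
Qed.

Lemma extension_L1 :
  (exists B : R, forall N, \sum_(0 <= p < N | p \in P) ln (ln p%:R) / p%:R <= B) ->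
  extension_in_Lloc (psi (R := R) Q) 1.
Proof.
move=> HB; exists psi_line; last exact: boundary_psi_line.
apply: Lloc_psi_line => // M M0; have [B hB] := ln1D_bounded M0 invP_cvg HB.
by exists (2 * B) => N; rewrite integral_Hs1// lee_fin ler_wpM2l.
Qed.

Lemma extension_Lq (q q' : R) : 1 < q -> 1 < q' -> q^-1 + q'^-1 = 1 ->
  (exists B : R, forall N, \sum_(0 <= p < N | p \in P) ln p%:R `^ q'^-1 / p%:R <= B) ->
  extension_in_Lloc (psi (R := R) Q) q.
Proof.
move=> q1 q'1 qq' [B HB]; have q0 : 0 < q by rewrite (lt_trans _ q1).
exists psi_line; last first.
  apply: boundary_psi_line; apply: (lnln_bounded_of_power (q' := q')).
    by rewrite (lt_trans _ q'1).
  by exists B.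
apply: Lloc_psi_line => // M M0; exists (B `^ q * (2 / (q - 1))) => N.
apply: (le_trans (integral_Hsq _ N M0 q1 q'1 qq')); rewrite lee_fin.
have S0 : 0 <= \sum_(0 <= p < N | p \in P) ln p%:R `^ q'^-1 / p%:R :> R.
  by rewrite sumr_ge0// => p _; rewrite divr_ge0// powR_ge0.
rewrite ler_wpM2r ?divr_ge0 ?subr_ge0 ?(ltW q1)//.
by apply: (ge0_ler_powR (ltW q0)) => //; rewrite nnegrE // (le_trans S0 (HB N)).
Qed.
End Sufficiency.

(** * The boundary distribution determines the function *)

Section Uniqueness.
Variable R : realType.
Variable Q : set nat.
Notation P := (primeset `\` Q).
Hypothesis invP_cvg : cvgn (series (invP R P)).
Notation mu := (@lebesgue_measure R).

Lemma integrable_cst_itv (e c : R) : mu.-integrable `[e, 1]%classic (EFin \o cst c).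
Proof.
have mc : measurable_fun setT (EFin \o cst c : R -> \bar R).
  by apply/measurable_EFinP; exact: measurable_cst.
apply/integrableP; split; first exact: measurable_funTS mc.
rewrite (eq_integral (cst `|c|%:E))//= integral_cst//.
rewrite lte_mul_pinfty ?abse_ge0//.
have h : (mu `[e, 1%R] < +oo)%E by rewrite lebesgue_measure_itv /=; case: ifP; rewrite ?ltry.
exact: h.
Qed.

Lemma integrable_ReIm (f : R -> R[i]) (H : R -> R) : measC f ->
  (forall t, cabs (f t) <= H t) -> mu.-integrable setT (EFin \o H) ->
  mu.-integrable setT (EFin \o (fun t => complex.Re (f t))) /\
  mu.-integrable setT (EFin \o (fun t => complex.Im (f t))).
Proof.
move=> [m1 m2] fH iH.
have h t : 0 <= H t by apply: le_trans (fH t); exact: cabs_ge0.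
split; apply: (le_integrable measurableT _ _ iH) => //=.
- exact/measurable_EFinP.
- by move=> t _; rewrite lee_fin (ger0_norm (h t)) (le_trans (Re_le_cabs _)).
- exact/measurable_EFinP.
- by move=> t _; rewrite lee_fin (ger0_norm (h t)) (le_trans (Im_le_cabs _)).
Qed.

Lemma integral_bump_sub (f1 f2 : R -> R) a b n :
  mu.-integrable setT (EFin \o f1) -> mu.-integrable setT (EFin \o f2) ->
  (\int[mu]_t (f1 t * bumpfn a b n t))%R = (\int[mu]_t (f2 t * bumpfn a b n t))%R ->
  (\int[mu]_t ((f1 t - f2 t) * bumpfn a b n t))%R = 0.
Proof.
move=> i1 i2 e.
have mB : measurable_fun setT (bumpfn a b n).
  by apply: continuous_measurable_fun; apply: smooth_continuous; exact: smooth_bump.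
have i f : mu.-integrable setT (EFin \o f) ->
    mu.-integrable setT (EFin \o (fun t => f t * bumpfn a b n t)).
  move=> jf; have mf : measurable_fun setT f by case/integrableP: jf => /measurable_EFinP.
  apply: (le_integrable measurableT _ _ jf).
    by apply/measurable_EFinP; exact: measurable_funM.
  move=> t _ /=; rewrite lee_fin normrM ler_piMr//.
  by have /andP[h1 h2] := bump_bounds a b n t; rewrite ger0_norm.
under eq_Rintegral do rewrite mulrBl.
rewrite RintegralB//; [by rewrite e subrr|exact: (i f1)|exact: (i f2)].
Qed.

(** Away from t = 0 the terms of H are at most 1/(p |t|), so psi stays bounded up to
    the line. *)
Lemma cabs_psi_ext_away (e d t : R) : 0 < e -> 0 <= d -> d <= 1 -> e <= t -> t <= 1 ->
  cabs (psi_ext Q (d +i* t)) <= eulerC R P * (8 * (1 + 1) + 3) +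
    eulerC R P * 6 * (e^-1 * limn (series (invP R P))).
Proof.
move=> e0 d0 d1 et t1; have t0 : 0 < t by apply: lt_le_trans et.
have tn0 : t != 0 by rewrite gt_eqF.
have C0 := ltW (eulerC_gt0 R P).
have tM : `|t| <= 1 by rewrite gtr0_norm.
apply: (le_trans (cabs_psi_ext_vert_le invP_cvg d0 d1 tM tn0)).
rewrite lerD2l ler_wpM2l ?mulr_ge0//.
apply: limr_le; first by apply/cvg_ex; exists (Hlim Q t); exact: cvg_Hs.
near=> N; rewrite /Hs /series /=.
apply: (@le_trans _ _ (\sum_(0 <= p < N) e^-1 * invP R P p)).
  apply: ler_sum => p _; apply: (le_trans (hpart_le Q p tn0)).
  by rewrite ler_wpM2r ?invP_ge0// gtr0_norm// lef_pV2.
rewrite -mulr_sumr ler_wpM2l ?invr_ge0 ?(ltW e0)//.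
exact: (series_le_lim N (@invP_ge0 R P) invP_cvg).
Unshelve. all: by end_near. Qed.

(** Against bump functions supported in ]e, 1[ the distribution is also given by the
    pointwise limit, because psi is bounded there.  So g and [psi_line] have the
    same integral over every subinterval. *)
Lemma boundary_ae_eq (r e : R) (g : R -> R[i]) : 1 <= r -> 0 < e -> e < 1 -> Lloc r g ->
  boundary_distribution (psi Q) g ->
  {ae mu, forall t, `]e, 1[%classic t -> g t = psi_line Q t}.
Proof.
move=> r1 e0 e1 Lg Bg; pose D : set R := `[e, 1]%classic.
have mD : measurable D by exact: measurable_itv.
have [mg1 mg2 ig] := Lg D (@segment_compact _ e 1).
(* g is only known to be integrable on compact sets *)
pose cut (f : R -> R[i]) t := if t \in D then f t else 0.
have cutE1 f : (fun t => complex.Re (cut f t)) = (fun t => complex.Re (f t)) \_ D.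
  by apply/funext => t; rewrite patchE /cut; case: ifP.
have cutE2 f : (fun t => complex.Im (cut f t)) = (fun t => complex.Im (f t)) \_ D.
  by apply/funext => t; rewrite patchE /cut; case: ifP.
have [mp1 mp2] := measC_psi_line invP_cvg.
have mg : measC (cut g).
  by split; [rewrite cutE1|rewrite cutE2]; apply/(measurable_restrictT _ mD).
have mp : measC (cut (psi_line Q)).
  split; [rewrite cutE1|rewrite cutE2]; apply/(measurable_restrictT _ mD).
    exact: measurable_funTS mp1.
  exact: measurable_funTS mp2.
have mgr : measurable_fun setT (fun t => (cabs (cut g t) `^ r)%:E).
  apply/measurable_EFinP; apply: (measurableT_comp (measurable_powR r)).
  exact: measurable_cabs mg.
have r0 : 0 < r by rewrite (lt_le_trans _ r1).
have i1 : mu.-integrable setT (EFin \o (fun t => 1 + cabs (cut g t) `^ r) \_ D).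
  rewrite -restrict_EFin; apply: (proj1 (@integrable_mkcond _ _ _ mu _ _ _)); first exact: mD.
  have j : mu.-integrable D (fun t => (cabs (cut g t) `^ r)%:E).
    apply/integrableP; split; first exact: measurable_funTS mgr.
    apply: le_lt_trans ig; rewrite le_eqVlt; apply/orP; left; apply/eqP/eq_integral => t tD.
    by rewrite /cut tD gee0_abs ?lee_fin ?powR_ge0.
  have j2 : mu.-integrable D (fun t => (EFin \o cst 1%R) t + (cabs (cut g t) `^ r)%:E)%E.
    by apply: integrableD j; [exact: mD|exact: integrable_cst_itv].
  by apply: eq_integrable j2; first exact: mD.
pose C := eulerC R P * (8 * (1 + 1) + 3) + eulerC R P * 6 * (e^-1 * limn (series (invP R P))).
have i2 : mu.-integrable setT (EFin \o (cst C) \_ D).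
  rewrite -restrict_EFin; apply: (proj1 (@integrable_mkcond _ _ _ mu _ _ _)); first exact: mD.
  exact: integrable_cst_itv.
(* |g| <= 1 + |g|^r because r >= 1 *)
have gi : forall t, cabs (cut g t) <= ((fun t => 1 + cabs (cut g t) `^ r) \_ D) t.
  move=> t; rewrite patchE {1}/cut; case: ifPn => tD; last by rewrite cabs0.
  rewrite /cut tD; have [h|h] := leP (cabs (g t)) 1.
    by rewrite (le_trans h)// lerDl powR_ge0.
  by rewrite (le_trans (le1r_powR (ltW h) r1))// lerDr.
have pj : forall t, cabs (cut (psi_line Q) t) <= (cst C \_ D) t.
  move=> t; rewrite patchE /cut; case: ifPn => [/set_mem|_]; last by rewrite cabs0.
  by rewrite /D /= in_itv /= => /andP[h1 h2]; exact: cabs_psi_ext_away.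
have [ig1 ig2] := integrable_ReIm mg gi i1.
have [ip1 ip2] := integrable_ReIm mp pj i2.
have cutM f a b n t : e < a -> b < 1 -> f t * cbump a b n t = cut f t * cbump a b n t.
  move=> ea b1; rewrite /cut; case: ifPn => // /negP tD.
  rewrite /cbump bump_out ?mulr0// => /= h; apply: tD; apply/mem_set; move: h.
  by rewrite /D /= !in_itv /= => /andP[h1 h2]; rewrite !ltW// ?(lt_trans ea)// (lt_trans h2).
have main a b n : e < a -> a < b -> b < 1 ->
    integralC (fun t => cut g t * cbump a b n t) =
    integralC (fun t => cut (psi_line Q) t * cbump a b n t).
  move=> ea ab b1.
  have -> : (fun t => cut g t * cbump a b n t) = (fun t => g t * cbump a b n t).
    by apply/funext => t; rewrite -cutM.
  have -> : (fun t => cut (psi_line Q) t * cbump a b n t) = (fun t => psi_line Q t * cbump a b n t).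
    by apply/funext => t; rewrite -cutM.
  have /cvgCE h1 := Bg _ (test_cbump a b n).
  apply: cvgC_unique h1 _.
  apply: (boundary_of_bounded invP_cvg (test_cbump a b n) i2) => d t d0 d1 _.
  rewrite patchE; case: ifPn => [/set_mem|/negP tD].
    rewrite /D /= in_itv /= => /andP[h2 h3].
    have /andP[b0 b1'] := bump_bounds a b n t.
    rewrite cabsM cabsR ger0_norm//.
    apply: (@le_trans _ _ (cabs (psi_ext Q (d +i* t)))); first by rewrite ler_piMr ?cabs_ge0.
    by apply: cabs_psi_ext_away => //; exact: ltW.
  rewrite /cbump bump_out ?mulr0 ?cabs0// => /= h; apply: tD; apply/mem_set; move: h.
  by rewrite /D /= !in_itv /= => /andP[h2 h3]; rewrite !ltW// ?(lt_trans ea)// (lt_trans h3).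
have MulE (f : R -> R[i]) a b n t : (complex.Re (f t * cbump a b n t) = complex.Re (f t) * bumpfn a b n t) *
   (complex.Im (f t * cbump a b n t) = complex.Im (f t) * bumpfn a b n t).
  by rewrite cReM cImM /cbump /= !mulr0 subr0 add0r; split=> //; rewrite addr0.
have comp (h1 h2 : R -> R) : mu.-integrable setT (EFin \o h1) -> mu.-integrable setT (EFin \o h2) ->
   (forall a b n, e < a -> a < b -> b < 1 ->
     (\int[mu]_t (h1 t * bumpfn a b n t))%R = (\int[mu]_t (h2 t * bumpfn a b n t))%R) ->
   {ae mu, forall x, `]e, 1[%classic x -> h1 x - h2 x = 0}.
  move=> j1 j2 H.
  have j : mu.-integrable setT (EFin \o (fun x => h1 x - h2 x)).
    exact: (integrableB measurableT j1 j2).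
  apply: (ae_zero_of_integrals j) => a b ea ab b1.
  apply: integral_zero_of_test => // n.
  exact: (integral_bump_sub j1 j2 (H a b n ea ab b1)).
have [|A1 [mA1 A10 hA1]] := comp _ _ ig1 ip1.
  move=> a b n ea ab b1; have := congr1 (@complex.Re R) (main a b n ea ab b1).
  rewrite /integralC /=; under eq_Rintegral do rewrite MulE.
  by under [in RHS]eq_Rintegral do rewrite MulE.
have [|A2 [mA2 A20 hA2]] := comp _ _ ig2 ip2.
  move=> a b n ea ab b1; have := congr1 (@complex.Im R) (main a b n ea ab b1).
  rewrite /integralC /=; under eq_Rintegral do rewrite MulE.
  by under [in RHS]eq_Rintegral do rewrite MulE.
exists (A1 `|` A2); split.
- exact: measurableU.
- by rewrite -A10; exact: (measureU0 mA1 mA2 A20).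
- move=> t /= nt; apply: contrapT => nA; apply: nt => tI.
  have tD : t \in D.
    apply/mem_set; move: tI; rewrite /D /= !in_itv /= => /andP[h1 h2].
    by rewrite !ltW.
  have e1' : complex.Re (cut g t) - complex.Re (cut (psi_line Q) t) = 0.
    by apply: contrapT => h; apply: nA; left; apply: hA1 => /= h'; exact: h (h' tI).
  have e2' : complex.Im (cut g t) - complex.Im (cut (psi_line Q) t) = 0.
    by apply: contrapT => h; apply: nA; right; apply: hA2 => /= h'; exact: h (h' tI).
  apply: eq_ReIm; apply/eqP; rewrite -subr_eq0; apply/eqP.
    by move: e1'; rewrite /cut tD.
  by move: e2'; rewrite /cut tD.
Qed.
End Uniqueness.

(** * Integrable boundary values give convergent prime sums *)

Section Necessity.
Variable R : realType.
Variable Q : set nat.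
Notation P := (primeset `\` Q).
Hypothesis invP_cvg : cvgn (series (invP R P)).
Notation mu := (@lebesgue_measure R).

Lemma measurable_cabs_on (D : set R) (f : R -> R[i]) : measurable D ->
  measurable_fun D (fun t => complex.Re (f t)) ->
  measurable_fun D (fun t => complex.Im (f t)) ->
  measurable_fun D (fun t => cabs (f t)).
Proof.
move=> mD m1 m2.
have mc : measC (fun t => if t \in D then f t else 0).
  split.
    rewrite (_ : (fun t => _) = (fun t => complex.Re (f t)) \_ D).
      exact/(measurable_restrictT _ mD).
    by apply/funext => t; rewrite patchE; case: ifP.
  rewrite (_ : (fun t => _) = (fun t => complex.Im (f t)) \_ D).
    exact/(measurable_restrictT _ mD).
  by apply/funext => t; rewrite patchE; case: ifP.
have mc' := measurable_cabs mc.
have mcD : measurable_fun D (fun t => cabs (if t \in D then f t else 0)).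
  exact: measurable_funTS mc'.
by apply: eq_measurable_fun mcD => t tD; rewrite tD.
Qed.

Variables (r : R) (g : R -> R[i]).
Hypothesis r1 : 1 <= r.
Hypothesis Lg : Lloc r g.
Hypothesis Bg : boundary_distribution (psi Q) g.

Lemma measurable_cabs_Lloc (e : R) : 0 < e -> measurable_fun `]e, 1[%classic (fun t => cabs (g t)).
Proof.
move=> e0; have [m1 m2 _] := Lg (@segment_compact _ e 1).
have sub : `]e, 1[%classic `<=` (`[e, 1]%classic : set R).
  by move=> t; rewrite /= !in_itv /= => /andP[h1 h2]; rewrite !ltW.
have mD : measurable (`[e, 1]%classic : set R) by exact: measurable_itv.
apply: measurable_cabs_on; first exact: measurable_itv.
- exact: measurable_funS mD sub m1.
- exact: measurable_funS mD sub m2.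
Qed.

(** The term 11 bounds the constant 8 |t| + 3 of [cabs_psi_ext_ge] for |t| <= 1. *)
Lemma cosine_sum_le_ae (e : R) N : 0 < e -> e < 1 ->
  {ae mu, forall t, `]e, 1[%classic t ->
    eulerR_inf R Q * Cs Q N t / t <= cabs (g t) + eulerC R P * 11}.
Proof.
move=> e0 e1; have [A [mA A0 hA]] := boundary_ae_eq invP_cvg r1 e0 e1 Lg Bg.
exists A; split=> // t /= nt; apply: hA => /= h; apply: nt => tI; rewrite h//.
move: tI; rewrite in_itv /= => /andP[et t1]; have t0 : 0 < t by apply: lt_trans et.
have C0 := ltW (eulerC_gt0 R P).
have tn0 : t != 0 by rewrite gt_eqF.
have := cabs_psi_ext_ge invP_cvg N tn0; rewrite gtr0_norm// => /le_trans; apply.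
by rewrite lerD2l ler_wpM2l//; lra.
Qed.

(** The integrals are cut off at a point that lies below 1 / (2 ln p) for every
    prime p < N, so that the lower bounds for cosine integrals apply to all of
    them at once, while the weights stay bounded on the interval of integration. *)
Definition cutoff (N : nat) : R := (2 * (1 + ln N%:R))^-1.

Lemma cutoff_gt0 N : 0 < cutoff N.
Proof. by rewrite /cutoff invr_gt0 mulr_gt0// ltr_pwDl// ln_nat_ge0. Qed.

Lemma cutoff_lt1 N : cutoff N < 1.
Proof. by rewrite /cutoff invf_lt1 ?mulr_gt0 ?ltr_pwDl ?ln_nat_ge0//; have := ln_nat_ge0 R N; lra. Qed.

Lemma cutoff_le N p : (p < N)%N -> prime p -> cutoff N <= (2 * ln p%:R)^-1.
Proof.
move=> pN pp; have l0 : 0 < ln p%:R :> R.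
  by apply: lt_le_trans (ln_ge_ln2 _ pp); exact: ln2_gt0.
have p0 := prime_gt0 pp.
have lN : ln p%:R <= ln N%:R :> R.
  by rewrite ler_ln ?posrE ?ltr0n ?(leq_trans p0 (ltnW pN))// ler_nat ltnW.
rewrite /cutoff lef_pV2 ?posrE ?mulr_gt0 ?ltr_pwDl ?ln_nat_ge0//.
by rewrite ler_pM2l//; lra.
Qed.

(** Integrate [cosine_sum_le_ae] against W over ]cutoff N, 1[ and exchange the sum
    with the integral.  Here w p is the mass, up to the constants k and K3, that the
    weight W gives to the prime p. *)
Lemma weighted_sum_bounded (W : R -> R) (w : nat -> R) (k K K3 : R) :
  measurable_fun setT W -> (forall t, 0 <= W t) -> 0 <= k -> 0 <= K3 ->
  (forall N p, (p < N)%N -> P p ->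
    ((w p - K3)%:E <=
      k%:E * \int[mu]_(t in `]cutoff N, 1%R[) ((1 - cos (t * ln p%:R)) / t * W t)%:E)%E) ->
  (forall N, (\int[mu]_(t in `]cutoff N, 1%R[)
     ((cabs (g t) + eulerC R P * 11) * W t)%:E <= K%:E)%E) ->
  exists B : R, forall N, \sum_(0 <= p < N | p \in P) w p / p%:R <= B.
Proof.
move=> mW W0 k0 K30 Hw HK; set G := eulerR_inf R Q; have G0 : 0 < G by exact: expR_gt0.
exists (k * (G^-1 * K) + K3 * limn (series (invP R P))) => N.
set e := cutoff N; have e0 : 0 < e := cutoff_gt0 N; have e1 : e < 1 := cutoff_lt1 N.
pose D : set R := `]e, 1[%classic; have mD : measurable D by exact: measurable_itv.
have posD t : D t -> 0 < t by rewrite /D /= in_itv /= => /andP[h _]; apply: lt_trans h.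
have mk p : measurable_fun setT (fun t : R => ((1 - cos (t * ln p%:R)) / t * W t)%:E).
  by apply/measurable_EFinP; apply: measurable_funM => //; exact: measurable_coskerV.
have k1 p t : D t -> (0 <= ((1 - cos (t * ln p%:R)) / t * W t)%:E)%E.
  move=> /posD t0.
  by rewrite lee_fin mulr_ge0// divr_ge0 ?one_sub_cos_ge0// ltW.
have mCs : measurable_fun setT (fun t : R => (Cs Q N t / t * W t)%:E).
  apply/measurable_EFinP; apply: measurable_funM => //; apply: measurable_funM; last exact: measurable_invR.
  apply: measurable_sum => p; rewrite /cospart; case: (p \in P); last exact: measurable_cst.
  apply: measurable_funM; last exact: measurable_cst.
  apply: continuous_measurable_fun => t; apply: cvgB; first exact: cvg_cst.
  have c : {for t, continuous (fun x : R => x * ln p%:R)} by apply: cvgM => //; exact: cvg_cst.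
  exact: (cvg_comp _ _ c (@continuous_cos R _)).
have CsE : (\int[mu]_(t in D) (Cs Q N t / t * W t)%:E =
  \sum_(0 <= p < N | p \in P) (p%:R^-1)%:E * \int[mu]_(t in D) ((1 - cos (t * ln p%:R)) / t * W t)%:E)%E.
  transitivity (\int[mu]_(t in D) \sum_(0 <= p < N) (if p \in P then
      (p%:R^-1)%:E * ((1 - cos (t * ln p%:R)) / t * W t)%:E else 0)%E)%E.
    apply: eq_integral => t _; rewrite /Cs /series /= mulr_suml mulr_suml -sumEFin.
    apply: eq_bigr => p _; rewrite /cospart /cosker; case: ifP => _; last by rewrite !mul0r.
    by rewrite -EFinM; congr EFin; ring.
  rewrite ge0_integral_sum//; last 2 first.
  - move=> p; case: (p \in P); last exact: measurable_cst.
    apply: emeasurable_funM; first exact: measurable_cst.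
    exact: measurable_funTS (mk p).
  - move=> p t tD; case: ifP => // _; rewrite mule_ge0 ?lee_fin ?invr_ge0//.
    by rewrite -lee_fin; exact: k1.
  rewrite [RHS]big_mkcond; apply: eq_bigr => p _; case: ifP => _; last by rewrite integral0.
  rewrite ge0_integralZl_EFin ?invr_ge0//; first by move=> t; exact: k1.
  exact: measurable_funTS (mk p).
have up : (\int[mu]_(t in D) (Cs Q N t / t * W t)%:E <= (G^-1 * K)%:E)%E.
  apply: (@le_trans _ _ ((G^-1)%:E * \int[mu]_(t in D) ((cabs (g t) + eulerC R P * 11) * W t)%:E)%E); last first.
    by rewrite [leRHS]EFinM lee_wpmul2l ?lee_fin ?invr_ge0 ?(ltW G0)//; exact: HK.
  have mg : measurable_fun D (fun t => ((cabs (g t) + eulerC R P * 11) * W t)%:E).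
    apply/measurable_EFinP; apply: measurable_funM; last exact: measurable_funTS mW.
    by apply: measurable_funD; [exact: measurable_cabs_Lloc|exact: measurable_cst].
  have C0 := ltW (eulerC_gt0 R P).
  have g0 t : 0 <= (cabs (g t) + eulerC R P * 11) * W t.
    by apply: mulr_ge0 => //; apply: addr_ge0; [exact: cabs_ge0|exact: mulr_ge0].
  rewrite -ge0_integralZl_EFin ?invr_ge0 ?(ltW G0)//; last 1 first.
  - by move=> t _; rewrite lee_fin.
  apply: ae_ge0_le_integral => //.
  - move=> t /posD t0; rewrite lee_fin mulr_ge0// divr_ge0 ?(ltW t0)//.
    by rewrite /Cs /series /= sumr_ge0// => p _; exact: cospart_ge0.
  - exact: measurable_funTS mCs.
  - by move=> t _; rewrite mule_ge0// lee_fin ?invr_ge0 ?(ltW G0).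
  - by apply: emeasurable_funM => //; exact: measurable_cst.
  - have [A [mA A0 hA]] := cosine_sum_le_ae N e0 e1.
    exists A; split=> // t /= nt; apply: hA => /= h; apply: nt => tI.
    rewrite -EFinM lee_fin mulrA ler_wpM2r// ler_pdivlMl//.
    by apply: le_trans (h tI); rewrite mulrA.
apply: (@le_trans _ _ (\sum_(0 <= p < N | p \in P) ((w p - K3) / p%:R + K3 * p%:R^-1))).
  by apply: ler_sum => p _; rewrite -mulrDl subrK.
rewrite big_split /= lerD//; last first.
  by rewrite -mulr_sumr ler_wpM2l//; exact: (invP_bounded invP_cvg).
rewrite -lee_fin EFinM -sumEFin.
apply: (@le_trans _ _ (k%:E * \int[mu]_(t in D) (Cs Q N t / t * W t)%:E)%E); last first.
  by rewrite lee_wpmul2l ?lee_fin.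
have kI p : (0 <= \int[mu]_(t in D) ((1 - cos (t * ln p%:R)) / t * W t)%:E)%E.
  by apply: integral_ge0 => t; exact: k1.
rewrite CsE ge0_sume_distrr; last by move=> p _; rewrite mule_ge0 ?lee_fin ?invr_ge0.
rewrite big_nat_cond [leRHS]big_nat_cond; apply: lee_sum => p /andP[/andP[_ pN] /set_mem pP].
rewrite EFinM muleC muleCA lee_wpmul2l ?lee_fin ?invr_ge0//.
exact: Hw.
Qed.

Lemma lnln_bounded_of_L1 : r = 1 ->
  exists B : R, forall N, \sum_(0 <= p < N | p \in P) ln (ln p%:R) / p%:R <= B.
Proof.
move=> rE; have C0 := ltW (eulerC_gt0 R P).
have [m1 m2 ig] := Lg (@segment_compact _ 0 1); rewrite rE in ig.
have mD : measurable (`[0, 1]%classic : set R) by exact: measurable_itv.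
have mg : measurable_fun (`[0, 1]%classic : set R) (fun t => cabs (g t)).
  exact: measurable_cabs_on.
pose I := (\int[mu]_(t in `[0%R, 1%R]) (cabs (g t))%:E)%E.
have IE : (\int[mu]_(t in `[0%R, 1%R]) (complex.Re `|g t| `^ 1)%:E)%E = I.
  by apply: eq_integral => t _; rewrite powRr1// cabs_ge0.
have I0 : (0 <= I)%E by apply: integral_ge0 => t _; rewrite lee_fin cabs_ge0.
have Ifin : I \is a fin_num by rewrite ge0_fin_numE// -IE.
have mu1 : mu (`[0, 1]%classic : set R) = 1%E.
  by rewrite lebesgue_measure_itv /= lte_fin ltr01 oppr0 adde0.
apply: (@weighted_sum_bounded (cst 1) (fun p => ln (ln p%:R)) 1 (fine I + eulerC R P * 11) 2) => //.
- move=> N p pN [pp _]; rewrite mul1e.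
  have l0 : 0 < ln p%:R :> R by apply: lt_le_trans (ln_ge_ln2 _ pp); exact: ln2_gt0.
  apply: (cos_integral_ge_ln l0 (cutoff_gt0 N)).
  apply: (le_trans (cutoff_le pN pp)); rewrite lef_pV2 ?posrE ?mulr_gt0//; lra.
- move=> N.
  apply: (@le_trans _ _ (\int[mu]_(t in `[0%R, 1%R]) ((cabs (g t))%:E + (eulerC R P * 11)%:E))%E).
    under eq_integral do rewrite mulr1 EFinD.
    apply: ge0_subset_integral => //.
    + by apply: emeasurable_funD; [exact/measurable_EFinP|exact: measurable_cst].
    + by move=> t _; rewrite adde_ge0 ?lee_fin ?cabs_ge0// mulr_ge0.
    + by move=> t; rewrite /= !in_itv /= => /andP[h1 h2]; rewrite !ltW// (lt_trans (cutoff_gt0 N)).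
  rewrite ge0_integralD//; last 3 first.
  + by move=> t _; rewrite lee_fin cabs_ge0.
  + exact/measurable_EFinP.
  + by move=> t _; rewrite lee_fin mulr_ge0.
  by rewrite integral_cst//= mu1 mule1 EFinD fineK.
Qed.

(** The weight t^(-a), a = 1/q', and [cos_integral_ge_powR].  Young's inequality
    leaves t^(-b) with b = a r', which is integrable at 0 exactly because r > q
    makes b < 1. *)
Lemma power_bounded_of_Lr (q q' : R) : 1 < q -> 1 < q' -> q^-1 + q'^-1 = 1 -> q < r ->
  exists B : R, forall N, \sum_(0 <= p < N | p \in P) ln p%:R `^ q'^-1 / p%:R <= B.
Proof.
move=> q1 q'1 qq' qr; have C0 := ltW (eulerC_gt0 R P).
have q0 : 0 < q by apply: lt_trans q1.
have q'0 : 0 < q' by apply: lt_trans q'1.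
have r0 : 0 < r by apply: lt_trans qr.
have rr1 : 0 < r - 1 by rewrite subr_gt0 (lt_trans q1).
pose a := q'^-1; have a0 : 0 < a by rewrite invr_gt0.
pose r' := r / (r - 1); have r'0 : 0 < r' by rewrite divr_gt0.
have rr' : r^-1 + r'^-1 = 1 by rewrite /r'; field; rewrite !lt0r_neq0.
have r'1 : 1 <= r' by rewrite ler_pdivlMr// mul1r gerBl.
pose b := a * r'; have b0 : 0 < b by rewrite mulr_gt0.
have b1 : b < 1.
  rewrite /b -ltr_pdivlMr// div1r.
  have h : r^-1 < q^-1 by rewrite ltf_pV2.
  by rewrite /a; lra.
have ab : a <= b by rewrite ler_peMr// ltW.
have [m1 m2 ig] := Lg (@segment_compact _ 0 1).
have mD : measurable (`[0, 1]%classic : set R) by exact: measurable_itv.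
have mg : measurable_fun (`[0, 1]%classic : set R) (fun t => cabs (g t)).
  exact: measurable_cabs_on.
pose I := (\int[mu]_(t in `[0%R, 1%R]) (cabs (g t) `^ r)%:E)%E.
have I0 : (0 <= I)%E by apply: integral_ge0 => t _; rewrite lee_fin powR_ge0.
have Ifin : I \is a fin_num by rewrite ge0_fin_numE.
have mgr : measurable_fun (`[0, 1]%classic : set R) (fun t => (cabs (g t) `^ r)%:E).
  apply/measurable_EFinP; apply: (measurable_comp measurableT _ (measurable_powR r)) => //.
have mW (c : R) : measurable_fun setT (fun t : R => t `^ c) by exact: measurable_powR.
pose c := 1 + eulerC R P * 11; have c0 : 0 <= c by rewrite addr_ge0// mulr_ge0.
apply: (@weighted_sum_bounded (fun t => t `^ (- a)) (fun p => ln p%:R `^ a) 64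
   (fine I + c * (1 - b)^-1) (ln 4 `^ a)) => //.
- by move=> t; exact: powR_ge0.
- exact: powR_ge0.
- move=> N p pN [pp _].
  have l0 : 0 < ln p%:R :> R by apply: lt_le_trans (ln_ge_ln2 _ pp); exact: ln2_gt0.
  (* the lower bound needs ln p >= 1, which fails at p = 2; the constant (ln 4)^a
     absorbs the primes below 4 *)
  have [p4|p4] := leqP 4 p; last first.
    apply: (@le_trans _ _ 0%E).
      rewrite lee_fin subr_le0; apply: (ge0_ler_powR (ltW a0)); rewrite ?nnegrE ?(ltW l0)//.
        by rewrite ln_ge0// ler1n.
      by rewrite ler_ln ?posrE ?ltr0n ?(prime_gt0 pp)// ler_nat ltnW.
    rewrite mule_ge0//; apply: integral_ge0 => t; rewrite /= in_itv /= => /andP[h _].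
    have t0 : 0 < t by apply: lt_trans h; exact: cutoff_gt0.
    by rewrite lee_fin mulr_ge0 ?powR_ge0// divr_ge0 ?one_sub_cos_ge0// ltW.
  apply: (@le_trans _ _ (64%:E * (ln p%:R `^ a / 64)%:E)%E).
    rewrite -EFinM lee_fin mulrCA divff ?mulr1// gerBl; exact: powR_ge0.
  rewrite lee_wpmul2l//.
  exact: (cos_integral_ge_powR a0 (ln_ge1 _ p4) (cutoff_gt0 N) (cutoff_le pN pp)).
- move=> N; set e := cutoff N; have e0 : 0 < e := cutoff_gt0 N; have e1 : e < 1 := cutoff_lt1 N.
  pose E : set R := `[e, 1]%classic; have mE : measurable E by exact: measurable_itv.
  have EI : E `<=` `[0, 1]%classic.
    by move=> t; rewrite /E /= !in_itv /= => /andP[h ->]; rewrite (le_trans (ltW e0)).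
  have mgE : measurable_fun E (fun t => cabs (g t)) by exact: measurable_funS mD EI mg.
  have mgrE : measurable_fun E (fun t => (cabs (g t) `^ r)%:E) by exact: measurable_funS mD EI mgr.
  have mWE (d : R) : measurable_fun E (fun t => t `^ d) by exact: measurable_funTS (mW d).
  have mWE' (d : R) : measurable_fun E (fun t => (t `^ d)%:E) by exact/measurable_EFinP.
  apply: (@le_trans _ _ (\int[mu]_(t in E) ((cabs (g t) `^ r)%:E + c%:E * (t `^ (- b))%:E))%E).
    apply: (@le_trans _ _ (\int[mu]_(t in E) ((cabs (g t) + eulerC R P * 11) * t `^ (- a))%:E)%E).
      apply: ge0_subset_integral => //.
      + apply/measurable_EFinP; apply: measurable_funM; last exact: (mWE (- a)).
        by apply: measurable_funD => //; exact: measurable_cst.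
      + move=> t _; rewrite lee_fin; apply: mulr_ge0; last exact: powR_ge0.
        by apply: addr_ge0; [exact: cabs_ge0|exact: mulr_ge0].
      + by move=> t; rewrite /E /= !in_itv /= => /andP[h1 h2]; rewrite !ltW.
    apply: ge0_le_integral => //.
    + move=> t _; rewrite lee_fin; apply: mulr_ge0; last exact: powR_ge0.
      by apply: addr_ge0; [exact: cabs_ge0|exact: mulr_ge0].
    + apply/measurable_EFinP; apply: measurable_funM; last exact: (mWE (- a)).
      by apply: measurable_funD => //; exact: measurable_cst.
    + apply: emeasurable_funD => //; apply: emeasurable_funM => //; exact: (mWE' (- b)).
    + move=> t; rewrite /E /= in_itv /= => /andP[et t1]; rewrite -EFinM -EFinD lee_fin.
      have t0 : 0 < t by apply: lt_le_trans et.
      have y := conjugate_powR (cabs_ge0 (g t)) (powR_ge0 t (- a)) r0 r'0 rr'.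
      have y1 : cabs (g t) `^ r / r <= cabs (g t) `^ r.
        by rewrite ler_piMr ?powR_ge0// invf_le1// ltW// (lt_trans q1).
      have y2 : (t `^ (- a)) `^ r' / r' <= t `^ (- b).
        by rewrite -powRrM mulNr ler_piMr ?powR_ge0// invf_le1.
      have y3 : t `^ (- a) <= t `^ (- b).
        have e' d : t `^ (- d) = t^-1 `^ d.
          by rewrite -[t^-1](powR_inv1 (ltW t0)) -powRrM mulN1r.
        by rewrite !e' ler_powR// invf_ge1.
      have y4 : eulerC R P * 11 * t `^ (- a) <= eulerC R P * 11 * t `^ (- b).
        by rewrite ler_wpM2l// mulr_ge0.
      rewrite mulrDl /c mulrDl mul1r addrA lerD// (le_trans y)// lerD//.
  rewrite ge0_integralD//; last 3 first.
  + by move=> t _; rewrite lee_fin powR_ge0.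
  + by move=> t _; rewrite mule_ge0 ?lee_fin ?powR_ge0.
  + by apply: emeasurable_funM => //; exact: (mWE' (- b)).
  rewrite ge0_integralZl_EFin//; last 2 first.
  + by move=> t _; rewrite lee_fin powR_ge0.
  + exact: (mWE' (- b)).
  have -> : (fine I + c / (1 - b))%:E = (I + c%:E * ((1 - b)^-1)%:E)%E.
    by rewrite -EFinM -[in RHS](fineK Ifin) -EFinD.
  apply: leeD.
    by apply: ge0_subset_integral => // t _; rewrite lee_fin powR_ge0.
  by rewrite lee_wpmul2l ?lee_fin//; exact: integral_powR_le.
Qed.
End Necessity.

Local Close Scope complex_scope.

Theorem theorem5 (R : realType) (Q : set nat) (hQ : Q `<=` primeset)
  (hsum : (\sum_(p <oo | p \in primeset `\` Q) ((p%:R : R)^-1)%:E < +oo)%E) :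
  (extension_in_Lloc (psi (R := R) Q) 1 <->
   (\sum_(p <oo | p \in primeset `\` Q)
      (ln (ln (p%:R : R)) / p%:R)%:E < +oo)%E) /\
  (forall q q' : R, 1 < q -> 1 < q' -> q^-1 + q'^-1 = 1 ->
    ((\sum_(p <oo | p \in primeset `\` Q)
        (ln (p%:R : R) `^ q'^-1 / p%:R)%:E < +oo)%E ->
     extension_in_Lloc (psi (R := R) Q) q) /\
    ((\sum_(p <oo | p \in primeset `\` Q)
        (ln (p%:R : R) `^ q'^-1 / p%:R)%:E = +oo)%E ->
     forall r : R, q < r -> ~ extension_in_Lloc (psi (R := R) Q) r)).
Proof.
have invP_cvg := cvg_invP_of_sum hsum.
have lnln := @eseries_lty_bounded R (fun p => ln (ln p%:R) / p%:R) (primeset `\` Q) 4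
  (fun p p4 _ => lnln_ge0 R p4).
have pow_ge0 (a : R) p : (0 <= p)%N -> (primeset `\` Q) p -> 0 <= ln p%:R `^ a / p%:R.
  by move=> _ _; rewrite divr_ge0// powR_ge0.
split; first (rewrite lnln; split).
- by move=> [g Lg Bg]; exact: (lnln_bounded_of_L1 invP_cvg (lexx 1) Lg Bg).
- exact: extension_L1.
move=> q q' q1 q'1 qq'; split.
  move=> /(eseries_lty_bounded (pow_ge0 q'^-1)); exact: extension_Lq.
move=> /(eseries_y_unbounded (pow_ge0 q'^-1)) unb r qr [g Lg Bg]; apply: unb.
have r1 : 1 <= r by rewrite ltW// (lt_trans q1).
exact: (power_bounded_of_Lr invP_cvg r1 Lg Bg q1 q'1 qq' qr).
Qed.
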